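(* Let $x=z+1/z$ and let $y(z)$ be an analytic function on a domain in $\mathbb{C}$ containing $z=\pm1$ with $y'(\pm1)\ne0$. For $g\geq2$ the symplectic invariants $F^g$ of the curve $(x,y)$ satisfy $$F^g=\frac{1}{2-2g}\,(1-\mathcal{D}^2)\,y(\mathcal{D})\left\{N^g_1(m)\right\}_{m=-1}.$$
   Context: The operator $\mathcal{D}$ acts on functions $f:\mathbb{Z}\to\mathbb{C}$ by $\mathcal{D}f(m)=f(m+1)$; for a polynomial $p(z)=\sum p_iz^i$ set $p(\mathcal{D})\{f(m)\}_{m=a}=\sum p_i f(a+i)$. For $y$ analytic near $\pm1$ and $N\ge0$, let $y^{(N)}(z)$ be the polynomial of the form $\sum_{k=0}^N(a_k+z\,c_k)(1-z^2)^k$, $a_k,c_k\in\mathbb{C}$, that agrees with $y$ at $z=1$ and $z=-1$ up to and including $N$-th derivatives. Expressions $q(\mathcal{D})y(\mathcal{D})\{f(m)\}_{m=a}$, with $q$ a polynomial and $f$ a quasi-polynomial depending on the parity of $m$, mean $(q\cdot y^{(N)})(\mathcal{D})\{f(m)\}_{m=a}$ for any sufficiently large $N$; this is independent of $N$ since $(1-\mathcal{D}^2)^k$ annihilates $f$ for large $k$. Eynard-Orantin invariants of a curve $x=z+1/z$, $y=y(z)$ on $\mathbb{P}^1$ with coordinate $z$, where $y$ is analytic near $z=\pm1$ and $y'(\pm1)\ne0$: the zeros of $dx$ are $z=\pm1$, and near each of them the point $\hat z\neq z$ with $x(\hat z)=x(z)$ is $\hat z=1/z$. Put $\omega^0_1=y\,dx$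 and $\omega^0_2=B(w,z)=\frac{dw\,dz}{(w-z)^2}$. For $2g-2+(n+1)>0$, with $S=\{1,\dots,n\}$ and $z_I=(z_i)_{i\in I}$, define recursively $$\omega^g_{n+1}(z_0,z_S)=\sum_{\alpha=\pm1}\operatorname*{Res}_{z=\alpha}K(z_0,z)\Big[\omega^{g-1}_{n+2}(z,\hat z,z_S)+\sum_{\substack{g_1+g_2=g\\ I\sqcup J=S}}\omega^{g_1}_{|I|+1}(z,z_I)\,\omega^{g_2}_{|J|+1}(\hat z,z_J)\Big],$$ where terms containing a factor $\omega^0_1$ are omitted from the inner sum, $\omega^{-1}_{m}=0$, and $$K(z_0,z)=\frac{-\int_{\hat z}^{z}B(z_0,z')}{2\,(y(z)-y(\hat z))\,dx(z)}.$$ For $g\ge2$ the symplectic invariant is defined by $(2g-2)F^g=\sum_{\alpha=\pm1}\operatorname*{Res}_{z=\alpha}\Phi(z)\,\omega^g_1(z)$, where $\Phi$ is any local primitive near each $\alpha$ of $y\,dx$, i.e. $d\Phi=y\,dx$ (the choice of constants is immaterial). For $g\ge1$ define $N^g_1(b)$ for positive integers $b$ by the expansion around $z=0$: $\omega_1^g=\sum_{b>0}b\,N^g_1(b)\,z^{b-1}dz$. $N^g_1$ is given by one polynomial in $b^2$ for $b$ even and another for $b$ odd; it is evaluated at arbitrary integers (including $0$ and negative ones) by evaluating the polynomial for the corresponding parity. *)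

(* Defs.v *)
From Stdlib Require Export Reals ZArith List.
From Stdlib Require Import Lra Lia ClassicalEpsilon.
From Coquelicot Require Export Coquelicot.
Import ListNotations.
Open Scope C_scope.

Definition connected (U : C -> Prop) : Prop :=
  forall A B : C -> Prop, open A -> open B ->
    (forall z, U z -> A z \/ B z) ->
    (forall z, U z -> A z -> B z -> False) ->
    (exists z, U z /\ A z) -> (exists z, U z /\ B z) -> False.

Definition is_domain (U : C -> Prop) : Prop := open U /\ connected U.

Definition analytic_at (f : C -> C) (z0 : C) : Prop :=
  exists (a : nat -> C) (r : R), (0 < r)%R /\
    forall z, (Cmod (z - z0) < r)%R -> is_pseries a (z - z0) (f z).

(* [c] is the residue at [z0] of a function meromorphic at [z0]: its Laurent
   series on a punctured disc is [(z - z0)^-(k+1)] times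
   [a 0 + a 1 (z - z0) + ...], so that [a k] is the coefficient of
   [(z - z0)^-1].  The value of the function at [z0] itself is irrelevant. *)
Definition is_residue (f : C -> C) (z0 c : C) : Prop :=
  exists (k : nat) (a : nat -> C) (r : R), (0 < r)%R /\
    (forall z, (0 < Cmod (z - z0) < r)%R ->
       is_pseries a (z - z0) ((z - z0) ^ (S k) * f z)) /\
    c = a k.

Definition Res (f : C -> C) (z0 : C) : C :=
  epsilon (A := C) (inhabits (RtoC 0)) (is_residue f z0).

Definition sum_Res (f : C -> C) : C := Res f 1 + Res f (-1).

(* Integral of [h dz] along the straight segment from [p] to [q]. *)
Definition seg_int (h : C -> C) (p q : C) : C :=
  (q - p) * @RInt C_R_CompleteNormedModule
              (fun t : R => h (p + RtoC t * (q - p))) 0%R 1%R.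

(* A differential is represented by its coefficient with respect to the
   differentials of its arguments.  Thus [dx] is [dx/dz], the coefficient of
   [B] is the one of [dw dz], and since the coefficient of [d zhat] is taken
   with respect to [dz], each differential in which [hat z] is substituted
   picks up the factor [dhat z = d zhat / dz]. *)
Definition xcurve (z : C) : C := z + / z.
Definition dx (z : C) : C := C_derive xcurve z.
Definition hat (z : C) : C := / z.
Definition dhat (z : C) : C := C_derive hat z.

Definition Bker (w z : C) : C := / (w - z) ^ 2.

(* Coefficient of [dz0 / dz]. *)
Definition Kker (y : C -> C) (z0 z : C) : C :=
  - seg_int (Bker z0) (hat z) z / (2 * (y z - y (hat z)) * dx z).

Definition csum (l : list C) : C := fold_right Cplus 0 l.

(* All the ordered pairs (z_I, z_J) with I and J complementary sets of
   positions in the list. *)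
Fixpoint splits (l : list C) : list (list C * list C) :=
  match l with
  | [] => [([], [])]
  | z :: l' =>
      flat_map (fun IJ => [(z :: fst IJ, snd IJ); (fst IJ, z :: snd IJ)])
               (splits l')
  end.

(* The pair (g, z_I) labels the factor omega^0_1. *)
Definition unstable01 (g : nat) (zI : list C) : bool :=
  match g, zI with O, [] => true | _, _ => false end.

(* The bracket of the recursion, as the coefficient of [dz dz]; [W g zs] stands
   for omega^g_n at the list [zs] of its n arguments. *)
Definition bracket (W : nat -> list C -> C) (g : nat) (zS : list C) (z : C) : C :=
  (match g with
   | O => RtoC 0
   | S g' => W g' (z :: hat z :: zS) * dhat z
   end)
  + csum (flat_map (fun g1 =>
      map (fun IJ =>
             let g2 := (g - g1)%nat in
             let zI := fst IJ in
             let zJ := snd IJ in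
             if (unstable01 g1 zI || unstable01 g2 zJ)%bool then RtoC 0
             else W g1 (z :: zI) * (W g2 (hat z :: zJ) * dhat z))
          (splits zS))
      (seq 0 (S g))).

Definition eo_step (y : C -> C) (W : nat -> list C -> C)
    (g : nat) (zs : list C) : C :=
  match g, zs with
  | _, [] => 0
  | O, [z] => y z * dx z
  | O, [w; z] => Bker w z
  | _, z0 :: zS => sum_Res (fun z => Kker y z0 z * bracket W g zS z)
  end.

(* omega^g_n(z_1, ..., z_n) is [omega y g [z_1; ...; z_n]].  It is the solution
   of the recursion [omega_rec] below; [2 g + n] unfoldings are enough because
   [2 g + n] decreases at each recursive call. *)
Definition omega (y : C -> C) (g : nat) (zs : list C) : C :=
  Nat.iter (2 * g + length zs) (eo_step y) (fun _ _ => 0) g zs.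

(* [Phi] is a primitive of [y dx] on a disc around [z0]. *)
Definition local_primitive (y Phi : C -> C) (z0 : C) : Prop :=
  exists r : R, (0 < r)%R /\
    forall z, (Cmod (z - z0) < r)%R -> is_derive Phi z (y z * dx z).

Definition symplectic_invariant (y Phi : C -> C) (g : nat) : C :=
  / RtoC (2 * INR g - 2) * sum_Res (fun z => Phi z * omega y g [z]).

(* Polynomials are coefficient lists, constant term first. *)
Definition poly := list C.

Fixpoint peval (p : poly) (z : C) : C :=
  match p with [] => 0 | c :: p' => c + z * peval p' z end.

Fixpoint padd (p q : poly) : poly :=
  match p, q with
  | [], _ => q
  | _, [] => p
  | c :: p', d :: q' => (c + d) :: padd p' q'
  end.

Fixpoint pmul (p q : poly) : poly :=
  match p with
  | [] => []
  | c :: p' => padd (map (Cmult c) q) (RtoC 0 :: pmul p' q)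
  end.

Fixpoint ppow (p : poly) (k : nat) : poly :=
  match k with O => [RtoC 1] | S k' => pmul p (ppow p k') end.

Definition one_minus_sq : poly := [RtoC 1; RtoC 0; RtoC (-1)].

(* [pD p f a] is p(D){f(m)}_{m=a} = sum_i p_i f(a+i). *)
Fixpoint pD (p : poly) (f : Z -> C) (a : Z) : C :=
  match p with [] => 0 | c :: p' => c * f a + pD p' f (a + 1)%Z end.

Definition derive_n (n : nat) (f : C -> C) : C -> C := Nat.iter n C_derive f.

Definition is_truncation (y : C -> C) (N : nat) (p : poly) : Prop :=
  (exists a c : nat -> C,
     p = fold_right padd []
           (map (fun k => pmul [a k; c k] (ppow one_minus_sq k))
                (seq 0 (S N)))) /\
  (forall j : nat, (j <= N)%nat ->
     derive_n j (peval p) 1 = derive_n j y 1 /\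
     derive_n j (peval p) (-1) = derive_n j y (-1)).

Definition truncation (y : C -> C) (N : nat) : poly :=
  epsilon (A := poly) (inhabits []) (is_truncation y N).

(* Quasi-polynomials which are given, on each parity class, by a polynomial in
   the square of the variable. *)
Definition is_even_quasi_poly (f : Z -> C) : Prop :=
  exists p0 p1 : poly, forall m : Z,
    f m = peval (if Z.even m then p0 else p1) (RtoC (IZR (m * m))).

(* omega^g_1 = sum_{b > 0} b N(b) z^(b-1) dz near z = 0; the sum is indexed by
   k = b - 1.  [N] is unique, since the two polynomials are determined by the
   values at positive integers. *)
Definition is_N1 (y : C -> C) (g : nat) (N : Z -> C) : Prop :=
  is_even_quasi_poly N /\
  exists r : R, (0 < r)%R /\
    forall z, (Cmod z < r)%R ->
      is_pseries (fun k : nat => RtoC (INR (S k)) * N (Z.of_nat (S k)))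
                 z (omega y g [z]).

Definition N1 (y : C -> C) (g : nat) : Z -> C :=
  epsilon (A := Z -> C) (inhabits (fun _ => RtoC 0)) (is_N1 y g).

Lemma splits_length (l I J : list C) :
  In (I, J) (splits l) -> (length I + length J = length l)%nat.
Proof.
  revert I J; induction l as [|z l IH]; intros I J; simpl.
  - intros [H|[]]; injection H; intros; subst; reflexivity.
  - intros H; apply in_flat_map in H; destruct H as [[I' J'] [HI H]].
    specialize (IH _ _ HI); simpl in H.
    destruct H as [H|[H|[]]]; injection H; intros; subst; simpl; lia.
Qed.

Lemma bracket_ext (V W : nat -> list C -> C) (g : nat) (zS : list C) (z : C) :
  (forall g' zs, (2 * g' + length zs < 2 * g + S (length zS))%nat ->
     V g' zs = W g' zs) ->
  bracket V g zS z = bracket W g zS z.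
Proof.
  intros H; unfold bracket; f_equal.
  - destruct g as [|g]; [reflexivity|].
    rewrite H; [reflexivity | simpl; lia].
  - f_equal; rewrite !flat_map_concat_map; f_equal.
    apply map_ext_in; intros g1 Hg1; apply in_seq in Hg1.
    apply map_ext_in; intros [I J] HIJ; apply splits_length in HIJ; simpl.
    destruct g1 as [|g1]; destruct I as [|i I]; simpl; try reflexivity.
    + destruct (g - 0)%nat as [|g2] eqn:E2; destruct J as [|j J]; simpl;
        try reflexivity;
        rewrite !H; try reflexivity; simpl in *; lia.
    + destruct (g - S g1)%nat as [|g2] eqn:E2; destruct J as [|j J]; simpl;
        try reflexivity;
        rewrite !H; try reflexivity; simpl in *; lia.
    + destruct (g - S g1)%nat as [|g2] eqn:E2; destruct J as [|j J]; simpl;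
        try reflexivity;
        rewrite !H; try reflexivity; simpl in *; lia.
Qed.

Lemma eo_step_ext (y : C -> C) (V W : nat -> list C -> C) (g : nat)
    (zs : list C) :
  (forall g' zs', (2 * g' + length zs' < 2 * g + length zs)%nat ->
     V g' zs' = W g' zs') ->
  eo_step y V g zs = eo_step y W g zs.
Proof.
  intros H.
  assert (HS : forall z0 zS, zs = z0 :: zS ->
    sum_Res (fun z => Kker y z0 z * bracket V g zS z) =
    sum_Res (fun z => Kker y z0 z * bracket W g zS z)).
  { intros z0 zS E; f_equal; apply FunctionalExtensionality.functional_extensionality.
    intros z; f_equal; apply bracket_ext.
    intros g' zs' Hlt; apply H; rewrite E; exact Hlt. }
  unfold eo_step; destruct g as [|g]; destruct zs as [|z0 [|z1 [|z2 zs]]];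
    try reflexivity; apply HS; reflexivity.
Qed.

Lemma iter_eo_step (y : C -> C) (n m g : nat) (zs : list C) :
  (2 * g + length zs <= n)%nat -> (2 * g + length zs <= m)%nat ->
  Nat.iter n (eo_step y) (fun _ _ => 0) g zs =
  Nat.iter m (eo_step y) (fun _ _ => 0) g zs.
Proof.
  revert m g zs; induction n as [|n IH]; intros m g zs Hn Hm.
  - assert (Eg : g = 0%nat) by lia.
    destruct zs as [|z zs]; [|simpl in Hn; lia].
    subst g; destruct m; reflexivity.
  - destruct m as [|m].
    + assert (Eg : g = 0%nat) by lia.
      destruct zs as [|z zs]; [|simpl in Hm; lia].
      subst g; reflexivity.
    + simpl; apply eo_step_ext; intros g' zs' Hlt; apply IH; lia.
Qed.

Lemma omega_rec (y : C -> C) (g : nat) (zs : list C) :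
  omega y g zs = eo_step y (omega y) g zs.
Proof.
  transitivity (Nat.iter (S (2 * g + length zs)) (eo_step y)
                  (fun _ _ => 0) g zs).
  - apply iter_eo_step; lia.
  - simpl Nat.iter; apply eo_step_ext; intros g' zs' Hlt.
    unfold omega; apply iter_eo_step; lia.
Qed.

(* Main.v *)
(** Let [a = 1] or [-1].  The recursion kernel is
    [K(z0, z) = - z / (2 (y(z) - y(1/z))) * 1 / ((z0 - a)^2 - z0 (x(z) - 2 a))],
    and [x(z) - 2 a = (z - a)^2 / z] vanishes to second order at [a].  Expanding in powers
    of it shows that [omega^g_1] is a finite combination of the differentials
    [z^k / (z - a)^(2 k + 2) dz]; the bracket of the recursion is meromorphic at [a]
    because all stable [omega^g_n] are rational functions with poles only at [1] and [-1],
    by induction.  By linearity it remains to treat each of these differentials: its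
    expansion at [0] gives
    [N(m) = a^(m - 1 - k) prod_(1 <= j <= k) (m^2 - j^2) / (2 k + 1)!],
    while its residue against [z^m] at [a] is [m N(m)].  Replacing [Phi] by a polynomial [h]
    with the same jet at [a] turns the residue into the operator [z^2 h'(z)], at [z = D],
    applied to [N] at [-1].  Since [Phi' = y (1 - 1/z^2)], that polynomial agrees with
    [(z^2 - 1) y(z)] to high order at [z = a], and [(D - a)^(2 k + 1)] annihilates [N]. *)
Require Import Defs.
From Stdlib Require Import Lra Lia FunctionalExtensionality ClassicalEpsilon.
Import ListNotations.

(** [Res] is a chosen value, meaningful only for an integrand shown to be meromorphic. As the
    arguments of one invariant become integration variables of the next, meromorphy in a single
    variable does not propagate through the recursion. What is carried along is an expansion in [z]
    whose coefficients are explicit rational functions of all remaining coordinates; a residue is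
    one of these coefficients, so the property reproduces itself. Poles of the kernel and of [B] at
    [z = z_i] or [z = 1/z_i] only create negative powers of [z_i - a], because [z] stays near [a].
    The two occurrences of [N] agree because the binomial coefficient of [m + k] over [2 k + 1] is,
    up to a power of [a], both the coefficient of [z^(m-1)] in [z^k / (z - a)^(2 k + 2)] at [0] and
    that of [(z - a)^(2 k + 1)] in [z^(m+k)]. The index [-1] arises since [z^2 h'(z)] has the
    coefficient [i h_i] at [z^(i+1)]: started at [-1], it returns the sum of the [i h_i N(i)], which
    is the residue of [h]. The sign in [z^2 Phi' = - (1 - z^2) y] turns [2 g - 2] into [2 - 2 g]. *)

Notation Cser := (@is_series C_AbsRing C_NormedModule).

(** * Absolutely convergent complex series *)

Lemma is_pseries_Cser (a : nat -> C) (u l : C) :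
  is_pseries a u l <-> Cser (fun n => a n * u ^ n) l.
Proof.
  assert (E : forall n, scal (pow_n (K := C_AbsRing) u n) (a n : C_NormedModule) = a n * u ^ n).
  { intros n; rewrite (Cmult_comm (a n)); change (pow_n (K := C_AbsRing) u n * a n = u ^ n * a n).
    reflexivity. }
  unfold is_pseries; split; apply is_series_ext; intros n; rewrite E; reflexivity.
Qed.

Definition Csum : (nat -> C) -> nat -> C := @sum_n C_AbelianMonoid.

Lemma Csum_O (a : nat -> C) : Csum a 0 = a 0%nat.
Proof. exact (sum_O (G:=C_AbelianMonoid) a). Qed.

Lemma Csum_S (a : nat -> C) (n : nat) : Csum a (S n) = Csum a n + a (S n).
Proof. exact (sum_Sn (G:=C_AbelianMonoid) a n). Qed.

Lemma Csum_ext (a b : nat -> C) (n : nat) :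
  (forall k, (k <= n)%nat -> a k = b k) -> Csum a n = Csum b n.
Proof. exact (sum_n_ext_loc (G:=C_AbelianMonoid) a b n). Qed.

Lemma Csum_plus (a b : nat -> C) (n : nat) :
  Csum (fun k => a k + b k) n = Csum a n + Csum b n.
Proof. exact (sum_n_plus (G:=C_AbelianMonoid) a b n). Qed.

Lemma Csum_scal (c : C) (a : nat -> C) (n : nat) :
  Csum (fun k => c * a k) n = c * Csum a n.
Proof. exact (sum_n_mult_l (K:=C_Ring) c a n). Qed.

Lemma Csum_switch (c : nat -> nat -> C) (m n : nat) :
  Csum (fun i => Csum (c i) n) m = Csum (fun j => Csum (fun i => c i j) m) n.
Proof. exact (sum_n_switch (G:=C_AbelianMonoid) c m n). Qed.

Lemma Csum_shift (a : nat -> C) (n : nat) :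
  Csum a (S n) = a 0%nat + Csum (fun k => a (S k)) n.
Proof.
  induction n as [|n IH]; [rewrite Csum_S, !Csum_O; reflexivity|].
  rewrite Csum_S, IH, Csum_S; ring.
Qed.

Lemma Csum_zero (a : nat -> C) (n : nat) : (forall k, (k <= n)%nat -> a k = 0) -> Csum a n = 0.
Proof.
  induction n as [|n IH]; intros H; [rewrite Csum_O; apply H; lia|].
  rewrite Csum_S, IH, H by (intros; try apply H; lia); ring.
Qed.

Lemma Cser_eps (a : nat -> C) (l : C) :
  Cser a l <-> forall eps : R, (0 < eps)%R ->
    exists N, forall n, (N <= n)%nat -> (Cmod (Csum a n - l) < eps)%R.
Proof.
  unfold is_series; split.
  - intros H eps Heps.
    apply (proj1 (filterlim_locally_ball_norm (K:=C_AbsRing) (U:=C_NormedModule) _ _)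
      ) with (eps := mkposreal eps Heps) in H.
    destruct H as [N HN]; exists N; intros n Hn; exact (HN n Hn).
  - intros H; apply filterlim_locally_ball_norm; intros [eps Heps].
    destruct (H eps Heps) as [N HN]; exists N; exact HN.
Qed.

Lemma Cser_unique (a : nat -> C) (l l' : C) : Cser a l -> Cser a l' -> l = l'.
Proof. intros H1 H2; exact (filterlim_locally_unique (K:=C_AbsRing) (V:=C_NormedModule) _ _ _ H1 H2). Qed.

Lemma Cser_plus (a b : nat -> C) (l l' : C) :
  Cser a l -> Cser b l' -> Cser (fun n => a n + b n) (l + l').
Proof. exact (is_series_plus (K:=C_AbsRing) (V:=C_NormedModule) a b l l'). Qed.

Lemma Cser_scal (c : C) (a : nat -> C) (l : C) :
  Cser a l -> Cser (fun n => c * a n) (c * l).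
Proof. exact (is_series_scal (K:=C_AbsRing) (V:=C_NormedModule) c a l). Qed.

Lemma Csum_Cmod (a : nat -> C) (n : nat) :
  (Cmod (Csum a n) <= sum_n (fun k => Cmod (a k)) n)%R.
Proof.
  induction n as [|n IH]; [rewrite Csum_O, sum_O; lra|].
  rewrite Csum_S, sum_Sn; apply Rle_trans with (1 := Cmod_triangle _ _).
  apply Rplus_le_compat_r; exact IH.
Qed.

Lemma Cser_abs (a : nat -> C) : ex_series (fun n => Cmod (a n)) -> exists l : C, Cser a l.
Proof.
  intros H; exact (ex_series_le (K:=C_AbsRing) (V:=C_CompleteNormedModule) a _ (fun n => Rle_refl _) H).
Qed.

Lemma sum_n_le_series (a : nat -> R) (l : R) (n : nat) :
  (forall k, 0 <= a k)%R -> is_series a l -> (sum_n a n <= l)%R.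
Proof.
  intros Ha H.
  apply (is_lim_seq_incr_compare (sum_n a) l H).
  intros k; rewrite sum_Sn; unfold plus; simpl; specialize (Ha (S k)); lra.
Qed.

Lemma Cser_Cmod_le (a : nat -> C) (l : C) (s : R) :
  Cser a l -> is_series (fun n => Cmod (a n)) s -> (Cmod l <= s)%R.
Proof.
  intros Ha Hs; apply Rnot_lt_le; intros Hlt.
  destruct (proj1 (Cser_eps a l) Ha (Cmod l - s)%R ltac:(lra)) as [N HN].
  specialize (HN N (Nat.le_refl _)).
  assert (H1 := sum_n_le_series _ _ N (fun k => Cmod_ge_0 _) Hs).
  assert (H2 := Csum_Cmod a N).
  assert (H3 := Cmod_triangle (Csum a N) (- (Csum a N - l))).
  rewrite Cmod_opp in H3.
  replace (Csum a N + - (Csum a N - l)) with l in H3 by ring. simpl in *. lra.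
Qed.

Lemma Cser_bounded (a : nat -> C) (l : C) :
  Cser a l -> exists B, (0 < B)%R /\ forall n, (Cmod (a n) <= B)%R.
Proof.
  intros H; destruct (proj1 (Cser_eps a l) H 1%R ltac:(lra)) as [N HN].
  assert (HB : exists B, (0 < B)%R /\ forall n, (n <= N)%nat -> (Cmod (a n) <= B)%R).
  { clear; induction N as [|N [B [H0 HB]]].
    - exists (Cmod (a 0%nat) + 1)%R; split; [pose proof (Cmod_ge_0 (a 0%nat)); lra|].
      intros n Hn; replace n with 0%nat by lia; lra.
    - exists (B + Cmod (a (S N)))%R; pose proof (Cmod_ge_0 (a (S N))); split; [lra|].
      intros n Hn; destruct (Nat.eq_dec n (S N)) as [->|]; [lra|].
      specialize (HB n ltac:(lia)); lra. }
  destruct HB as [B [H0 HB]]; exists (B + 2)%R; split; [lra|].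
  intros n; destruct (Nat.le_gt_cases n N) as [Hn|Hn]; [specialize (HB n Hn); lra|].
  destruct n as [|n]; [lia|].
  assert (H1 := HN n ltac:(lia)); assert (H2 := HN (S n) ltac:(lia)).
  rewrite Csum_S in H2.
  replace (a (S n)) with ((Csum a n + a (S n) - l) + - (Csum a n - l)) by ring.
  pose proof (Cmod_triangle (Csum a n + a (S n) - l) (- (Csum a n - l))) as H3.
  rewrite Cmod_opp in H3. simpl in *; lra.
Qed.

(** Exchange of summation for a double series dominated by summable row norms [s]. The triangular
    shape makes the column sums finite; Cauchy products and compositions are both instances. *)
Lemma triangular_series (c : nat -> nat -> C) (r : nat -> C) (l : C) (s : nat -> R) :
  (forall n m, (m < n)%nat -> c n m = 0) ->
  (forall n, is_series (fun m => Cmod (c n m)) (s n)) ->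
  (forall n, Cser (c n) (r n)) -> ex_series s -> Cser r l ->
  Cser (fun m => Csum (fun n => c n m) m) l.
Proof.
  intros Htri Habs Hrow [S HS] Hl.
  (* Entries with [m < n] vanish, so the columns up to [K] fill exactly the square of side [K]. *)
  assert (Hsq : forall K, Csum (fun m => Csum (fun n => c n m) m) K =
                          Csum (fun n => Csum (c n) K) K).
  { intros K; rewrite Csum_switch.
    apply Csum_ext; intros m Hm.
    induction K as [|K IH]; [replace m with 0%nat by lia; reflexivity|].
    destruct (Nat.eq_dec m (Datatypes.S K)) as [->|Hne]; [reflexivity|].
    rewrite Csum_S, <- IH, Htri by lia; ring. }
  (* Absolute tail of row [n] beyond column [K]; it bounds the error of the truncated row. *)
  set (t := fun n K => (s n - sum_n (fun m => Cmod (c n m)) K)%R).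
  assert (Ht0 : forall n K, (0 <= t n K <= s n)%R).
  { intros n K; unfold t.
    pose proof (sum_n_le_series _ _ K (fun k => Cmod_ge_0 _) (Habs n)).
    assert (0 <= sum_n (fun m => Cmod (c n m)) K)%R.
    { clear; induction K as [|K IH]; [rewrite sum_O; apply Cmod_ge_0|].
      rewrite sum_Sn; unfold plus; simpl; pose proof (Cmod_ge_0 (c n (Datatypes.S K))); simpl in *; lra. }
    lra. }
  assert (Het : forall n K, (Cmod (Csum (c n) K - r n) <= t n K)%R).
  { intros n K.
    assert (H1 := is_series_incr_n (K:=C_AbsRing) (V:=C_NormedModule) (c n) (Datatypes.S K) (r n - Csum (c n) K) ltac:(lia)).
    assert (H2 := is_series_incr_n (fun m => Cmod (c n m)) (Datatypes.S K) (t n K) ltac:(lia)).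
    replace (Csum (c n) K - r n) with (- (r n - Csum (c n) K)) by ring.
    rewrite Cmod_opp; apply (Cser_Cmod_le (fun k => c n (Datatypes.S K + k)%nat)).
    - apply H1; simpl pred.
      assert (E : r n - Csum (c n) K + Csum (c n) K = r n) by ring.
      change (Cser (c n) (r n - Csum (c n) K + Csum (c n) K)); rewrite E; apply Hrow.
    - apply H2; simpl pred.
      assert (E : (t n K + sum_n (fun m => Cmod (c n m)) K)%R = s n) by (unfold t; ring).
      change (is_series (fun m => Cmod (c n m)) (t n K + sum_n (fun m => Cmod (c n m)) K)%R).
      rewrite E; apply Habs. }
  apply Cser_eps; intros eps Heps.
  destruct (proj1 (Cser_eps r l) Hl (eps / 3)%R ltac:(lra)) as [N1 HN1].
  (* Rows beyond [n0] contribute little uniformly in [K]; the finitely many rows up to [n0] have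
     tails tending to [0]. *)
  assert (Htail : exists n0, forall K, (n0 <= K)%nat -> (sum_n s K - sum_n s n0 < eps / 3)%R).
  { assert (HS' : is_lim_seq (sum_n s) S) by exact HS.
    destruct (proj2 (is_lim_seq_spec _ _) HS' (mkposreal (eps/6) ltac:(lra))) as [n0 Hn0].
    exists n0; intros K HK; pose proof (Hn0 K HK) as H1; pose proof (Hn0 n0 (Nat.le_refl _)) as H2.
    simpl in *; apply Rabs_def2 in H1; apply Rabs_def2 in H2; lra. }
  destruct Htail as [n0 Hn0].
  assert (Hlim : is_lim_seq (fun K => sum_n (fun n => t n K) n0) 0%R).
  { clear - Habs; induction n0 as [|n0 IH].
    - apply is_lim_seq_ext with (fun K => (s 0%nat - sum_n (fun m => Cmod (c 0%nat m)) K)%R).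
      { intros K; rewrite sum_O; reflexivity. }
      replace (Finite 0%R) with (Finite (s 0%nat - s 0%nat)%R) by (f_equal; lra).
      apply is_lim_seq_minus'; [apply is_lim_seq_const|apply Habs].
    - apply is_lim_seq_ext with
        (fun K => (sum_n (fun n => t n K) n0 + t (Datatypes.S n0) K)%R).
      { intros K; rewrite sum_Sn; reflexivity. }
      replace (Finite 0%R) with (Finite (0 + (s (Datatypes.S n0) - s (Datatypes.S n0)))%R) by (f_equal; lra).
      apply is_lim_seq_plus'; [exact IH|].
      apply is_lim_seq_minus'; [apply is_lim_seq_const|apply Habs]. }
  destruct (proj2 (is_lim_seq_spec _ _) Hlim (mkposreal (eps/3) ltac:(lra))) as [N2 HN2].
  exists (N1 + N2 + n0)%nat; intros K HK; rewrite Hsq.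
  assert (Hle : forall K, (n0 <= K)%nat -> forall K',
     (sum_n (fun n => t n K') K <= sum_n (fun n => t n K') n0 + (sum_n s K - sum_n s n0))%R).
  { clear -Ht0; intros K HK K'; induction HK as [|K HK IH]; [lra|].
    rewrite !sum_Sn; unfold plus; simpl; pose proof (Ht0 (Datatypes.S K) K'); simpl in *; lra. }
  assert (Hd : Csum (fun n => Csum (c n) K) K - l =
     Csum (fun n => Csum (c n) K - r n) K + (Csum r K - l)).
  { assert (E : Csum (fun n => Csum (c n) K) K = Csum (fun n => Csum (c n) K - r n) K + Csum r K).
    { rewrite <- Csum_plus; apply Csum_ext; intros n _; ring. }
    rewrite E; ring. }
  rewrite Hd; apply Rle_lt_trans with (1 := Cmod_triangle _ _).
  specialize (HN1 K ltac:(lia)); specialize (HN2 K ltac:(lia)).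
  specialize (Hle K ltac:(lia) K); specialize (Hn0 K ltac:(lia)).
  assert (H4 : (Cmod (Csum (fun n => Csum (c n) K - r n)%C K) <= sum_n (fun n => t n K) K)%R).
  { apply Rle_trans with (1 := Csum_Cmod _ _); apply sum_n_m_le; intros n; apply Het. }
  simpl in *; rewrite Rminus_0_r in HN2; apply Rabs_def2 in HN2; lra.
Qed.

(** * Absolute convergence on discs and Cauchy products *)

Definition absconv (a : nat -> C) (rho : R) : Prop :=
  ex_series (fun n => Cmod (a n) * rho ^ n)%R.

Definition conv (a b : nat -> C) (n : nat) : C := Csum (fun k => a k * b (n - k)%nat) n.

(** Abel's lemma: comparison with the geometric series of ratio [rho / r]. *)
Lemma absconv_of_bounded (a : nat -> C) (B r rho : R) :
  (0 < r)%R -> (forall n, Cmod (a n) * r ^ n <= B)%R -> (0 <= rho < r)%R -> absconv a rho.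
Proof.
  intros Hr HB Hrho.
  assert (Hq : (Rabs (rho / r) < 1)%R).
  { rewrite Rabs_pos_eq by (apply Rdiv_le_0_compat; lra).
    apply Rlt_div_l; lra. }
  assert (HG : ex_series (fun n => B * (rho / r) ^ n)%R).
  { exists (B * / (1 - rho / r))%R. exact (is_series_scal B _ _ (is_series_geom _ Hq)). }
  refine (ex_series_le (K:=R_AbsRing) (V:=R_CompleteNormedModule) _ _ _ HG).
  intros n; unfold norm; simpl; unfold abs; simpl.
  rewrite Rabs_pos_eq by (apply Rmult_le_pos; [apply Cmod_ge_0|apply pow_le; lra]).
  replace (Cmod (a n) * rho ^ n)%R with ((Cmod (a n) * r ^ n) * (rho / r) ^ n)%R.
  - apply Rmult_le_compat_r; [apply pow_le, Rdiv_le_0_compat; lra|apply HB].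
  - unfold Rdiv; rewrite Rpow_mult_distr, pow_inv.
    field; apply pow_nonzero; lra.
Qed.

Lemma absconv_of_Cser (a : nat -> C) (u l : C) (rho : R) :
  Cser (fun n => a n * u ^ n) l -> (0 <= rho < Cmod u)%R -> absconv a rho.
Proof.
  intros H Hrho; destruct (Cser_bounded _ _ H) as [B [_ HB]].
  apply (absconv_of_bounded a B (Cmod u)); [lra| |exact Hrho].
  intros n; rewrite <- Cmod_pow, <- Cmod_mult; apply HB.
Qed.

Lemma absconv_le (a : nat -> C) (rho rho' : R) :
  absconv a rho -> (0 <= rho' <= rho)%R -> absconv a rho'.
Proof.
  intros H Hr; refine (ex_series_le (K:=R_AbsRing) (V:=R_CompleteNormedModule) _ _ _ H).
  intros n; unfold norm; simpl; unfold abs; simpl.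
  rewrite Rabs_pos_eq by (apply Rmult_le_pos; [apply Cmod_ge_0|apply pow_le; lra]).
  apply Rmult_le_compat_l; [apply Cmod_ge_0|apply pow_incr; lra].
Qed.

Lemma absconv_term (a : nat -> C) (u : C) (rho : R) :
  absconv a rho -> (Cmod u <= rho)%R -> ex_series (fun n => Cmod (a n * u ^ n)).
Proof.
  intros H Hu.
  apply ex_series_ext with (fun n => Cmod (a n) * (Cmod u) ^ n)%R.
  { intros n; rewrite Cmod_mult, Cmod_pow; reflexivity. }
  apply absconv_le with (1 := H); split; [apply Cmod_ge_0|exact Hu].
Qed.

Lemma is_series_shift {K : AbsRing} {V : NormedModule K} (b : nat -> V) (n : nat) (l : V) :
  is_series b l -> is_series (fun m => if (m <? n)%nat then zero else b (m - n)%nat) l.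
Proof.
  intros H; destruct n as [|n].
  { revert H; apply is_series_ext; intros m; simpl; rewrite Nat.sub_0_r; reflexivity. }
  apply (is_series_decr_n _ (S n)); [lia|].
  replace (plus l _) with l.
  - revert H; apply is_series_ext; intros m.
    replace (S n + m <? S n)%nat with false by (symmetry; apply Nat.ltb_ge; lia).
    f_equal; lia.
  - simpl pred.
    assert (E : forall k, (k <= n)%nat ->
      sum_n (fun m => if (m <? S n)%nat then zero (G:=V) else b (m - S n)%nat) k = zero).
    { intros k; induction k as [|k IH]; intros Hk; [apply sum_O|].
      rewrite sum_Sn, IH by lia.
      replace (S k <? S n)%nat with true by (symmetry; apply Nat.ltb_lt; lia).
      apply plus_zero_r. }
    transitivity (minus l (zero (G:=V))); [symmetry; exact (minus_zero_r (G:=NormedModule.AbelianGroup K V) l)|].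
    unfold minus; apply f_equal, f_equal; symmetry; apply E; lia.
Qed.

(** Row [n] of the triangular array is the series of [b] shifted by [n] and scaled by [a n * u ^ n];
    its columns are the terms of the product. *)
Lemma conv_series (a b : nat -> C) (u A B : C) (rho : R) :
  absconv a rho -> absconv b rho -> (Cmod u <= rho)%R ->
  Cser (fun n => a n * u ^ n) A -> Cser (fun n => b n * u ^ n) B ->
  Cser (fun n => conv a b n * u ^ n) (A * B).
Proof.
  intros Ha Hb Hu HA HB.
  destruct (absconv_term b u rho Hb Hu) as [s Hs].
  set (c := fun n m => if (m <? n)%nat then RtoC 0 else (a n * u ^ n) * (b (m - n)%nat * u ^ (m - n))).
  assert (HC : Cser (fun m => Csum (fun n => c n m) m) (A * B)).
  { apply (triangular_series c (fun n => B * (a n * u ^ n)) (A * B)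
             (fun n => (s * Cmod (a n * u ^ n))%R)).
    - intros n m Hnm; unfold c; apply Nat.ltb_lt in Hnm; rewrite Hnm; reflexivity.
    - intros n; rewrite Rmult_comm.
      assert (H1 := is_series_shift (V:=R_NormedModule) _ n _
                      (is_series_scal (Cmod (a n * u ^ n)) _ _ Hs)).
      revert H1; apply is_series_ext; intros m; unfold c.
      destruct (m <? n)%nat; [symmetry; exact Cmod_0|].
      symmetry; apply Cmod_mult.
    - intros n; rewrite Cmult_comm.
      exact (is_series_shift (V:=C_NormedModule) _ n _ (Cser_scal (a n * u ^ n) _ _ HB)).
    - destruct (absconv_term a u rho Ha Hu) as [s' Hs'].
      exists (s * s')%R; exact (is_series_scal s _ _ Hs').
    - rewrite (Cmult_comm A); apply Cser_scal; exact HA. }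
  revert HC; apply is_series_ext; intros m; unfold conv.
  transitivity (u ^ m * Csum (fun k => a k * b (m - k)%nat) m); [|apply Cmult_comm].
  rewrite <- Csum_scal; apply Csum_ext; intros n Hn; unfold c.
  replace (m <? n)%nat with false by (symmetry; apply Nat.ltb_ge; lia).
  replace (u ^ m) with (u ^ n * u ^ (m - n)) by (rewrite <- Cpow_add_r; f_equal; lia).
  ring.
Qed.

(** Submultiplicativity of the weighted norm [sum |a n| rho^n]. The bound on [s], iterated, controls
    the powers that occur in a composition. *)
Lemma conv_abs_series (a b : nat -> C) (rho A B : R) :
  (0 <= rho)%R ->
  is_series (fun n => Cmod (a n) * rho ^ n)%R A -> is_series (fun n => Cmod (b n) * rho ^ n)%R B ->
  exists s, is_series (fun n => Cmod (conv a b n) * rho ^ n)%R s /\ (0 <= s <= A * B)%R.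
Proof.
  intros Hrho HA HB.
  assert (Hpos : forall (c : nat -> C) n, (0 <= Cmod (c n) * rho ^ n)%R).
  { intros c n; apply Rmult_le_pos; [apply Cmod_ge_0|apply pow_le; exact Hrho]. }
  assert (HP := is_series_mult _ _ _ _ HA HB
    (ex_series_ext _ _ (fun n => eq_sym (Rabs_pos_eq _ (Hpos a n))) (ex_intro _ _ HA))
    (ex_series_ext _ _ (fun n => eq_sym (Rabs_pos_eq _ (Hpos b n))) (ex_intro _ _ HB))).
  set (d := fun n => sum_f_R0 (fun k => Cmod (a k) * rho ^ k * (Cmod (b (n - k)%nat) * rho ^ (n - k)))%R n) in HP.
  assert (Hle : forall n, (Cmod (conv a b n) * rho ^ n <= d n)%R).
  { intros n; unfold conv, d; rewrite <- sum_n_Reals.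
    apply Rle_trans with (sum_n (fun k => Cmod (a k * b (n - k)%nat)) n * rho ^ n)%R.
    - apply Rmult_le_compat_r; [apply pow_le; exact Hrho|apply Csum_Cmod].
    - right. rewrite Rmult_comm. rewrite <- (sum_n_mult_l (K:=R_Ring) (rho ^ n)%R).
      apply sum_n_ext_loc; intros k Hk; rewrite Cmod_mult; unfold mult; simpl.
      replace (rho ^ n)%R with (rho ^ k * rho ^ (n - k))%R by (rewrite <- pow_add; f_equal; lia).
      ring. }
  assert (HE : ex_series (fun n => Cmod (conv a b n) * rho ^ n)%R).
  { refine (ex_series_le (K:=R_AbsRing) (V:=R_CompleteNormedModule) _ _ _ (ex_intro _ _ HP)).
    intros n; unfold norm; simpl; unfold abs; simpl; rewrite Rabs_pos_eq; [apply Hle|apply Hpos]. }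
  exists (Series (fun n => Cmod (conv a b n) * rho ^ n)%R); split; [apply Series_correct, HE|].
  rewrite <- (is_series_unique _ _ HP).
  split.
  - rewrite <- (is_series_unique (fun _ : nat => 0%R) 0%R).
    + apply Series_le; [|exact HE]; intros n; split; [lra|apply Hpos].
    + apply (is_series_ext (fun _ => 0%R)); [reflexivity|].
      apply filterlim_ext with (fun _ : nat => 0%R); [|apply filterlim_const].
      intros n; induction n as [|n IH]; [rewrite sum_O; reflexivity|].
      rewrite sum_Sn, <- IH; unfold plus; simpl; lra.
  - apply Series_le; [|exists (A * B)%R; exact HP]; intros n; split; [apply Hpos|apply Hle].
Qed.

Lemma absconv_conv (a b : nat -> C) (rho : R) :
  (0 <= rho)%R -> absconv a rho -> absconv b rho -> absconv (conv a b) rho.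
Proof.
  intros Hrho [A HA] [B HB]; destruct (conv_abs_series a b rho A B Hrho HA HB) as [s [Hs _]].
  exists s; exact Hs.
Qed.

(** * Powers and composition of power series *)

Fixpoint conv_pow (b : nat -> C) (n : nat) : nat -> C :=
  match n with
  | O => fun m => match m with O => RtoC 1 | _ => RtoC 0 end
  | S n' => conv b (conv_pow b n')
  end.

(** Coefficients of the composite series. The sum stops at [m] because, when [b 0 = 0], the [n]-th
    power of [b] starts in degree [n]. *)
Definition comp_coef (a b : nat -> C) (m : nat) : C := Csum (fun n => a n * conv_pow b n m) m.

Lemma conv_pow_order (b : nat -> C) (n m : nat) : b 0%nat = 0 -> (m < n)%nat -> conv_pow b n m = 0.
Proof.
  intros Hb; revert m; induction n as [|n IH]; intros m Hm; [lia|]; simpl.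
  apply Csum_zero; intros k Hk; destruct k as [|k]; [rewrite Hb; ring|].
  rewrite IH by lia; ring.
Qed.

Lemma Cser_first (c : C) (f : nat -> C) : f 0%nat = c -> (forall n, f (S n) = 0) -> Cser f c.
Proof.
  intros H0 HS; apply Cser_eps; intros eps Heps; exists 0%nat; intros n _.
  replace (Csum f n) with c; [unfold Cminus; rewrite Cplus_opp_r, Cmod_0; exact Heps|].
  induction n as [|n IH]; [rewrite Csum_O; auto|]. rewrite Csum_S, <- IH, HS; ring.
Qed.

Lemma conv_pow_abs (b : nat -> C) (rho s : R) (n : nat) :
  (0 <= rho)%R -> is_series (fun n => Cmod (b n) * rho ^ n)%R s ->
  exists s', is_series (fun m => Cmod (conv_pow b n m) * rho ^ m)%R s' /\ (0 <= s' <= s ^ n)%R.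
Proof.
  intros Hrho Hs; induction n as [|n [s' [H1 H2]]].
  - exists 1%R; split; [|simpl; lra].
    apply is_series_decr_1.
    apply filterlim_ext with (fun _ : nat => 0%R).
    + intros n; induction n as [|n IH].
      * rewrite sum_O; simpl; rewrite Cmod_0; lra.
      * rewrite sum_Sn, <- IH; simpl; rewrite Cmod_0; unfold plus; simpl; lra.
    + replace (plus _ _) with 0%R by (simpl; rewrite Cmod_1; unfold plus, opp; simpl; lra).
      apply filterlim_const.
  - destruct (conv_abs_series b (conv_pow b n) rho s s' Hrho Hs H1) as [s'' [H3 H4]].
    exists s''; split; [exact H3|]; split; [lra|].
    apply Rle_trans with (1 := proj2 H4); simpl.
    apply Rmult_le_compat_l; [|lra].
    pose proof (sum_n_le_series _ _ 0%nat
      (fun k => Rmult_le_pos _ _ (Cmod_ge_0 (b k)) (pow_le _ k Hrho)) Hs) as H5.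
    rewrite sum_O in H5; simpl in H5.
    pose proof (Cmod_ge_0 (b 0%nat)); lra.
Qed.

Lemma conv_pow_series (b : nat -> C) (u v : C) (rho : R) (n : nat) :
  absconv b rho -> (Cmod u <= rho)%R -> Cser (fun m => b m * u ^ m) v ->
  Cser (fun m => conv_pow b n m * u ^ m) (v ^ n).
Proof.
  intros Hb Hu Hv; induction n as [|n IH].
  - simpl; apply Cser_first; [simpl; ring|intros; ring].
  - assert (Hr : (0 <= rho)%R) by (pose proof (Cmod_ge_0 u); lra).
    simpl; apply conv_series with rho; try assumption.
    destruct Hb as [s Hs]; destruct (conv_pow_abs b rho s n Hr Hs) as [s' [H _]].
    exists s'; exact H.
Qed.

(** Row [n] of the triangular array is [a n] times the series of [v ^ n], whose norm is at most
    [s ^ n]; since [s <= sigma], the row norms are dominated by [Cmod (a n) * sigma ^ n]. *)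
Lemma comp_series (a b : nat -> C) (u v l : C) (rho s sigma : R) :
  b 0%nat = 0 -> is_series (fun n => Cmod (b n) * rho ^ n)%R s -> (s <= sigma)%R ->
  absconv a sigma -> (Cmod u <= rho)%R ->
  Cser (fun m => b m * u ^ m) v -> Cser (fun n => a n * v ^ n) l ->
  Cser (fun m => comp_coef a b m * u ^ m) l.
Proof.
  intros Hb Hs Hss Ha Hu Hv Hl.
  assert (Hb' : absconv b rho) by (exists s; exact Hs).
  assert (Hr : (0 <= rho)%R) by (pose proof (Cmod_ge_0 u); lra).
  assert (Hs0 : (0 <= s)%R).
  { destruct (conv_pow_abs b rho s 1 Hr Hs) as [s' [_ H]]; simpl in H; lra. }
  assert (Hrow : forall n, ex_series (fun m => Cmod (conv_pow b n m * u ^ m))).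
  { intros n; apply absconv_term with rho; [|exact Hu].
    destruct (conv_pow_abs b rho s n Hr Hs) as [s' [H _]]; exists s'; exact H. }
  assert (HC : Cser (fun m => Csum (fun n => a n * (conv_pow b n m * u ^ m)) m) l).
  { apply (triangular_series (fun n m => a n * (conv_pow b n m * u ^ m)) (fun n => a n * v ^ n) l
             (fun n => Cmod (a n) * Series (fun m => Cmod (conv_pow b n m * u ^ m)))%R).
    - intros n m Hnm; rewrite conv_pow_order by assumption; ring.
    - intros n; apply is_series_ext with (fun m => Cmod (a n) * Cmod (conv_pow b n m * u ^ m))%R.
      { intros m; rewrite (Cmod_mult (a n)); reflexivity. }
      apply (is_series_scal (Cmod (a n)) (fun m => Cmod (conv_pow b n m * u ^ m))).
      apply Series_correct, Hrow.
    - intros n; apply Cser_scal, conv_pow_series with rho; assumption.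
    - refine (ex_series_le (K:=R_AbsRing) (V:=R_CompleteNormedModule) _ _ _ Ha).
      intros n; unfold norm; simpl; unfold abs; simpl.
      destruct (conv_pow_abs b rho s n Hr Hs) as [s' [H1 H2]].
      assert (H3 : (0 <= Series (fun m => Cmod (conv_pow b n m * u ^ m)) <= s')%R).
      { split.
        - pose proof (sum_n_le_series _ _ 0%nat (fun k => Cmod_ge_0 _) (Series_correct _ (Hrow n))) as H4.
          rewrite sum_O in H4; pose proof (Cmod_ge_0 (conv_pow b n 0 * u ^ 0)); lra.
        - rewrite <- (is_series_unique _ _ H1); apply Series_le; [|exists s'; exact H1].
          intros m; split; [apply Cmod_ge_0|]. rewrite Cmod_mult, Cmod_pow.
          apply Rmult_le_compat_l; [apply Cmod_ge_0|apply pow_incr; split; [apply Cmod_ge_0|exact Hu]]. }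
      rewrite Rabs_pos_eq by (apply Rmult_le_pos; [apply Cmod_ge_0|lra]).
      apply Rmult_le_compat_l; [apply Cmod_ge_0|].
      apply Rle_trans with (s ^ n)%R; [lra|apply pow_incr; lra].
    - exact Hl. }
  revert HC; apply is_series_ext; intros m; unfold comp_coef.
  transitivity (u ^ m * Csum (fun n => a n * conv_pow b n m) m); [|apply Cmult_comm].
  rewrite <- Csum_scal; apply Csum_ext; intros n _; ring.
Qed.

(** Without constant term, scaling the radius by [q <= 1] scales the weighted norm by at most
    [q]. *)
Lemma absconv_shrink (b : nat -> C) (rho sigma : R) :
  b 0%nat = 0 -> (0 < rho)%R -> (0 < sigma)%R -> absconv b rho ->
  exists rho' s, (0 < rho' <= rho)%R /\ (s <= sigma)%R /\
    is_series (fun n => Cmod (b n) * rho' ^ n)%R s.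
Proof.
  intros Hb Hr Hs [S HS].
  assert (HS0 : (0 <= S)%R).
  { pose proof (sum_n_le_series _ _ 0%nat
      (fun k => Rmult_le_pos _ _ (Cmod_ge_0 (b k)) (pow_le _ k (Rlt_le _ _ Hr))) HS) as H5.
    rewrite sum_O in H5; simpl in H5; pose proof (Cmod_ge_0 (b 0%nat)); lra. }
  (* The [+ 1] keeps the quotient defined when the norm [S] is [0]. *)
  set (q := Rmin 1 (sigma / (S + 1))%R).
  assert (Hq : (0 < q <= 1)%R).
  { unfold q; split; [apply Rmin_glb_lt; [lra|apply Rdiv_lt_0_compat; lra]|apply Rmin_l]. }
  assert (Hq2 : (q * S <= sigma)%R).
  { apply Rle_trans with (sigma / (S + 1) * S)%R.
    - apply Rmult_le_compat_r; [exact HS0|apply Rmin_r].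
    - apply Rle_trans with (sigma / (S + 1) * (S + 1))%R.
      + apply Rmult_le_compat_l; [apply Rdiv_le_0_compat; lra|lra].
      + right; field; lra. }
  assert (HE : absconv b (q * rho)%R).
  { apply absconv_le with rho; [exists S; exact HS|]. split; nra. }
  exists (q * rho)%R, (Series (fun n => Cmod (b n) * (q * rho) ^ n)%R).
  split; [split; nra|]; split; [|apply Series_correct, HE].
  apply Rle_trans with (q * S)%R; [|exact Hq2].
  assert (HqS := is_series_scal q _ _ HS).
  rewrite <- (is_series_unique _ (q * S)%R HqS).
  apply Series_le; [|exists (q * S)%R; exact HqS].
  intros n; split; [apply Rmult_le_pos; [apply Cmod_ge_0|apply pow_le; nra]|].
  unfold scal; simpl; unfold mult; simpl.
  destruct n as [|n]; [rewrite Hb, Cmod_0; lra|].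
  rewrite Rpow_mult_distr; simpl.
  assert (q ^ n <= 1)%R by (rewrite <- (pow1 n); apply pow_incr; lra).
  assert (0 <= Cmod (b (Datatypes.S n)) * (rho * rho ^ n) * q)%R.
  { apply Rmult_le_pos; [apply Rmult_le_pos; [apply Cmod_ge_0|]|lra].
    apply Rmult_le_pos; [lra|apply pow_le; lra]. }
  nra.
Qed.

(** * Expansions on a punctured disc *)

(* The value of [f] at [z0] itself is not constrained. *)
Definition expands (a : nat -> C) (z0 : C) (f : C -> C) : Prop :=
  exists r : R, (0 < r)%R /\ forall z, (0 < Cmod (z - z0) < r)%R ->
    Cser (fun n => a n * (z - z0) ^ n) (f z).

Definition near (z0 : C) (P : C -> Prop) : Prop :=
  exists r : R, (0 < r)%R /\ forall z, (0 < Cmod (z - z0) < r)%R -> P z.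

Lemma near_and (z0 : C) (P Q : C -> Prop) :
  near z0 P -> near z0 Q -> near z0 (fun z => P z /\ Q z).
Proof.
  intros [r [Hr H]] [r' [Hr' H']]; exists (Rmin r r'); split; [apply Rmin_glb_lt; assumption|].
  intros z Hz; pose proof (Rmin_l r r'); pose proof (Rmin_r r r'); split; [apply H|apply H']; lra.
Qed.

Lemma near_imp (z0 : C) (P Q : C -> Prop) : near z0 P -> (forall z, P z -> Q z) -> near z0 Q.
Proof. intros [r [Hr H]] HPQ; exists r; split; [exact Hr|]; intros z Hz; apply HPQ, H, Hz. Qed.

Lemma near_true (z0 : C) (P : C -> Prop) : (forall z, P z) -> near z0 P.
Proof. intros H; exists 1%R; split; [lra|]; intros; apply H. Qed.

Lemma near_neq (z0 w : C) : near z0 (fun z => z <> w).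
Proof.
  destruct (Ceq_dec z0 w) as [->|Hne].
  - exists 1%R; split; [lra|]; intros z Hz ->.
    unfold Cminus in Hz; rewrite Cplus_opp_r, Cmod_0 in Hz; lra.
  - exists (Cmod (w - z0)); split.
    + apply Cmod_gt_0; intros E; apply Hne. replace w with (w - z0 + z0) by ring. rewrite E; ring.
    + intros z Hz ->; lra.
Qed.

Lemma near_self (z0 : C) : near z0 (fun z => z - z0 <> 0).
Proof. exists 1%R; split; [lra|]; intros z Hz; apply Cmod_gt_0; lra. Qed.

Lemma expands_ext (a : nat -> C) (z0 : C) (f g : C -> C) :
  near z0 (fun z => f z = g z) -> expands a z0 f -> expands a z0 g.
Proof.
  intros H1 H2; apply (near_imp _ _ _ (near_and _ _ _ H1 H2)); intros z [<- H]; exact H.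
Qed.

Lemma expands_radius (a : nat -> C) (z0 : C) (f : C -> C) :
  expands a z0 f -> exists r : R, (0 < r)%R /\ absconv a r /\
    forall z, (0 < Cmod (z - z0) <= r)%R -> Cser (fun n => a n * (z - z0) ^ n) (f z).
Proof.
  (* Convergence at the single point [z0 + r / 2] already gives absolute convergence at the smaller
     radius [r / 4]. *)
  intros [r [Hr H]]; exists (r / 4)%R; split; [lra|]; split.
  - set (z := z0 + RtoC (r / 2)).
    assert (E : Cmod (z - z0) = (r / 2)%R).
    { unfold z; replace (z0 + RtoC (r / 2) - z0) with (RtoC (r / 2)) by ring.
      rewrite Cmod_R; apply Rabs_pos_eq; lra. }
    apply (absconv_of_Cser a (z - z0) (f z)); [apply H; lra|lra].
  - intros z Hz; apply H; lra.
Qed.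

Lemma expands_bounded (a : nat -> C) (z0 : C) (f : C -> C) :
  expands a z0 f -> exists B, near z0 (fun z => (Cmod (f z) <= B)%R).
Proof.
  intros H; destruct (expands_radius a z0 f H) as [r [Hr [[S HS] Hf]]].
  exists S, r; split; [exact Hr|]; intros z Hz.
  assert (Ha : absconv a r) by (exists S; exact HS).
  destruct (absconv_term a (z - z0) r Ha ltac:(lra)) as [s Hs].
  apply Rle_trans with s; [apply (Cser_Cmod_le _ _ _ (Hf z ltac:(lra)) Hs)|].
  rewrite <- (is_series_unique _ _ Hs), <- (is_series_unique _ _ HS).
  apply Series_le; [|exists S; exact HS].
  intros n; split; [apply Cmod_ge_0|]; rewrite Cmod_mult, Cmod_pow.
  apply Rmult_le_compat_l; [apply Cmod_ge_0|apply pow_incr; split; [apply Cmod_ge_0|lra]].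
Qed.

Lemma expands_plus (a b : nat -> C) (z0 : C) (f g : C -> C) :
  expands a z0 f -> expands b z0 g -> expands (fun n => a n + b n) z0 (fun z => f z + g z).
Proof.
  intros Ha Hb; apply (near_imp _ _ _ (near_and _ _ _ Ha Hb)); intros z [H1 H2].
  apply is_series_ext with (2 := Cser_plus _ _ _ _ H1 H2).
  intros n; symmetry; apply Cmult_plus_distr_r.
Qed.

Lemma expands_scal (c : C) (a : nat -> C) (z0 : C) (f : C -> C) :
  expands a z0 f -> expands (fun n => c * a n) z0 (fun z => c * f z).
Proof.
  intros Ha; apply (near_imp _ _ _ Ha); intros z H1.
  apply is_series_ext with (2 := Cser_scal c _ _ H1).
  intros n; apply Cmult_assoc.
Qed.

Lemma expands_mult (a b : nat -> C) (z0 : C) (f g : C -> C) :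
  expands a z0 f -> expands b z0 g -> expands (conv a b) z0 (fun z => f z * g z).
Proof.
  intros Ha Hb; destruct (expands_radius _ _ _ Ha) as [r [Hr [Aa Ha']]].
  destruct (expands_radius _ _ _ Hb) as [r' [Hr' [Ab Hb']]].
  assert (Hm : (0 < Rmin r r')%R) by (apply Rmin_glb_lt; assumption).
  pose proof (Rmin_l r r'); pose proof (Rmin_r r r').
  exists (Rmin r r'); split; [exact Hm|]; intros z Hz.
  apply conv_series with (Rmin r r'); [apply absconv_le with r; [exact Aa|lra]|
    apply absconv_le with r'; [exact Ab|lra]|lra|apply Ha'; lra|apply Hb'; lra].
Qed.

Definition monomial (c : C) (k n : nat) : C := if (n =? k)%nat then c else 0.

Lemma Cser_monomial (c u : C) (k : nat) : Cser (fun n => monomial c k n * u ^ n) (c * u ^ k).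
Proof.
  assert (H := is_series_shift (V:=C_NormedModule) (fun n => match n with O => c * u ^ k | _ => RtoC 0 end) k (c * u ^ k)).
  assert (H0 : Cser (fun n => match n with O => c * u ^ k | _ => RtoC 0 end) (c * u ^ k)).
  { apply Cser_first; [reflexivity|intros; reflexivity]. }
  apply is_series_ext with (2 := H H0); intros n; unfold monomial.
  destruct (Nat.ltb_spec n k) as [Hn|Hn].
  - replace (n =? k)%nat with false by (symmetry; apply Nat.eqb_neq; lia).
    symmetry; apply Cmult_0_l.
  - destruct (Nat.eqb_spec n k) as [->|Hne]; [rewrite Nat.sub_diag; reflexivity|].
    destruct (n - k)%nat eqn:E; [lia|symmetry; apply Cmult_0_l].
Qed.

Lemma expands_monomial (c z0 : C) (k : nat) :
  expands (monomial c k) z0 (fun z => c * (z - z0) ^ k).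
Proof. apply near_true; intros z; apply Cser_monomial. Qed.

Lemma Cser_tail (a : nat -> C) (l : C) :
  Cser a l <-> Cser (fun n => a (S n)) (l - a 0%nat).
Proof.
  split; intros H.
  - apply (is_series_incr_1 (K:=C_AbsRing) (V:=C_NormedModule)).
    assert (E : l - a 0%nat + a 0%nat = l) by ring.
    change (Cser a (l - a 0%nat + a 0%nat)); rewrite E; exact H.
  - apply (is_series_decr_1 (K:=C_AbsRing) (V:=C_NormedModule)); exact H.
Qed.

Lemma expands_div (a : nat -> C) (z0 : C) (f : C -> C) :
  expands a z0 f -> expands (fun n => a (S n)) z0 (fun z => (f z - a 0%nat) / (z - z0)).
Proof.
  intros H; apply (near_imp _ _ _ (near_and _ _ _ H (near_self z0))); intros z [Hz Hu].
  apply (proj1 (Cser_tail _ _)) in Hz; cbv beta in Hz; rewrite Cmult_1_r in Hz.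
  apply (Cser_scal (/ (z - z0))) in Hz.
  replace ((f z - a 0%nat) / (z - z0)) with (/ (z - z0) * (f z - a 0%nat)) by (unfold Cdiv; ring).
  revert Hz; apply is_series_ext; intros n; simpl.
  field; exact Hu.
Qed.

(** If [d 0] were nonzero, [- d 0 / (z - z0)] would have an expansion and hence be bounded near
    [z0]. Dividing by [z - z0] then moves to the next coefficient. Only punctured discs are used, as
    [expands] says nothing at the centre. *)
Lemma expands_zero_coef (d : nat -> C) (z0 : C) : expands d z0 (fun _ => 0) -> forall n, d n = 0.
Proof.
  assert (H0 : forall d, expands d z0 (fun _ => 0) -> d 0%nat = 0).
  { clear d; intros d H; apply Cmod_eq_0, Rle_antisym; [|apply Cmod_ge_0].
    destruct (expands_bounded _ _ _ (expands_div _ _ _ H)) as [B [r [Hr HB]]].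
    apply Rnot_lt_le; intros Hd.
    assert (HBp : (0 <= B)%R).
    { set (z := z0 + RtoC (r / 2)).
      apply Rle_trans with (2 := HB z ltac:(unfold z; replace (z0 + RtoC (r / 2) - z0) with (RtoC (r / 2)) by ring;
        rewrite Cmod_R, Rabs_pos_eq; lra)); apply Cmod_ge_0. }
    (* So small that [Cmod (d 0) / e] is at least [2 * (B + 1)], which exceeds the bound [B]. *)
    set (e := Rmin (r / 2) (Cmod (d 0%nat) / (2 * (B + 1)))%R).
    assert (He : (0 < e)%R) by (apply Rmin_glb_lt; [lra|apply Rdiv_lt_0_compat; lra]).
    assert (He1 : (e <= r / 2)%R) by apply Rmin_l.
    assert (He2 : (e * (2 * (B + 1)) <= Cmod (d 0%nat))%R).
    { apply Rle_div_r; [lra|apply Rmin_r]. }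
    assert (Ee : Cmod (z0 + RtoC e - z0) = e).
    { replace (z0 + RtoC e - z0) with (RtoC e) by ring; rewrite Cmod_R; apply Rabs_pos_eq; lra. }
    specialize (HB (z0 + RtoC e) ltac:(rewrite Ee; lra)).
    unfold Cdiv in HB; rewrite Cmod_mult, Cmod_inv, Ee in HB by (apply Cmod_gt_0; lra).
    replace (0 - d 0%nat) with (- d 0%nat) in HB by ring; rewrite Cmod_opp in HB.
    apply Rle_div_l in HB; [nra|lra]. }
  intros H n; revert d H; induction n as [|n IH]; intros d H; [apply H0, H|].
  apply (IH (fun n => d (S n))).
  apply expands_ext with (2 := expands_div _ _ _ H).
  apply near_imp with (1 := near_self z0); intros z Hz; rewrite (H0 d H).
  field; exact Hz.
Qed.

Lemma expands_unique (a b : nat -> C) (z0 : C) (f : C -> C) :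
  expands a z0 f -> expands b z0 f -> forall n, a n = b n.
Proof.
  intros Ha Hb n.
  assert (H := expands_plus _ _ _ _ _ Ha (expands_scal (-1) _ _ _ Hb)).
  assert (E : a n + -1 * b n = 0).
  { apply (expands_zero_coef (fun n => a n + -1 * b n) z0).
    apply expands_ext with (2 := H); apply near_true; intros z; ring. }
  replace (a n) with (a n + -1 * b n + b n) by ring; rewrite E; ring.
Qed.

(** The series of [f] is assumed on a full disc, centre included, because [v z] may vanish at points
    other than [z0]. *)
Lemma expands_comp (a b : nat -> C) (z0 : C) (r : R) (f v : C -> C) :
  (0 < r)%R -> (forall w, (Cmod w < r)%R -> Cser (fun n => a n * w ^ n) (f w)) ->
  b 0%nat = 0 -> expands b z0 v -> expands (comp_coef a b) z0 (fun z => f (v z)).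
Proof.
  intros Hr Hf Hb Hv; destruct (expands_radius _ _ _ Hv) as [r' [Hr' [Ab Hb']]].
  assert (Aa : absconv a (r / 2)).
  { assert (E : Cmod (RtoC (r * 2 / 3)) = (r * 2 / 3)%R) by (rewrite Cmod_R; apply Rabs_pos_eq; lra).
    apply (absconv_of_Cser a (RtoC (r * 2 / 3)) (f (RtoC (r * 2 / 3)))); [apply Hf|]; lra. }
  (* On a smaller disc the norm of the series of [v], and so [v] itself, is at most [r / 2], where
     the series of [f] converges absolutely. *)
  destruct (absconv_shrink b r' (r / 2) Hb Hr' ltac:(lra) Ab) as [rho [s [Hrho [Hs1 Hs2]]]].
  exists rho; split; [lra|]; intros z Hz.
  assert (Ab' : absconv b rho) by (exists s; exact Hs2).
  assert (Hvz := Hb' z ltac:(lra)).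
  assert (Hle : (Cmod (v z) <= s)%R).
  { destruct (absconv_term b (z - z0) rho Ab' ltac:(lra)) as [s' Hs'].
    apply Rle_trans with s'; [exact (Cser_Cmod_le _ _ _ Hvz Hs')|].
    rewrite <- (is_series_unique _ _ Hs'), <- (is_series_unique _ _ Hs2).
    apply Series_le; [|exists s; exact Hs2].
    intros n; split; [apply Cmod_ge_0|]; rewrite Cmod_mult, Cmod_pow.
    apply Rmult_le_compat_l; [apply Cmod_ge_0|apply pow_incr; split; [apply Cmod_ge_0|lra]]. }
  apply comp_series with (v := v z) (rho := rho) (s := s) (sigma := (r / 2)%R); try assumption; try lra.
  apply Hf; lra.
Qed.

Lemma Cser_geom (w : C) : (Cmod w < 1)%R -> Cser (fun n => 1 * w ^ n) (/ (1 - w)).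
Proof.
  intros Hw.
  assert (Hne : 1 - w <> 0).
  { intros E; assert (E1 : w = 1) by (replace w with (1 - (1 - w)) by ring; rewrite E; ring).
    rewrite E1, Cmod_1 in Hw; lra. }
  assert (HA : ex_series (fun n => Cmod (1 * w ^ n))).
  { apply ex_series_ext with (fun n => Cmod w ^ n)%R.
    - intros n; rewrite Cmult_1_l, Cmod_pow; reflexivity.
    - apply ex_series_geom; rewrite Rabs_pos_eq; [exact Hw|apply Cmod_ge_0]. }
  destruct (Cser_abs _ HA) as [l Hl].
  assert (E : l - 1 * 1 = w * l).
  { apply (Cser_unique (fun n => 1 * w ^ S n)); [exact (proj1 (Cser_tail _ _) Hl)|].
    apply is_series_ext with (2 := Cser_scal w _ _ Hl); intros n.
    change (w * (1 * w ^ n) = 1 * (w * w ^ n)). ring. }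
  replace (/ (1 - w)) with l; [exact Hl|].
  assert (E2 : l * (1 - w) = 1) by (replace (l * (1 - w)) with (l - 1 * 1 + 1 - w * l) by ring; rewrite E; ring).
  replace l with (l * (1 - w) * / (1 - w)) by (field; exact Hne).
  rewrite E2; ring.
Qed.

Definition drop_head (c : C) (a : nat -> C) (n : nat) : C :=
  match n with O => 0 | S _ => c * a n end.

(* [i] is the inverse of the constant coefficient [a 0]; the expansion is the
   Neumann series of [1 / (a 0 (1 - v))], where [v] is [1 - f / a 0]. *)
Definition inv_coef (i : C) (a : nat -> C) (n : nat) : C :=
  i * comp_coef (fun _ => 1) (drop_head (- i) a) n.

(** The inverse [i] of the constant coefficient is an argument so that it can be supplied as a
    rational function of further parameters. *)
Lemma expands_inv (a : nat -> C) (i z0 : C) (f : C -> C) :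
  i * a 0%nat = 1 -> expands a z0 f -> expands (inv_coef i a) z0 (fun z => / f z).
Proof.
  intros Hi Ha.
  assert (Hi0 : i <> 0) by (intros E; rewrite E, Cmult_0_l in Hi; injection Hi; lra).
  set (v := fun z => 1 - i * f z).
  assert (Hv : expands (drop_head (- i) a) z0 v).
  { apply (near_imp _ _ _ Ha); intros z Hz; unfold v.
    apply (proj1 (Cser_tail _ _)) in Hz; cbv beta in Hz; rewrite Cmult_1_r in Hz; apply (Cser_scal (- i)) in Hz.
    apply (proj2 (Cser_tail _ _)); simpl.
    replace (1 - i * f z - 0 * 1) with (- i * (f z - a 0%nat)) by (ring_simplify; rewrite Hi; ring).
    revert Hz; apply is_series_ext; intros n; simpl; apply Cmult_assoc. }
  assert (HC := expands_comp (fun _ => 1) _ z0 1 (fun w => / (1 - w)) v Rlt_0_1 Cser_geom eq_refl Hv).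
  apply (expands_scal i) in HC.
  apply expands_ext with (2 := HC); apply near_true; intros z; unfold v.
  replace (1 - (1 - i * f z)) with (i * f z) by ring.
  (* At a zero of [f] both sides are [0] by the convention [/ 0 = 0]. *)
  destruct (Ceq_dec (f z) 0) as [->|Hf]; [rewrite Cmult_0_r|field; split; assumption].
  assert (E0 : / 0 = 0).
  { unfold Cinv; simpl; apply injective_projections; simpl; unfold Rdiv; ring. }
  rewrite E0; ring.
Qed.

(** * Complex derivatives and segment integrals *)

Notation Cderive := (@is_derive C_AbsRing C_NormedModule).

Lemma Cderive_eps (f : C -> C) (z l : C) :
  Cderive f z l <-> forall eps : R, (0 < eps)%R -> exists d : R, (0 < d)%R /\
    forall w, (Cmod (w - z) < d)%R -> (Cmod (f w - f z - (w - z) * l) <= eps * Cmod (w - z))%R.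
Proof.
  split.
  - intros [_ H] eps Heps.
    specialize (H z (fun P HP => HP) (mkposreal eps Heps)).
    destruct H as [d Hd]; exists d; split; [apply cond_pos|]; intros w Hw; exact (Hd w Hw).
  - intros H; split; [apply is_linear_scal_l|].
    intros x Hx. apply (is_filter_lim_locally_unique (K:=C_AbsRing) (V:=AbsRing_NormedModule C_AbsRing)) in Hx; subst x.
    intros eps; destruct (H eps (cond_pos eps)) as [d [Hd H']].
    exists (mkposreal d Hd); intros w Hw; exact (H' w Hw).
Qed.

Lemma Cderive_quad (f : C -> C) (z l : C) (d M : R) :
  (0 < d)%R -> (forall w, (Cmod (w - z) < d)%R ->
    (Cmod (f w - f z - (w - z) * l) <= M * (Cmod (w - z)) ^ 2)%R) -> Cderive f z l.
Proof.
  intros Hd H; apply Cderive_eps; intros eps Heps.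
  assert (HM : (0 < Rabs M + 1)%R) by (pose proof (Rabs_pos M); lra).
  exists (Rmin d (eps / (Rabs M + 1))); split; [apply Rmin_glb_lt; [exact Hd|apply Rdiv_lt_0_compat; lra]|].
  intros w Hw; pose proof (Rmin_l d (eps / (Rabs M + 1))); pose proof (Rmin_r d (eps / (Rabs M + 1))).
  apply Rle_trans with (1 := H w ltac:(lra)).
  assert (H3 : (Cmod (w - z) * (Rabs M + 1) <= eps)%R) by (apply Rle_div_r; lra).
  pose proof (Cmod_ge_0 (w - z)); pose proof (Rle_abs M); simpl; nra.
Qed.

(** Chain rule along a segment. It passes from [C] as a normed space over itself to [C] over the
    reals, where integration takes place; [Cmod_norm] identifies the norms. *)
Lemma Cderive_segment (f : C -> C) (p q l : C) (t : R) :
  Cderive f (p + RtoC t * (q - p)) l ->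
  @is_derive R_AbsRing C_R_NormedModule (fun s : R => f (p + RtoC s * (q - p))) t ((q - p) * l).
Proof.
  intros H; split; [apply is_linear_scal_l|].
  intros x Hx; apply (is_filter_lim_locally_unique (K:=R_AbsRing) (V:=R_NormedModule)) in Hx; subst x.
  intros [eps Heps]; simpl.
  set (m := Cmod (q - p)).
  assert (Hm : (0 <= m)%R) by apply Cmod_ge_0.
  destruct (proj1 (Cderive_eps _ _ _) H (eps / (m + 1))%R ltac:(apply Rdiv_lt_0_compat; lra)) as [d [Hd Hd']].
  exists (mkposreal (d / (m + 1)) ltac:(apply Rdiv_lt_0_compat; lra)).
  intros s Hs; change (Rabs (s - t) < d / (m + 1))%R in Hs.
  assert (E : (p + RtoC s * (q - p)) - (p + RtoC t * (q - p)) = RtoC (s - t) * (q - p)).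
  { rewrite RtoC_minus; ring. }
  assert (Em : (Cmod ((p + RtoC s * (q - p)) - (p + RtoC t * (q - p))) = Rabs (s - t) * m)%R).
  { rewrite E, Cmod_mult, Cmod_R; reflexivity. }
  assert (Hlt : (Rabs (s - t) * (m + 1) < d)%R) by (apply Rlt_div_r; lra).
  specialize (Hd' (p + RtoC s * (q - p))); rewrite Em, E in Hd'.
  pose proof (Rabs_pos (s - t)).
  specialize (Hd' ltac:(nra)).
  change (@norm R_AbsRing (prod_NormedModule R_AbsRing R_NormedModule R_NormedModule)
    (f (p + RtoC s * (q - p)) - f (p + RtoC t * (q - p))
     - @scal R_AbsRing C_R_NormedModule (s - t)%R ((q - p) * l))%C <= eps * Rabs (s - t))%R.
  assert (E2 : @scal R_AbsRing C_R_NormedModule (s - t)%R ((q - p) * l) = RtoC (s - t) * (q - p) * l).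
  { rewrite <- Cmult_assoc; generalize ((q - p) * l); intros c.
    unfold scal; simpl; unfold prod_scal, Cmult; simpl; unfold scal; simpl; unfold mult; simpl.
    apply injective_projections; simpl; ring. }
  rewrite E2, <- Cmod_norm; apply Rle_trans with (1 := Hd').
  apply Rle_trans with ((eps / (m + 1)) * (Rabs (s - t) * (m + 1)))%R.
  - apply Rmult_le_compat_l; [apply Rdiv_le_0_compat; lra|nra].
  - right; field; lra.
Qed.

Lemma Cderive_scal_r (f : C -> C) (z l c : C) : Cderive f z l -> Cderive (fun w => f w * c) z (l * c).
Proof.
  intros H; apply Cderive_eps; intros eps Heps.
  pose proof (Cmod_ge_0 c).
  destruct (proj1 (Cderive_eps _ _ _) H (eps / (Cmod c + 1))%R ltac:(apply Rdiv_lt_0_compat; lra)) as [d [Hd Hd']].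
  exists d; split; [exact Hd|]; intros w Hw; specialize (Hd' w Hw).
  replace (f w * c - f z * c - (w - z) * (l * c)) with ((f w - f z - (w - z) * l) * c) by ring.
  rewrite Cmod_mult.
  apply Rle_trans with ((eps / (Cmod c + 1)) * Cmod (w - z) * (Cmod c + 1))%R.
  - apply Rmult_le_compat; [apply Cmod_ge_0|apply Cmod_ge_0|exact Hd'|lra].
  - right; field; lra.
Qed.

(** Fundamental theorem of calculus. The derivative [dh] of the integrand serves to make it
    continuous. *)
Lemma seg_int_primitive (F h dh : C -> C) (p q : C) :
  (forall t : R, (0 <= t <= 1)%R -> Cderive F (p + RtoC t * (q - p)) (h (p + RtoC t * (q - p)))) ->
  (forall t : R, (0 <= t <= 1)%R -> Cderive h (p + RtoC t * (q - p)) (dh (p + RtoC t * (q - p)))) ->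
  seg_int h p q = F q - F p.
Proof.
  intros HF Hh; unfold seg_int.
  destruct (Ceq_dec (q - p) 0) as [E|Hne].
  { rewrite E, Cmult_0_l; replace q with (q - p + p) by ring; rewrite E, Cplus_0_l; ring. }
  assert (HI : is_RInt (V:=C_R_CompleteNormedModule) (fun t : R => h (p + RtoC t * (q - p))) 0 1
                 (F q / (q - p) - F p / (q - p))).
  { assert (H := is_RInt_derive (V:=C_R_CompleteNormedModule)
       (fun t : R => F (p + RtoC t * (q - p)) / (q - p)) (fun t : R => h (p + RtoC t * (q - p))) 0 1).
    assert (E1 : p + RtoC 1 * (q - p) = q) by ring.
    assert (E0 : p + RtoC 0 * (q - p) = p) by ring.
    cbv beta in H; rewrite E1, E0 in H.
    apply H.
    - intros t Ht; rewrite Rmin_left, Rmax_right in Ht by lra.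
      assert (H1 := Cderive_segment (fun w => F w * / (q - p)) p q _ t (Cderive_scal_r _ _ _ _ (HF t Ht))).
      replace ((q - p) * (h (p + t * (q - p)) * / (q - p))) with (h (p + t * (q - p))) in H1
        by (field; exact Hne).
      exact H1.
    - intros t Ht; rewrite Rmin_left, Rmax_right in Ht by lra.
      apply (ex_derive_continuous (K:=R_AbsRing) (V:=C_R_NormedModule)).
      eexists; exact (Cderive_segment h p q _ t (Hh t Ht)). }
  rewrite (is_RInt_unique (V:=C_R_CompleteNormedModule) _ _ _ _ HI).
  field; exact Hne.
Qed.

(** The integral of the zero function from [z0] to [z] is computed with the two primitives [f] and
    [0]. *)
Lemma Cderive_zero_const (f : C -> C) (z0 : C) (r : R) :
  (forall z, (Cmod (z - z0) < r)%R -> Cderive f z (RtoC 0)) ->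
  forall z, (Cmod (z - z0) < r)%R -> f z = f z0.
Proof.
  intros Hf z Hz.
  assert (Hin : forall t : R, (0 <= t <= 1)%R -> (Cmod (z0 + RtoC t * (z - z0) - z0) < r)%R).
  { intros t Ht; replace (z0 + RtoC t * (z - z0) - z0) with (RtoC t * (z - z0)) by ring.
    rewrite Cmod_mult, Cmod_R, Rabs_pos_eq by lra; pose proof (Cmod_ge_0 (z - z0)); nra. }
  assert (H : seg_int (fun _ => 0) z0 z = f z - f z0).
  { apply (seg_int_primitive f (fun _ => RtoC 0) (fun _ => RtoC 0)).
    - intros t Ht; apply Hf, Hin, Ht.
    - intros t Ht; exact (is_derive_const (K:=C_AbsRing) (V:=C_NormedModule) (RtoC 0) _). }
  assert (H' : seg_int (fun _ => 0) z0 z = 0 - 0).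
  { apply (seg_int_primitive (fun _ => RtoC 0) (fun _ => RtoC 0) (fun _ => RtoC 0));
      intros t Ht; exact (is_derive_const (K:=C_AbsRing) (V:=C_NormedModule) (RtoC 0) _). }
  rewrite H in H'; replace (f z) with (f z - f z0 + f z0) by ring; rewrite H'; ring.
Qed.

(** * Termwise differentiation of power series *)

Definition der_coef (a : nat -> C) (n : nat) : C := RtoC (INR (S n)) * a (S n).

(** The constant [(m + 1) (m + 2) rho^m] is the one of the second derivative of [u^(m+2)], so that
    these bounds sum to the series of [der_coef (der_coef a)]. *)
Lemma pow_remainder (u h : C) (rho : R) (m : nat) :
  (Cmod u + Cmod h <= rho)%R ->
  (Cmod ((u + h) ^ S (S m) - u ^ S (S m) - h * (RtoC (INR (S (S m))) * u ^ S m))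
   <= (INR (S m) * INR (S (S m)) * rho ^ m) * Cmod h ^ 2)%R.
Proof.
  intros Hr; pose proof (Cmod_ge_0 u); pose proof (Cmod_ge_0 h).
  induction m as [|m IH].
  - replace ((u + h) ^ 2 - u ^ 2 - h * (RtoC (INR 2) * u ^ 1)) with (h ^ 2).
    + rewrite Cmod_pow; simpl; nra.
    + simpl INR; rewrite RtoC_plus; simpl; ring.
  - set (n := S (S m)) in *.
    replace ((u + h) ^ S n - u ^ S n - h * (RtoC (INR (S n)) * u ^ n))
      with ((u + h) * ((u + h) ^ n - u ^ n - h * (RtoC (INR n) * u ^ S m)) + RtoC (INR n) * u ^ S m * h ^ 2).
    2:{ rewrite (S_INR n), RtoC_plus; unfold n; rewrite !Cpow_S; ring. }
    apply Rle_trans with (1 := Cmod_triangle _ _).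
    rewrite !Cmod_mult, !Cmod_pow, Cmod_R, (Rabs_pos_eq _ (pos_INR n)).
    pose proof (Cmod_triangle u h).
    apply Rle_trans with (rho * (INR (S m) * INR n * rho ^ m * Cmod h ^ 2) + INR n * rho ^ S m * Cmod h ^ 2)%R.
    + apply Rplus_le_compat.
      * apply Rmult_le_compat; [apply Cmod_ge_0|apply Cmod_ge_0|lra|exact IH].
      * apply Rmult_le_compat_r; [apply pow_le; lra|].
        apply Rmult_le_compat_l; [apply pos_INR|apply pow_incr; lra].
    + assert (E : (rho * (INR (S m) * INR n * rho ^ m * Cmod h ^ 2) + INR n * rho ^ S m * Cmod h ^ 2
               = INR n * (INR (S m) + 1) * rho ^ S m * Cmod h ^ 2)%R) by (simpl; ring).
      rewrite E; apply Rmult_le_compat_r; [apply pow_le; lra|].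
      apply Rmult_le_compat_r; [apply pow_le; lra|].
      apply Rmult_le_compat_l; [apply pos_INR|].
      rewrite (S_INR n); unfold n; rewrite (S_INR (S m)); lra.
Qed.

(** The real power series with coefficients [Cmod (a n)] keeps its radius of convergence under
    differentiation. *)
Lemma absconv_der (a : nat -> C) (rho rho' : R) :
  absconv a rho -> (0 <= rho' < rho)%R -> absconv (der_coef a) rho'.
Proof.
  intros H Hr.
  assert (HR : Rbar_lt (Rabs rho') (CV_radius (fun n => Cmod (a n)))).
  { apply Rbar_lt_le_trans with (Finite rho); [simpl; rewrite Rabs_pos_eq; lra|].
    rewrite <- (Rabs_pos_eq rho) by lra.
    apply Rbar_not_lt_le; intros Hlt; apply (CV_disk_outside _ _ Hlt).
    exact (ex_series_lim_0 _ H). }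
  rewrite <- CV_radius_derive in HR.
  apply CV_disk_inside in HR; revert HR; apply ex_series_ext; intros n.
  unfold PS_derive, der_coef.
  rewrite Cmod_mult, Cmod_R, (Rabs_pos_eq _ (pos_INR _)).
  apply Rabs_pos_eq; apply Rmult_le_pos; [|apply pow_le; lra].
  apply Rmult_le_pos; [apply pos_INR|apply Cmod_ge_0].
Qed.

Lemma Cser_derive (a : nat -> C) (z0 : C) (r : R) (f : C -> C) :
  (forall z, (Cmod (z - z0) < r)%R -> Cser (fun n => a n * (z - z0) ^ n) (f z)) ->
  forall z, (Cmod (z - z0) < r)%R ->
    exists l : C, Cser (fun n => der_coef a n * (z - z0) ^ n) l /\ Cderive f z l.
Proof.
  intros Hf z Hz; pose proof (Cmod_ge_0 (z - z0)).
  (* The fifth leaves room for the nested radii [s + 4 e] (convergence), [s + 3 e], [s + 2 e] and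
     [s + e] (absolute convergence of the series and of its first and second derivatives). *)
  set (s := Cmod (z - z0)) in *; set (e := ((r - s) / 5)%R).
  assert (He : (0 < e)%R) by (unfold e; lra).
  assert (Aa : absconv a (s + 3 * e)).
  { set (w := z0 + RtoC (s + 4 * e)).
    assert (E : Cmod (w - z0) = (s + 4 * e)%R).
    { unfold w; replace (z0 + RtoC (s + 4 * e) - z0) with (RtoC (s + 4 * e)) by ring.
      rewrite Cmod_R; apply Rabs_pos_eq; lra. }
    apply (absconv_of_Cser a (w - z0) (f w)); [apply Hf; rewrite E; unfold e; lra|rewrite E; lra]. }
  assert (Ad := absconv_der _ _ (s + 2 * e) Aa ltac:(lra)).
  destruct (absconv_der _ _ (s + e) Ad ltac:(lra)) as [M HM].
  destruct (Cser_abs _ (absconv_term _ (z - z0) _ Ad ltac:(unfold s; lra))) as [l Hl].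
  exists l; split; [exact Hl|].
  apply (Cderive_quad f z l e M He); intros w Hw.
  set (h := w - z) in *; set (u := z - z0) in *.
  assert (Ew : w - z0 = u + h) by (unfold u, h; ring).
  assert (Hfw : Cser (fun n => a n * (u + h) ^ n) (f w)).
  { rewrite <- Ew; apply Hf; rewrite Ew; pose proof (Cmod_triangle u h); fold s in H0; unfold e in *; lra. }
  assert (Hfz := Hf z Hz); fold u in Hfz.
  (* The [match] shifts the derived series by one place to align it with [a]. The terms of index [0]
     and [1] then cancel and are split off; the others are the remainders of [pow_remainder]. *)
  assert (H1 : Cser (fun n => (a n * (u + h) ^ n + -1 * (a n * u ^ n)) + (- h) * match n with O => 0 | S k => der_coef a k * u ^ k end)
      ((f w + -1 * f z) + (- h) * l)).
  { apply Cser_plus; [apply Cser_plus; [exact Hfw|apply Cser_scal; exact Hfz]|apply Cser_scal].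
    apply (proj2 (Cser_tail _ _)); replace (l - 0) with l by ring; exact Hl. }
  replace (f w + -1 * f z + - h * l) with (f w - f z - h * l) in H1 by ring.
  apply (proj1 (Cser_tail _ _)) in H1; cbv beta iota in H1.
  replace (f w - f z - h * l - (a 0%nat * (u + h) ^ 0 + -1 * (a 0%nat * u ^ 0) + - h * 0)) with (f w - f z - h * l) in H1
    by (simpl; ring).
  apply (proj1 (Cser_tail _ _)) in H1; cbv beta iota in H1.
  replace (f w - f z - h * l - (a 1%nat * (u + h) ^ 1 + -1 * (a 1%nat * u ^ 1) + - h * (der_coef a 0 * u ^ 0))) with (f w - f z - h * l) in H1
    by (unfold der_coef; simpl; ring).
  assert (HMS : is_series (fun n => Cmod (der_coef (der_coef a) n) * (s + e) ^ n * Cmod h ^ 2)%R (M * Cmod h ^ 2)%R).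
  { rewrite Rmult_comm; apply is_series_ext with (2 := is_series_scal (Cmod h ^ 2)%R _ _ HM).
    intros n; apply Rmult_comm. }
  assert (Hterm : forall n, (Cmod (a (S (S n)) * (u + h) ^ S (S n) + -1 * (a (S (S n)) * u ^ S (S n)) +
      - h * (der_coef a (S n) * u ^ S n)) <= Cmod (der_coef (der_coef a) n) * (s + e) ^ n * Cmod h ^ 2)%R).
  { intros n.
    replace (a (S (S n)) * (u + h) ^ S (S n) + -1 * (a (S (S n)) * u ^ S (S n)) + - h * (der_coef a (S n) * u ^ S n))
      with (a (S (S n)) * ((u + h) ^ S (S n) - u ^ S (S n) - h * (RtoC (INR (S (S n))) * u ^ S n)))
      by (unfold der_coef; ring).
    unfold der_coef; rewrite !Cmod_mult, !Cmod_R, !(Rabs_pos_eq _ (pos_INR _)).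
    apply Rle_trans with (Cmod (a (S (S n))) * (INR (S n) * INR (S (S n)) * (s + e) ^ n * Cmod h ^ 2))%R.
    - apply Rmult_le_compat_l; [apply Cmod_ge_0|apply pow_remainder; fold s; lra].
    - right; ring. }
  assert (HE : ex_series (fun n => Cmod (a (S (S n)) * (u + h) ^ S (S n) + -1 * (a (S (S n)) * u ^ S (S n)) +
      - h * (der_coef a (S n) * u ^ S n)))).
  { refine (ex_series_le (K:=R_AbsRing) (V:=R_CompleteNormedModule) _ _ _ (ex_intro _ _ HMS)).
    intros n; unfold norm; simpl; unfold abs; simpl; rewrite Rabs_pos_eq by apply Cmod_ge_0; apply Hterm. }
  apply Rle_trans with (1 := Cser_Cmod_le _ _ _ H1 (Series_correct _ HE)).
  rewrite <- (is_series_unique _ _ HMS); apply Series_le; [|eexists; exact HMS].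
  intros n; split; [apply Cmod_ge_0|apply Hterm].
Qed.

Fixpoint der_coef_n (j : nat) (a : nat -> C) : nat -> C :=
  match j with O => a | S j' => der_coef (der_coef_n j' a) end.

Lemma Cser_derive_n (a : nat -> C) (z0 : C) (r : R) (f : C -> C) (j : nat) :
  (forall z, (Cmod (z - z0) < r)%R -> Cser (fun n => a n * (z - z0) ^ n) (f z)) ->
  forall z, (Cmod (z - z0) < r)%R ->
    Cser (fun n => der_coef_n j a n * (z - z0) ^ n) (derive_n j f z).
Proof.
  intros Hf; induction j as [|j IH]; [exact Hf|].
  intros z Hz; destruct (Cser_derive _ _ _ _ IH z Hz) as [l [H1 H2]]; simpl.
  rewrite (is_C_derive_unique _ _ _ H2); exact H1.
Qed.

Lemma der_coef_n_eq (j n : nat) (a : nat -> C) :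
  der_coef_n j a n = RtoC (INR (fact (n + j)) / INR (fact n)) * a (n + j)%nat.
Proof.
  revert n; induction j as [|j IH]; intros n; simpl der_coef_n.
  - rewrite Nat.add_0_r; unfold Rdiv; rewrite Rinv_r by apply INR_fact_neq_0; ring.
  - unfold der_coef; rewrite IH, Cmult_assoc, <- RtoC_mult.
    replace (S n + j)%nat with (n + S j)%nat by lia.
    f_equal; f_equal; rewrite fact_simpl, mult_INR; field; split; [apply INR_fact_neq_0|apply not_0_INR; lia].
Qed.

Lemma derive_n_coef (a : nat -> C) (z0 : C) (r : R) (f : C -> C) (j : nat) : (0 < r)%R ->
  (forall z, (Cmod (z - z0) < r)%R -> Cser (fun n => a n * (z - z0) ^ n) (f z)) ->
  derive_n j f z0 = RtoC (INR (fact j)) * a j.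
Proof.
  intros Hr Hf.
  assert (E : z0 - z0 = 0) by ring.
  assert (H := Cser_derive_n a z0 r f j Hf z0 ltac:(rewrite E, Cmod_0; exact Hr)); rewrite E in H.
  apply (Cser_unique _ _ _ H).
  apply Cser_first; [|intros; simpl; ring].
  rewrite der_coef_n_eq; simpl; rewrite Rdiv_1_r; ring.
Qed.

(** * Branch points, and rational functions with poles only there *)

(** The zeros of [dx], indexed by a boolean so that one argument based on [branch_sq] treats
    both. *)
Definition branch (b : bool) : C := if b then 1 else -1.

Lemma branch_sq (b : bool) : branch b * branch b = 1.
Proof. destruct b; simpl; ring. Qed.

Lemma branch_neq_0 (b : bool) : branch b <> 0.
Proof. intros E; pose proof (branch_sq b) as H; rewrite E, Cmult_0_l in H; injection H; lra. Qed.

Definition regular (z : C) : Prop := forall b, z - branch b <> 0.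

(* Coordinates beyond the end of the list read as [0], which is regular. *)
Definition good (t : list C) : Prop := forall i, regular (nth i t 0).

(* Rational functions of the entries of a list, with poles only where an entry is [1] or [-1]. *)
Inductive rational : (list C -> C) -> Prop :=
| rational_const c : rational (fun _ => c)
| rational_coord i : rational (fun t => nth i t 0)
| rational_pole i b : rational (fun t => / (nth i t 0 - branch b))
| rational_add f g : rational f -> rational g -> rational (fun t => f t + g t)
| rational_mul f g : rational f -> rational g -> rational (fun t => f t * g t).

Lemma rational_Csum (f : nat -> list C -> C) (n : nat) :
  (forall k, (k <= n)%nat -> rational (f k)) -> rational (fun t => Csum (fun k => f k t) n).
Proof.
  induction n as [|n IH]; intros H.
  - replace (fun t => Csum (fun k => f k t) 0) with (f 0%nat); [apply H; lia|].
    apply functional_extensionality; intros t; rewrite Csum_O; reflexivity.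
  - replace (fun t => Csum (fun k => f k t) (S n)) with (fun t => Csum (fun k => f k t) n + f (S n) t).
    + apply rational_add; [apply IH; intros; apply H; lia|apply H; lia].
    + apply functional_extensionality; intros t; rewrite Csum_S; reflexivity.
Qed.

Lemma rational_conv (a b : nat -> list C -> C) (n : nat) :
  (forall k, rational (a k)) -> (forall k, rational (b k)) ->
  rational (fun t => conv (fun k => a k t) (fun k => b k t) n).
Proof.
  intros Ha Hb; apply (rational_Csum (fun k t => a k t * b (n - k)%nat t)).
  intros k _; apply rational_mul; auto.
Qed.

Lemma rational_conv_pow (b : nat -> list C -> C) (n m : nat) :
  (forall k, rational (b k)) -> rational (fun t => conv_pow (fun k => b k t) n m).
Proof.
  intros Hb; revert m; induction n as [|n IH]; intros m.
  - destruct m; [exact (rational_const 1)|exact (rational_const 0)].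
  - apply (rational_conv b (fun k t => conv_pow (fun k => b k t) n k) m Hb IH).
Qed.

(** Each coefficient of the Neumann series is a polynomial in [i] and the [a k]. *)
Lemma rational_inv_coef (a : nat -> list C -> C) (i : list C -> C) (n : nat) :
  (forall k, rational (a k)) -> rational i -> rational (fun t => inv_coef (i t) (fun k => a k t) n).
Proof.
  intros Ha Hi; apply rational_mul; [exact Hi|].
  apply (rational_Csum (fun k t => 1 * conv_pow (drop_head (- i t) (fun j => a j t)) k n)).
  intros k _; apply rational_mul; [apply rational_const|].
  apply (rational_conv_pow (fun j t => drop_head (- i t) (fun j => a j t) j)).
  intros [|j]; [exact (rational_const 0)|].
  apply rational_mul; [|apply Ha].
  replace (fun t => - i t) with (fun t => -1 * i t) by (apply functional_extensionality; intros t; ring).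
  apply rational_mul; [apply rational_const|exact Hi].
Qed.

(** * Laurent expansions with rational coefficients *)

(** The list [t] holds the spectator coordinates. The radius of validity may depend on [t], but the
    coefficients are rational functions of [t]. *)
Definition holomorphic (al : C) (F : list C -> C -> C) : Prop :=
  exists a : nat -> list C -> C, (forall k, rational (a k)) /\
    forall t, good t -> expands (fun k => a k t) al (F t).

Definition laurent (al : C) (F : list C -> C -> C) : Prop :=
  exists p : nat, holomorphic al (fun t z => (z - al) ^ p * F t z).

Lemma holomorphic_ext (al : C) (F G : list C -> C -> C) :
  (forall t, good t -> near al (fun z => F t z = G t z)) -> holomorphic al F -> holomorphic al G.
Proof.
  intros H [a [Ha HF]]; exists a; split; [exact Ha|]; intros t Ht.
  apply expands_ext with (2 := HF t Ht); apply H, Ht.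
Qed.

Lemma holomorphic_plus (al : C) (F G : list C -> C -> C) :
  holomorphic al F -> holomorphic al G -> holomorphic al (fun t z => F t z + G t z).
Proof.
  intros [a [Ha HF]] [b [Hb HG]]; exists (fun k t => a k t + b k t); split.
  - intros k; apply rational_add; auto.
  - intros t Ht; apply (expands_plus (fun k => a k t) (fun k => b k t)); auto.
Qed.

Lemma holomorphic_mult (al : C) (F G : list C -> C -> C) :
  holomorphic al F -> holomorphic al G -> holomorphic al (fun t z => F t z * G t z).
Proof.
  intros [a [Ha HF]] [b [Hb HG]]; exists (fun k t => conv (fun k => a k t) (fun k => b k t) k); split.
  - intros k; apply (rational_conv a b k Ha Hb).
  - intros t Ht; apply (expands_mult (fun k => a k t) (fun k => b k t)); auto.
Qed.

Lemma holomorphic_const (al : C) (f : list C -> C) : rational f -> holomorphic al (fun t _ => f t).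
Proof.
  intros Hf; exists (fun k t => monomial (f t) 0 k); split.
  - intros [|k]; [exact Hf|exact (rational_const 0)].
  - intros t _; apply expands_ext with (2 := expands_monomial (f t) al 0).
    apply near_true; intros z; simpl; ring.
Qed.

Lemma holomorphic_fixed (al : C) (a : nat -> C) (f : C -> C) : expands a al f -> holomorphic al (fun _ z => f z).
Proof. intros H; exists (fun k _ => a k); split; [intros k; apply rational_const|intros t _; exact H]. Qed.

Lemma holomorphic_pow (al : C) (p : nat) : holomorphic al (fun _ z => (z - al) ^ p).
Proof.
  apply holomorphic_fixed with (monomial 1 p).
  apply expands_ext with (2 := expands_monomial 1 al p); apply near_true; intros z; ring.
Qed.

Lemma holomorphic_inv (al : C) (a : nat -> list C -> C) (i : list C -> C) (F : list C -> C -> C) :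
  (forall k, rational (a k)) -> rational i -> (forall t, good t -> i t * a 0%nat t = 1) ->
  (forall t, good t -> expands (fun k => a k t) al (F t)) -> holomorphic al (fun t z => / F t z).
Proof.
  intros Ha Hi H1 HF; exists (fun k t => inv_coef (i t) (fun j => a j t) k); split.
  - intros k; apply rational_inv_coef; auto.
  - intros t Ht; apply (expands_inv (fun j => a j t)); auto.
Qed.

Lemma laurent_holomorphic (al : C) (F : list C -> C -> C) : holomorphic al F -> laurent al F.
Proof.
  intros H; exists 0%nat; apply holomorphic_ext with (2 := H); intros t _; apply near_true; intros z; simpl; ring.
Qed.

Lemma laurent_ext (al : C) (F G : list C -> C -> C) :
  (forall t, good t -> near al (fun z => F t z = G t z)) -> laurent al F -> laurent al G.
Proof.
  intros H [p HF]; exists p; apply holomorphic_ext with (2 := HF); intros t Ht.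
  apply near_imp with (1 := H t Ht); intros z ->; reflexivity.
Qed.

Lemma laurent_const (al : C) (f : list C -> C) : rational f -> laurent al (fun t _ => f t).
Proof. intros H; apply laurent_holomorphic, holomorphic_const, H. Qed.

Lemma laurent_fixed (al : C) (a : nat -> C) (f : C -> C) : expands a al f -> laurent al (fun _ z => f z).
Proof. intros H; apply laurent_holomorphic, holomorphic_fixed with a, H. Qed.

Lemma laurent_plus (al : C) (F G : list C -> C -> C) :
  laurent al F -> laurent al G -> laurent al (fun t z => F t z + G t z).
Proof.
  intros [p HF] [q HG]; exists (p + q)%nat.
  assert (H := holomorphic_plus _ _ _ (holomorphic_mult _ _ _ (holomorphic_pow al q) HF) (holomorphic_mult _ _ _ (holomorphic_pow al p) HG)).
  apply holomorphic_ext with (2 := H); intros t _; apply near_true; intros z.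
  rewrite Cpow_add_r; ring.
Qed.

Lemma laurent_mult (al : C) (F G : list C -> C -> C) :
  laurent al F -> laurent al G -> laurent al (fun t z => F t z * G t z).
Proof.
  intros [p HF] [q HG]; exists (p + q)%nat.
  apply holomorphic_ext with (2 := holomorphic_mult _ _ _ HF HG); intros t _; apply near_true; intros z.
  rewrite Cpow_add_r; ring.
Qed.

Lemma laurent_id (al : C) : laurent al (fun _ z => z).
Proof.
  apply laurent_holomorphic.
  apply holomorphic_ext with (2 := holomorphic_plus _ _ _ (holomorphic_const al _ (rational_const al)) (holomorphic_pow al 1)).
  intros t _; apply near_true; intros z; simpl; ring.
Qed.

Lemma laurent_inv_self (al : C) : laurent al (fun _ z => / (z - al)).
Proof.
  exists 1%nat; apply holomorphic_ext with (2 := holomorphic_const al _ (rational_const 1)).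
  intros t _; apply near_imp with (1 := near_self al); intros z Hz; field; exact Hz.
Qed.

Lemma laurent_inv_shift (al : C) (f i : list C -> C) :
  rational f -> rational i -> (forall t, good t -> i t * (al - f t) = 1) -> laurent al (fun t z => / (z - f t)).
Proof.
  intros Hf Hi H; apply laurent_holomorphic.
  apply (holomorphic_inv al (fun k t => monomial (al + -1 * f t) 0 k + monomial 1 1 k) i).
  - intros k; apply rational_add; unfold monomial.
    + destruct (k =? 0)%nat; [|apply rational_const].
      apply rational_add; [apply rational_const|apply rational_mul; [apply rational_const|exact Hf]].
    + destruct (k =? 1)%nat; apply rational_const.
  - exact Hi.
  - intros t Ht; unfold monomial; simpl. rewrite <- (H t Ht); ring.
  - intros t Ht.
    apply expands_ext with (2 := expands_plus _ _ _ _ _ (expands_monomial (al + -1 * f t) al 0) (expands_monomial 1 al 1)).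
    apply near_true; intros z; simpl; ring.
Qed.

Lemma laurent_inv_z (b : bool) : laurent (branch b) (fun _ z => / z).
Proof.
  apply laurent_ext with (fun _ z => / (z - 0)).
  - intros t _; apply near_true; intros z; f_equal; ring.
  - apply (laurent_inv_shift (branch b) (fun _ => 0) (fun _ => branch b)); [apply rational_const|apply rational_const|].
    intros t _; rewrite <- (branch_sq b); ring.
Qed.

Lemma laurent_inv_pole (b b' : bool) : laurent (branch b) (fun _ z => / (z - branch b')).
Proof.
  destruct (Bool.bool_dec b b') as [->|Hne]; [apply laurent_inv_self|].
  assert (E : branch b' = - branch b) by (destruct b, b'; try congruence; simpl; ring).
  apply (laurent_inv_shift (branch b) (fun _ => branch b') (fun _ => branch b * / 2)); [apply rational_const|apply rational_const|].
  intros t _; rewrite E. replace (branch b * / 2 * (branch b - - branch b)) with (branch b * branch b) by field.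
  apply branch_sq.
Qed.

(** * Substitution of [z], [1/z] or a fixed coordinate into rational functions *)

Lemma near_branch_neq_0 (b : bool) : near (branch b) (fun z => z <> 0).
Proof. apply near_neq. Qed.

Lemma near_regular (b : bool) : near (branch b) regular.
Proof.
  apply near_imp with (1 := near_and _ _ _ (near_neq (branch b) 1) (near_neq (branch b) (-1))).
  intros z [H1 H2] b' E; destruct b'; [apply H1|apply H2].
  - simpl in *; replace z with (z - 1 + 1) by ring; rewrite E; ring.
  - simpl in *; replace z with (z - -1 + -1) by ring; rewrite E; ring.
Qed.

(** Both branch points are fixed by [z -> 1/z]. *)
Lemma regular_inv (z : C) : z <> 0 -> regular z -> regular (/ z).
Proof.
  intros Hz Hr b E; apply (Hr b).
  assert (E1 : / z = branch b) by (replace (/ z) with (/ z - branch b + branch b) by ring; rewrite E; ring).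
  replace z with (z * (branch b * branch b)) by (rewrite branch_sq; ring).
  rewrite <- E1 at 1; field_simplify; [ring|exact Hz].
Qed.

(* [s t z] can be substituted for a coordinate of any [rational] function. *)
Definition moving (al : C) (s : list C -> C -> C) : Prop :=
  laurent al s /\ (forall b, laurent al (fun t z => / (s t z - branch b))) /\
  (forall t, good t -> near al (fun z => regular (s t z))).

Lemma moving_z (b : bool) : moving (branch b) (fun _ z => z).
Proof.
  split; [apply laurent_id|]; split; [intros b'; apply laurent_inv_pole|].
  intros t _; apply near_regular.
Qed.

Lemma moving_hat (b : bool) : moving (branch b) (fun _ z => hat z).
Proof.
  split; [apply laurent_inv_z|]; split.
  - intros b'.
    (* With [branch b' ^ 2 = 1], [1/z - branch b'] equals [- branch b' (z - branch b') / z]. *)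
    apply laurent_ext with (fun _ z => (- branch b' * z) * / (z - branch b')).
    + intros t _; apply near_imp with (1 := near_and _ _ _ (near_branch_neq_0 b) (near_regular b)).
      intros z [H1 H2]; unfold hat.
      assert (H3 := regular_inv z H1 H2 b'); specialize (H2 b').
      assert (E : / z - branch b' = - branch b' * (z - branch b') * / z).
      { transitivity (branch b' * branch b' * / z - branch b'); [rewrite branch_sq; ring|field; exact H1]. }
      rewrite E; pose proof (branch_neq_0 b').
      transitivity (- (branch b' * branch b') * z * / (z - branch b') * / branch b').
      { field; repeat split; assumption. }
      rewrite branch_sq; field; repeat split; try assumption.
    + apply laurent_mult; [apply laurent_mult; [apply (laurent_const _ _ (rational_const _))|apply laurent_id]|apply laurent_inv_pole].
  - intros t _; apply near_imp with (1 := near_and _ _ _ (near_branch_neq_0 b) (near_regular b)).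
    intros z [H1 H2]; apply regular_inv; assumption.
Qed.

Lemma moving_coord (al : C) (i : nat) : moving al (fun t _ => nth i t 0).
Proof.
  split; [apply laurent_const, rational_coord|]; split; [intros b; apply laurent_const, rational_pole|].
  intros t Ht; apply near_true; intros z; apply Ht.
Qed.

Lemma regular_0 : regular 0.
Proof. intros b E; apply (branch_neq_0 b). replace (branch b) with (- (0 - branch b)) by ring; rewrite E; ring. Qed.

Lemma moving_0 (al : C) : moving al (fun _ _ => 0).
Proof.
  split; [apply (laurent_const al _ (rational_const 0))|]; split; [intros b; apply (laurent_const al _ (rational_const _))|].
  intros t Ht; apply near_true; intros z; apply regular_0.
Qed.

(** An index beyond the list reads the default [0], which is admissible by [moving_0]. *)
Lemma nth_map_moving (al : C) (ss : list (list C -> C -> C)) (i : nat) :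
  List.Forall (moving al) ss ->
  exists s, moving al s /\ forall t z, nth i (map (fun s => s t z) ss) 0 = s t z.
Proof.
  intros H; revert i; induction H as [|s ss Hs Hss IH]; intros [|i].
  - exists (fun _ _ => 0); split; [apply moving_0|reflexivity].
  - exists (fun _ _ => 0); split; [apply moving_0|reflexivity].
  - exists s; split; [exact Hs|reflexivity].
  - destruct (IH i) as [s' [H1 H2]]; exists s'; split; [exact H1|exact H2].
Qed.

(** Turns rationality of the lower invariants, the induction hypothesis of the recursion, into
    meromorphy in [z] of the bracket. *)
Lemma laurent_rational (al : C) (rho : list C -> C) (ss : list (list C -> C -> C)) :
  rational rho -> List.Forall (moving al) ss -> laurent al (fun t z => rho (map (fun s => s t z) ss)).
Proof.
  intros Hr Hss; induction Hr as [c|i|i b|f g Hf IHf Hg IHg|f g Hf IHf Hg IHg].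
  - apply (laurent_const al _ (rational_const c)).
  - destruct (nth_map_moving al ss i Hss) as [s [[H1 _] E]].
    apply laurent_ext with (2 := H1); intros t _; apply near_true; intros z; symmetry; apply E.
  - destruct (nth_map_moving al ss i Hss) as [s [[_ [H1 _]] E]].
    apply laurent_ext with (2 := H1 b); intros t _; apply near_true; intros z; rewrite E; reflexivity.
  - apply laurent_plus; assumption.
  - apply laurent_mult; assumption.
Qed.

Lemma near_good (al : C) (ss : list (list C -> C -> C)) (t : list C) :
  List.Forall (moving al) ss -> good t -> near al (fun z => good (map (fun s => s t z) ss)).
Proof.
  intros Hss Ht; induction Hss as [|s ss [_ [_ Hs]] Hss IH].
  - apply near_true; intros z [|i]; apply regular_0.
  - apply near_imp with (1 := near_and _ _ _ (Hs t Ht) IH).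
    intros z [H1 H2] [|i]; simpl; [exact H1|apply H2].
Qed.

(** * Residues *)

Lemma expands_shift (a : nat -> C) (k : nat) (z0 : C) (f : C -> C) :
  expands a z0 f -> expands (fun n => if (n <? k)%nat then 0 else a (n - k)%nat) z0 (fun z => (z - z0) ^ k * f z).
Proof.
  intros H; apply (near_imp _ _ _ H); intros z Hz.
  apply (is_series_shift (V:=C_NormedModule) _ k) in Hz.
  apply is_series_ext with (2 := Cser_scal ((z - z0) ^ k) _ _ Hz); intros n.
  destruct (Nat.ltb_spec n k) as [Hn|Hn].
  - change ((z - z0) ^ k * 0 = 0 * (z - z0) ^ n); ring.
  - change ((z - z0) ^ k * (a (n - k)%nat * (z - z0) ^ (n - k)) = a (n - k)%nat * (z - z0) ^ n).
    replace ((z - z0) ^ n) with ((z - z0) ^ k * (z - z0) ^ (n - k)) by (rewrite <- Cpow_add_r; f_equal; lia).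
    ring.
Qed.

Lemma is_residue_expands (f : C -> C) (z0 c : C) :
  is_residue f z0 c <->
  exists k a, expands a z0 (fun z => (z - z0) ^ S k * f z) /\ c = a k.
Proof.
  split.
  - intros [k [a [r [Hr [H E]]]]]; exists k, a; split; [|exact E].
    exists r; split; [exact Hr|]; intros z Hz; exact (proj1 (is_pseries_Cser _ _ _) (H z Hz)).
  - intros [k [a [[r [Hr H]] E]]]; exists k, a, r; split; [exact Hr|]; split; [|exact E].
    intros z Hz; apply is_pseries_Cser, H, Hz.
Qed.

Lemma expands_pole_residue (p : nat) (a : nat -> C) (z0 : C) (f : C -> C) :
  expands a z0 (fun z => (z - z0) ^ p * f z) ->
  is_residue f z0 (match p with O => 0 | S k => a k end).
Proof.
  intros H; apply is_residue_expands; destruct p as [|k]; [|exists k, a; auto].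
  (* [is_residue] requires at least one factor [z - z0], so the holomorphic case is shifted by one
     degree. *)
  exists 0%nat, (fun n => if (n <? 1)%nat then RtoC 0 else a (n - 1)%nat); split; [|reflexivity].
  apply expands_ext with (2 := expands_shift a 1 z0 _ H); apply near_true; intros z; simpl; ring.
Qed.

Lemma is_residue_unique (f : C -> C) (z0 c c' : C) : is_residue f z0 c -> is_residue f z0 c' -> c = c'.
Proof.
  intros H H'; apply is_residue_expands in H, H'.
  destruct H as [k [a [H ->]]]; destruct H' as [k' [a' [H' ->]]].
  (* Both expansions are brought to the common factor of degree [k + k' + 1], where the residue sits
     in degree [k + k']. *)
  apply (expands_shift _ k') in H; apply (expands_shift _ k) in H'.
  apply (expands_ext _ _ _ (fun z => (z - z0) ^ k' * ((z - z0) ^ S k * f z))) in H';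
    [|apply near_true; intros z; simpl; ring].
  assert (E := expands_unique _ _ _ _ H H' (k + k')%nat); simpl in E.
  replace (k + k' <? k')%nat with false in E by (symmetry; apply Nat.ltb_ge; lia).
  replace (k + k' <? k)%nat with false in E by (symmetry; apply Nat.ltb_ge; lia).
  replace (k + k' - k')%nat with k in E by lia; replace (k + k' - k)%nat with k' in E by lia.
  exact E.
Qed.

Lemma Res_eq (f : C -> C) (z0 c : C) : is_residue f z0 c -> Res f z0 = c.
Proof.
  intros H; unfold Res; apply is_residue_unique with f z0; [|exact H].
  apply epsilon_spec; exists c; exact H.
Qed.

Lemma is_residue_ext (f g : C -> C) (z0 c : C) :
  near z0 (fun z => f z = g z) -> is_residue f z0 c -> is_residue g z0 c.
Proof.
  intros H Hf; apply is_residue_expands in Hf; apply is_residue_expands.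
  destruct Hf as [k [a [Hf E]]]; exists k, a; split; [|exact E].
  apply expands_ext with (2 := Hf); apply near_imp with (1 := H); intros z ->; reflexivity.
Qed.

Lemma is_residue_plus (f g : C -> C) (z0 c c' : C) :
  is_residue f z0 c -> is_residue g z0 c' -> is_residue (fun z => f z + g z) z0 (c + c').
Proof.
  intros H H'; apply is_residue_expands in H, H'.
  destruct H as [k [a [H ->]]]; destruct H' as [k' [a' [H' ->]]].
  apply (expands_shift _ (S k')) in H; apply (expands_shift _ (S k)) in H'.
  assert (HS := expands_plus _ _ _ _ _ H H').
  apply (expands_ext _ _ _ (fun z => (z - z0) ^ (S k' + S k) * (f z + g z))) in HS;
    [|apply near_true; intros z; rewrite Cpow_add_r; ring].
  assert (HP := expands_pole_residue (S k' + S k) _ z0 _ HS).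
  simpl Nat.add in HP; cbv iota beta in HP.
  replace (k' + S k <? S k')%nat with false in HP by (symmetry; apply Nat.ltb_ge; lia).
  replace (k' + S k <? S k)%nat with false in HP by (symmetry; apply Nat.ltb_ge; lia).
  replace (k' + S k - S k')%nat with k in HP by lia; replace (k' + S k - S k)%nat with k' in HP by lia.
  exact HP.
Qed.

Lemma is_residue_scal (d : C) (f : C -> C) (z0 c : C) :
  is_residue f z0 c -> is_residue (fun z => d * f z) z0 (d * c).
Proof.
  intros H; apply is_residue_expands in H; destruct H as [k [a [H ->]]].
  apply is_residue_expands; exists k, (fun n => d * a n); split; [|reflexivity].
  apply expands_ext with (2 := expands_scal d _ _ _ H); apply near_true; intros z; ring.
Qed.

Lemma is_residue_holomorphic (a : nat -> C) (f : C -> C) (z0 : C) : expands a z0 f -> is_residue f z0 0.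
Proof.
  intros H; apply (expands_pole_residue 0 a).
  apply expands_ext with (2 := H); apply near_true; intros z; simpl; ring.
Qed.

(** The residue is one of the Laurent coefficients, so it is rational in the spectator
    coordinates. *)
Lemma laurent_residue (al : C) (F : list C -> C -> C) :
  laurent al F -> exists rho, rational rho /\ forall t, good t -> is_residue (F t) al (rho t).
Proof.
  intros [p [a [Ha H]]].
  exists (match p with O => fun _ => RtoC 0 | S k => a k end); split.
  - destruct p; [apply rational_const|apply Ha].
  - intros t Ht; assert (H1 := expands_pole_residue p _ al _ (H t Ht)); destruct p; exact H1.
Qed.

(** * The kernel of the recursion *)

Lemma Cderive_AbsRing (f : C -> C) (z l : C) :
  Cderive f z l <-> @is_derive C_AbsRing (AbsRing_NormedModule C_AbsRing) f z l.
Proof. split; intros [_ H]; (split; [apply is_linear_scal_l|exact H]). Qed.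

Lemma Cderive_mult (f g : C -> C) (z l m : C) :
  Cderive f z l -> Cderive g z m -> Cderive (fun w => f w * g w) z (l * g z + f z * m).
Proof.
  intros H1 H2; apply Cderive_AbsRing.
  exact (is_derive_mult (K:=C_AbsRing) f g z l m (proj1 (Cderive_AbsRing _ _ _) H1)
           (proj1 (Cderive_AbsRing _ _ _) H2) Cmult_comm).
Qed.

Lemma Cderive_plus (f g : C -> C) (z l m : C) :
  Cderive f z l -> Cderive g z m -> Cderive (fun w => f w + g w) z (l + m).
Proof. exact (is_derive_plus (K:=C_AbsRing) (V:=C_NormedModule) f g z l m). Qed.

Lemma Cderive_id (z : C) : Cderive (fun w => w) z (RtoC 1).
Proof.
  apply (Cderive_quad _ _ _ 1 0 Rlt_0_1); intros w _.
  replace (w - z - (w - z) * 1) with (RtoC 0) by ring; rewrite Cmod_0; lra.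
Qed.

Lemma Cderive_inv_sub (c z : C) : c - z <> 0 -> Cderive (fun w => / (c - w)) z (/ (c - z) ^ 2).
Proof.
  intros H; assert (Hp : (0 < Cmod (c - z))%R) by (apply Cmod_gt_0; exact H).
  set (m := Cmod (c - z)) in *.
  (* The remainder is [(w - z)^2 / ((c - w) (c - z)^2)], and [Cmod (c - w)] is at least [m / 2] on
     this disc. *)
  apply (Cderive_quad _ _ _ (m / 2) (2 / m ^ 3)); [lra|]; intros w Hw.
  assert (Hcw : (m / 2 <= Cmod (c - w))%R).
  { pose proof (Cmod_triangle (c - w) (w - z)) as H1.
    replace (c - w + (w - z)) with (c - z) in H1 by ring; fold m in H1; lra. }
  assert (Hne : c - w <> 0) by (apply Cmod_gt_0; lra).
  replace (/ (c - w) - / (c - z) - (w - z) * / (c - z) ^ 2)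
    with ((w - z) ^ 2 * (/ (c - w) * / (c - z) ^ 2)) by (field; split; assumption).
  rewrite !Cmod_mult, !Cmod_inv, !Cmod_pow by (try apply Cpow_nz; assumption); fold m.
  rewrite Rmult_comm; apply Rmult_le_compat_r; [apply pow_le, Cmod_ge_0|].
  replace (2 / m ^ 3)%R with (/ (m / 2) * / m ^ 2)%R by (field; lra).
  apply Rmult_le_compat_r; [left; apply Rinv_0_lt_compat, pow_lt; lra|].
  apply Rinv_le_contravar; lra.
Qed.

Lemma Cderive_inv (z : C) : z <> 0 -> Cderive (fun w => / w) z (- / z ^ 2).
Proof.
  intros Hz; assert (Hz' : 0 - z <> 0).
  { intros E; apply Hz; replace z with (- (0 - z)) by ring; rewrite E; ring. }
  assert (H := Cderive_scal_r _ _ _ (-1) (Cderive_inv_sub 0 z Hz')).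
  replace (/ (0 - z) ^ 2 * -1) with (- / z ^ 2) in H by (field; repeat split; try assumption).
  apply is_derive_ext with (2 := H); intros w; change (/ (0 - w) * -1 = / w).
  destruct (Ceq_dec w 0) as [->|Hw].
  - replace (0 - 0) with (RtoC 0) by ring.
    unfold Cinv, Cmult; simpl; apply injective_projections; simpl; unfold Rdiv; ring.
  - field; exact Hw.
Qed.

Lemma dhat_eq (z : C) : z <> 0 -> dhat z = - / z ^ 2.
Proof. intros Hz; apply is_C_derive_unique, Cderive_inv, Hz. Qed.

Lemma dx_eq (z : C) : z <> 0 -> dx z = 1 - / z ^ 2.
Proof. intros Hz; apply is_C_derive_unique, (Cderive_plus (fun w => w)); [apply Cderive_id|apply Cderive_inv, Hz]. Qed.

Lemma seg_int_Bker (w p q : C) :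
  (forall t : R, (0 <= t <= 1)%R -> w - (p + RtoC t * (q - p)) <> 0) ->
  seg_int (Bker w) p q = / (w - q) - / (w - p).
Proof.
  intros H.
  apply (seg_int_primitive (fun z => / (w - z)) (Bker w)
    (fun z => / (w - z) ^ 2 * (/ (w - z) * 1) + / (w - z) * (/ (w - z) ^ 2 * 1))).
  - intros t Ht; apply Cderive_inv_sub, H, Ht.
  - intros t Ht; specialize (H t Ht); set (z := p + RtoC t * (q - p)) in *.
    assert (H1 := Cderive_mult _ _ _ _ _ (Cderive_inv_sub w z H) (Cderive_inv_sub w z H)).
    replace (/ (w - z) ^ 2 * (/ (w - z) * 1) + / (w - z) * (/ (w - z) ^ 2 * 1))
      with (/ (w - z) ^ 2 * / (w - z) + / (w - z) * / (w - z) ^ 2) by ring.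
    apply is_derive_ext_loc with (2 := H1).
    assert (Hp : (0 < Cmod (w - z))%R) by (apply Cmod_gt_0; exact H).
    exists (mkposreal _ Hp); intros u Hu; change (Cmod (u - z) < Cmod (w - z))%R in Hu.
    unfold Bker; assert (Hne : w - u <> 0).
    { intros E; replace (u - z) with (w - z - (w - u)) in Hu by ring.
      rewrite E in Hu; replace (w - z - 0) with (w - z) in Hu by ring; lra. }
    change (/ (w - u) * / (w - u) = / (w - u) ^ 2); field; exact Hne.
Qed.

Lemma Cmod_branch (b : bool) : Cmod (branch b) = 1%R.
Proof. destruct b; simpl; [apply Cmod_1|rewrite Cmod_R, Rabs_left; lra]. Qed.

Lemma near_hat_close (b : bool) (d : R) : (0 < d)%R ->
  near (branch b) (fun z => (Cmod (z - branch b) < d)%R /\ (Cmod (hat z - branch b) < d)%R).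
Proof.
  intros Hd; exists (Rmin (1 / 2) (d / 2)); split; [apply Rmin_glb_lt; lra|]; intros z [_ Hz].
  pose proof (Rmin_l (1 / 2) (d / 2)); pose proof (Rmin_r (1 / 2) (d / 2)).
  split; [lra|].
  assert (H1 : (1 / 2 <= Cmod z)%R).
  { pose proof (Cmod_triangle z (- (z - branch b))) as H1; rewrite Cmod_opp in H1.
    replace (z + - (z - branch b)) with (branch b) in H1 by ring; rewrite Cmod_branch in H1; lra. }
  assert (Hz0 : z <> 0) by (apply Cmod_gt_0; lra).
  replace (hat z - branch b) with (- branch b * (z - branch b) * / z).
  - rewrite !Cmod_mult, Cmod_opp, Cmod_branch, Cmod_inv by exact Hz0.
    rewrite Rmult_1_l; apply Rlt_div_l; [lra|nra].
  - unfold hat; transitivity (branch b * branch b * / z - branch b).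
    + field; exact Hz0.
    + rewrite branch_sq; ring.
Qed.

(** Both ends of the segment lie in the open disc around the branch point whose radius is the
    distance to [w]. By convexity the segment misses [w]. *)
Lemma near_seg_int (b : bool) (w : C) : regular w ->
  near (branch b) (fun z => seg_int (Bker w) (hat z) z = / (w - z) - / (w - hat z)).
Proof.
  intros Hw; set (d := Cmod (w - branch b)).
  assert (Hd : (0 < d)%R) by (apply Cmod_gt_0, Hw).
  apply near_imp with (1 := near_hat_close b d Hd); intros z [H1 H2].
  apply seg_int_Bker; intros t Ht E.
  assert (H3 : (Cmod (w - branch b) < d)%R); [|unfold d in H3; lra].
  replace (w - branch b) with (RtoC (1 - t) * (hat z - branch b) + RtoC t * (z - branch b)
      + (w - (hat z + RtoC t * (z - hat z)))) by (rewrite RtoC_minus; ring).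
  rewrite E, Cplus_0_r; apply Rle_lt_trans with (1 := Cmod_triangle _ _).
  rewrite !Cmod_mult, !Cmod_R, !Rabs_pos_eq by lra.
  destruct (Req_dec t 0) as [->|Ht0]; nra.
Qed.

Lemma laurent_inv_affine (al : C) (f g i : list C -> C) :
  rational f -> rational g -> rational i -> (forall t, good t -> i t * f t = 1) ->
  laurent al (fun t z => / (f t + g t * (z - al))).
Proof.
  intros Hf Hg Hi H; apply laurent_holomorphic.
  apply (holomorphic_inv al (fun k t => monomial (f t) 0 k + monomial (g t) 1 k) i).
  - intros k; apply rational_add; unfold monomial.
    + destruct (k =? 0)%nat; [exact Hf|apply rational_const].
    + destruct (k =? 1)%nat; [exact Hg|apply rational_const].
  - exact Hi.
  - intros t Ht; unfold monomial; simpl; rewrite <- (H t Ht); ring.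
  - intros t Ht.
    apply expands_ext with (2 := expands_plus _ _ _ _ _ (expands_monomial (f t) al 0) (expands_monomial (g t) al 1)).
    apply near_true; intros z; simpl; ring.
Qed.

Lemma rational_opp (f : list C -> C) : rational f -> rational (fun t : list C => - f t).
Proof.
  intros H; replace (fun t : list C => - f t) with (fun t : list C => -1 * f t) by (apply functional_extensionality; intros t; ring).
  apply rational_mul; [apply rational_const|exact H].
Qed.

Definition z_or_hat (h : bool) (z : C) : C := if h then hat z else z.

Lemma laurent_inv_coord (b h : bool) (i : nat) : laurent (branch b) (fun (t : list C) z => / (z_or_hat h z - nth i t 0)).
Proof.
  assert (Hreg : forall t, good t -> nth i t 0 - branch b <> 0) by (intros t Ht; apply Ht).
  destruct h; simpl.
  - apply laurent_ext with (fun (t : list C) z => z * / (branch b * (branch b + - nth i t 0) + - nth i t 0 * (z - branch b))).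
    + intros t Ht; apply near_imp with (1 := near_and _ _ _ (near_branch_neq_0 b)
        (near_hat_close b _ (proj1 (Cmod_gt_0 _) (Hreg t Ht)))); intros z [Hz [_ H2]].
      replace (branch b * (branch b + - nth i t 0) + - nth i t 0 * (z - branch b))
        with (branch b * branch b - nth i t 0 * z) by ring.
      rewrite branch_sq; unfold hat in *.
      assert (H3 : / z - nth i t 0 <> 0).
      { intros E; replace (/ z - branch b) with ((/ z - nth i t 0) + (nth i t 0 - branch b)) in H2 by ring.
        rewrite E, Cplus_0_l in H2; lra. }
      assert (H4 : 1 - nth i t 0 * z <> 0).
      { intros E; apply H3; replace (/ z - nth i t 0) with ((1 - nth i t 0 * z) / z) by (field; exact Hz).
        rewrite E; unfold Cdiv; ring. }
      field; repeat split; assumption.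
    + apply laurent_mult; [apply laurent_id|].
      apply (laurent_inv_affine (branch b) (fun t : list C => branch b * (branch b + - nth i t 0)) (fun t : list C => - nth i t 0)
        (fun t : list C => - branch b * / (nth i t 0 - branch b))).
      * apply rational_mul; [apply rational_const|apply rational_add; [apply rational_const|apply rational_opp, rational_coord]].
      * apply rational_opp, rational_coord.
      * apply rational_mul; [apply (rational_const (- branch b))|apply rational_pole].
      * intros t Ht; transitivity (branch b * branch b); [field; apply Hreg, Ht|apply branch_sq].
  - apply (laurent_inv_shift (branch b) (fun t : list C => nth i t 0) (fun t : list C => - / (nth i t 0 - branch b))).
    + apply rational_coord.
    + apply rational_opp, rational_pole.
    + intros t Ht; field; apply Hreg, Ht.
Qed.

Lemma laurent_inv_dx (b : bool) : laurent (branch b) (fun _ z => / dx z).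
Proof.
  apply laurent_ext with (fun _ z => z * z * (/ (z - branch true) * / (z - branch false))).
  - intros t _; apply near_imp with (1 := near_and _ _ _ (near_branch_neq_0 b) (near_regular b)).
    intros z [Hz Hr]; rewrite dx_eq by exact Hz.
    pose proof (Hr true) as H1; pose proof (Hr false) as H2; simpl in H1, H2; change (branch true) with (RtoC 1); change (branch false) with (RtoC (-1)).
    replace (1 - / z ^ 2) with ((z - 1) * (z - -1) * / z ^ 2) by (field; exact Hz).
    revert H1 H2; generalize (z - 1) (z - -1); intros A B H1 H2.
    field; repeat split; assumption.
  - apply laurent_mult; [apply laurent_mult; apply laurent_id|apply laurent_mult; apply laurent_inv_pole].
Qed.

Lemma laurent_dhat (b : bool) : laurent (branch b) (fun _ z => dhat z).
Proof.
  apply laurent_ext with (fun _ z => -1 * (/ z * / z)).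
  - intros t _; apply near_imp with (1 := near_branch_neq_0 b); intros z Hz.
    rewrite dhat_eq by exact Hz; field; exact Hz.
  - apply laurent_mult; [apply (laurent_const _ _ (rational_const (-1)))|apply laurent_mult; apply laurent_inv_z].
Qed.

Lemma Cinv_0 : / 0 = 0.
Proof. unfold Cinv; simpl; apply injective_projections; simpl; unfold Rdiv; ring. Qed.

Lemma Cinv_mult_total (a b : C) : / (a * b) = / a * / b.
Proof.
  destruct (Ceq_dec a 0) as [->|Ha]; [rewrite Cmult_0_l, Cinv_0; ring|].
  destruct (Ceq_dec b 0) as [->|Hb]; [rewrite Cmult_0_r, Cinv_0; ring|].
  field; split; assumption.
Qed.

Lemma analytic_at_series (f : C -> C) (z0 : C) : analytic_at f z0 ->
  exists (a : nat -> C) (r : R), (0 < r)%R /\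
    forall z, (Cmod (z - z0) < r)%R -> Cser (fun n => a n * (z - z0) ^ n) (f z).
Proof.
  intros [a [r [Hr H]]]; exists a, r; split; [exact Hr|]; intros z Hz; exact (proj1 (is_pseries_Cser _ _ _) (H z Hz)).
Qed.

(** With [u = z - al] and [al ^ 2 = 1], [1/z] is the geometric series [al / (1 + al u)]; its
    constant term [al] is removed. *)
Definition hat_coef (al : C) (n : nat) : C := match n with O => 0 | S _ => al * (- al) ^ n end.

Lemma expands_hat (b : bool) : expands (hat_coef (branch b)) (branch b) (fun z => hat z - branch b).
Proof.
  assert (Hnear : near (branch b) (fun z => (Cmod (z - branch b) < 1)%R)).
  { exists 1%R; split; [lra|]; intros z Hz; lra. }
  apply near_imp with (1 := near_and _ _ _ Hnear (near_branch_neq_0 b)); intros z [H1 H2].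
  set (al := branch b) in *; set (u := z - al) in *.
  assert (Hg : Cser (fun n => 1 * (- al * u) ^ n) (/ (1 - - al * u))).
  { apply Cser_geom; rewrite Cmod_mult, Cmod_opp; unfold al; rewrite Cmod_branch; lra. }
  apply (Cser_scal al) in Hg.
  replace (al * / (1 - - al * u)) with (/ z) in Hg.
  2:{ replace (1 - - al * u) with (al * z).
      - pose proof (branch_neq_0 b) as H0; fold al in H0; field; split; assumption.
      - unfold u, al; rewrite <- (branch_sq b) at 1; ring. }
  apply (proj1 (Cser_tail _ _)) in Hg; cbv beta in Hg; apply (proj2 (Cser_tail _ _)); unfold hat.
  replace (/ z - al - hat_coef al 0 * u ^ 0) with (/ z - al * (1 * (- al * u) ^ 0)) by (simpl; ring).
  revert Hg; apply is_series_ext; intros n; simpl hat_coef.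
  change (al * (1 * (- al * u) ^ S n) = al * (- al) ^ S n * u ^ S n).
  rewrite Cpow_mult_l; ring.
Qed.

(** The difference [y(z) - y(1/z)] has a simple zero at the branch point, because [y'] does not
    vanish there. *)
Lemma laurent_inv_y_diff (y : C -> C) (b : bool) :
  analytic_at y (branch b) -> C_derive y (branch b) <> 0 ->
  laurent (branch b) (fun _ z => / (y z - y (hat z))).
Proof.
  intros Hy Hdy; set (al := branch b) in *.
  destruct (analytic_at_series y al Hy) as [a [r [Hr Ha]]].
  assert (Ha1 : a 1%nat <> 0).
  { intros E; apply Hdy; change (derive_n 1 y al = 0).
    rewrite (derive_n_coef a al r y 1 Hr Ha), E; ring. }
  assert (H1 : expands a al y) by (exists r; split; [exact Hr|]; intros z Hz; apply Ha; lra).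
  assert (H2 : expands (comp_coef a (hat_coef al)) al (fun z => y (hat z))).
  { apply expands_ext with (fun z => y (al + (hat z - al))).
    - apply near_true; intros z; f_equal; ring.
    - apply (expands_comp a (hat_coef al) al r (fun w => y (al + w)) (fun z => hat z - al) Hr).
      + intros w Hw.
        assert (E : al + w - al = w) by ring.
        assert (H := Ha (al + w)); rewrite E in H; apply H, Hw.
      + reflexivity.
      + apply expands_hat. }
  set (d := fun n => a n + -1 * comp_coef a (hat_coef al) n).
  assert (HD : expands d al (fun z => y z + -1 * y (hat z))) by (apply expands_plus; [|apply expands_scal]; assumption).
  assert (Hd0 : d 0%nat = 0).
  { unfold d, comp_coef; rewrite Csum_O; simpl; ring. }
  (* [1/z] has the linear coefficient [- al ^ 2 = -1], so the linear terms of [y(z)] and [- y(1/z)]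
     add up. *)
  assert (Hd1 : d 1%nat = 2 * a 1%nat).
  { unfold d, comp_coef; rewrite Csum_S, Csum_O; simpl conv_pow; unfold conv.
    rewrite Csum_S, Csum_O; simpl.
    replace (al * (- al * 1)) with (- (al * al)) by ring.
    unfold al; rewrite branch_sq; ring. }
  apply expands_div in HD.
  assert (HI := expands_inv (fun n => d (S n)) (/ (2 * a 1%nat)) al _
    ltac:(cbv beta; rewrite Hd1; field; exact Ha1) HD).
  apply laurent_ext with (fun _ z => / (z - al) * / ((y z + -1 * y (hat z) - d 0%nat) / (z - al))).
  - intros t _; apply near_imp with (1 := near_self al); intros z Hz.
    rewrite Hd0; unfold Cdiv; rewrite Cinv_mult_total.
    replace (y z + -1 * y (hat z) - 0) with (y z - y (hat z)) by ring.
    generalize (/ (y z - y (hat z))); intros c; field; exact Hz.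
  - apply laurent_mult; [apply laurent_inv_self|apply (laurent_fixed al _ _ HI)].
Qed.

(** * Rationality of the stable invariants *)

Section Recursion.

Variable y : C -> C.
Hypothesis Hy : forall b, analytic_at y (branch b).
Hypothesis Hdy : forall b, C_derive y (branch b) <> 0.

Lemma laurent_Kker (b : bool) : laurent (branch b) (fun t z => Kker y (nth 0 t 0) z).
Proof.
  apply laurent_ext with (fun (t : list C) z =>
    ((/ (z_or_hat false z - nth 0 t 0) + -1 * / (z_or_hat true z - nth 0 t 0)) * / 2) *
    (/ (y z - y (hat z)) * / dx z)).
  - intros t Ht.
    assert (Hreg : nth 0 t 0 - branch b <> 0) by apply Ht.
    apply near_imp with (1 := near_and _ _ _ (near_seg_int b (nth 0 t 0) (Ht 0%nat))
      (near_hat_close b _ (proj1 (Cmod_gt_0 _) Hreg))); intros z [E [H1 H2]].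
    unfold Kker, Cdiv; rewrite E, !Cinv_mult_total; simpl z_or_hat.
    generalize (/ (y z - y (hat z))) (/ dx z); intros c c'.
    assert (H : forall v, (Cmod (v - branch b) < Cmod (nth 0 t 0 - branch b))%R -> / (nth 0 t 0 - v) = - / (v - nth 0 t 0)).
    { intros v Hv; assert (Hne : v - nth 0 t 0 <> 0).
      { intros E'; replace (v - branch b) with ((v - nth 0 t 0) + (nth 0 t 0 - branch b)) in Hv by ring.
        rewrite E', Cplus_0_l in Hv; lra. }
      replace (nth 0 t 0 - v) with (-1 * (v - nth 0 t 0)) by ring.
      rewrite Cinv_mult_total; field; exact Hne. }
    rewrite (H z H1), (H (hat z) H2); ring.
  - apply laurent_mult; [apply laurent_mult|apply laurent_mult; [apply laurent_inv_y_diff; [apply Hy|apply Hdy]|apply laurent_inv_dx]].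
    + apply laurent_plus; [apply laurent_inv_coord|apply laurent_mult; [apply (laurent_const _ _ (rational_const (-1)))|apply laurent_inv_coord]].
    + apply (laurent_const _ _ (rational_const (/ 2))).
Qed.

(** Splitting commutes with [map], so the pairs are enumerated once on coordinate indices, whatever
    the values of the coordinates. *)
Lemma splits_map {T : Type} (l : list T) :
  exists s : list (list T * list T),
    (forall I J, In (I, J) s -> (length I + length J = length l)%nat) /\
    forall f : T -> C, splits (map f l) = map (fun IJ => (map f (fst IJ), map f (snd IJ))) s.
Proof.
  induction l as [|x l [s [Hs E]]]; simpl.
  - exists [([], [])]; split; [|reflexivity].
    intros I J [H|[]]; injection H; intros; subst; reflexivity.
  - exists (flat_map (fun IJ => [(x :: fst IJ, snd IJ); (fst IJ, x :: snd IJ)]) s); split.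
    + intros I J H; apply in_flat_map in H; destruct H as [[I' J'] [H1 H2]].
      specialize (Hs _ _ H1); destruct H2 as [H2|[H2|[]]]; injection H2; intros; subst; simpl; lia.
    + intros f; rewrite E; clear; induction s as [|[I J] s IH]; [reflexivity|]; simpl; rewrite IH; reflexivity.
Qed.

Lemma csum_app (l l' : list C) : csum (l ++ l') = csum l + csum l'.
Proof. induction l as [|c l IH]; simpl; [ring|]; rewrite IH; ring. Qed.

Lemma csum_flat_map {T : Type} (f : T -> list C) (l : list T) :
  csum (flat_map f l) = csum (map (fun x => csum (f x)) l).
Proof. induction l as [|x l IH]; [reflexivity|]; simpl; rewrite csum_app, IH; reflexivity. Qed.

Lemma laurent_csum {T : Type} (al : C) (F : T -> list C -> C -> C) (l : list T) :
  (forall x, In x l -> laurent al (F x)) -> laurent al (fun t z => csum (map (fun x => F x t z) l)).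
Proof.
  induction l as [|x l IH]; intros H; [apply (laurent_const al _ (rational_const 0))|].
  apply (laurent_plus al (F x) (fun t z => csum (map (fun x => F x t z) l))); [apply H; left; reflexivity|].
  apply IH; intros; apply H; right; assumption.
Qed.

Definition omega_is_rational (g n : nat) : Prop :=
  exists rho, rational rho /\ forall zs, length zs = n -> good zs -> omega y g zs = rho zs.

Definition coords (t : list C) (I : list nat) : list C := map (fun i => nth i t 0) I.

Lemma moving_z_or_hat (b h : bool) : moving (branch b) (fun _ z => z_or_hat h z).
Proof. destruct h; [apply moving_hat|apply moving_z]. Qed.

Lemma laurent_omega_rational (g : nat) (b : bool) (ss : list (list C -> C -> C)) :
  omega_is_rational g (length ss) -> List.Forall (moving (branch b)) ss ->
  laurent (branch b) (fun t z => omega y g (map (fun s => s t z) ss)).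
Proof.
  intros [rho [Hr H]] Hss.
  apply laurent_ext with (2 := laurent_rational (branch b) rho ss Hr Hss); intros t Ht.
  apply near_imp with (1 := near_good _ _ _ Hss Ht); intros z Hz; symmetry; apply H; [apply length_map|exact Hz].
Qed.

Lemma map_coords (t : list C) (z : C) (I : list nat) :
  map (fun s : list C -> C -> C => s t z) (map (fun i (t : list C) (_ : C) => nth i t 0) I) = coords t I.
Proof. unfold coords; rewrite map_map; reflexivity. Qed.

Lemma Forall_moving_coords (al : C) (I : list nat) :
  List.Forall (moving al) (map (fun i (t : list C) (_ : C) => nth i t 0) I).
Proof. induction I as [|i I IH]; constructor; [apply moving_coord|exact IH]. Qed.

(** For at least one point this is [2 g - 2 + n > 0]. *)
Definition stable (g n : nat) : Prop := (1 <= n)%nat /\ (1 <= g \/ 3 <= n)%nat.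

(** With [omega^0_1] excluded, the only unstable factor left is [B], whose pole at a fixed regular
    coordinate stays away from the branch point. *)
Lemma laurent_omega_one (g : nat) (b h : bool) (I : list nat) :
  (stable g (S (length I)) -> omega_is_rational g (S (length I))) ->
  unstable01 g (coords [] I) = false ->
  laurent (branch b) (fun t z => omega y g (z_or_hat h z :: coords t I)).
Proof.
  intros HIH Hun.
  assert (Hcase : stable g (S (length I)) \/ (g = 0%nat /\ length I = 1%nat)).
  { unfold stable; destruct g; [|left; lia]; destruct I as [|i [|j I]]; simpl in *; [discriminate|right; lia|left; lia]. }
  destruct Hcase as [Hs|[-> HI]].
  - assert (H := laurent_omega_rational g b ((fun _ z => z_or_hat h z) :: map (fun i (t : list C) (_ : C) => nth i t 0) I)).
    simpl length in H; rewrite length_map in H.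
    specialize (H (HIH Hs) (Forall_cons _ (moving_z_or_hat b h) (Forall_moving_coords _ I))).
    apply laurent_ext with (2 := H); intros t _; apply near_true; intros z.
    simpl map; rewrite map_coords; reflexivity.
  - destruct I as [|i [|]]; try discriminate.
    apply laurent_ext with (fun (t : list C) z => / (z_or_hat h z - nth i t 0) * / (z_or_hat h z - nth i t 0)).
    + intros t _; apply near_true; intros z; rewrite omega_rec; simpl; unfold Bker.
      simpl; rewrite !Cinv_mult_total, <- (Cmult_1_r (/ (z_or_hat h z - nth i t 0))) at 1.
      replace (/ 1) with (RtoC 1) by field; ring.
    + apply laurent_mult; apply laurent_inv_coord.
Qed.

Lemma laurent_bracket (g : nat) (b : bool) (J : list nat) :
  (forall g' n, (2 * g' + n < 2 * g + S (length J))%nat -> stable g' n -> omega_is_rational g' n) ->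
  laurent (branch b) (fun t z => bracket (omega y) g (coords t J) z).
Proof.
  intros HIH; unfold bracket; apply laurent_plus.
  - destruct g as [|g]; [apply (laurent_const _ _ (rational_const 0))|].
    apply laurent_mult; [|apply laurent_dhat].
    (* For genus one and no spectator the term is [B(z, 1/z)], unstable and singular at the branch
       points: [z^2 / ((z - 1)^2 (z + 1)^2)]. *)
    destruct (Nat.eq_dec (g + length J) 0) as [E|E].
    + assert (g = 0%nat) by lia; subst g; destruct J; [|simpl in E; lia].
      apply laurent_ext with (fun _ z => (z * (/ (z - branch true) * / (z - branch false))) *
                                   (z * (/ (z - branch true) * / (z - branch false)))).
      * intros t _; apply near_imp with (1 := near_and _ _ _ (near_branch_neq_0 b) (near_regular b)).
        intros z [Hz Hr]; rewrite omega_rec; simpl; unfold Bker, hat.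
        pose proof (Hr true) as H1; pose proof (Hr false) as H2; simpl in H1, H2.
        replace (z - / z) with ((z - 1) * (z - -1) * / z) by (field; exact Hz).
        revert H1 H2; generalize (z - 1) (z - -1); intros A B H1 H2.
        field; repeat split; assumption.
      * apply laurent_mult; (apply laurent_mult; [apply laurent_id|apply laurent_mult; apply laurent_inv_pole]).
    + assert (H := laurent_omega_rational g b ((fun _ z => z) :: (fun _ z => hat z) :: map (fun i (t : list C) (_ : C) => nth i t 0) J)).
      simpl length in H; rewrite length_map in H.
      specialize (H (HIH g (S (S (length J))) ltac:(lia) ltac:(unfold stable; lia))
        (Forall_cons _ (moving_z b) (Forall_cons _ (moving_hat b) (Forall_moving_coords _ J)))).
      apply laurent_ext with (2 := H); intros t _; apply near_true; intros z.
      simpl map; rewrite map_coords; reflexivity.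
  - destruct (splits_map J) as [s [Hlen Hs]].
    apply laurent_ext with (fun t z => csum (map (fun g1 => csum (map (fun IJ =>
      if (unstable01 g1 (coords t (fst IJ)) || unstable01 (g - g1) (coords t (snd IJ)))%bool then RtoC 0
      else omega y g1 (z :: coords t (fst IJ)) * (omega y (g - g1) (hat z :: coords t (snd IJ)) * dhat z)) s))
      (seq 0 (S g)))).
    { intros t _; apply near_true; intros z; rewrite csum_flat_map; apply f_equal, map_ext; intros g1.
      change (coords t J) with (map (fun i => nth i t (RtoC 0)) J).
      rewrite Hs, map_map; reflexivity. }
    apply (laurent_csum _ (fun g1 t z => csum (map (fun IJ =>
      if (unstable01 g1 (coords t (fst IJ)) || unstable01 (g - g1) (coords t (snd IJ)))%bool then RtoC 0
      else omega y g1 (z :: coords t (fst IJ)) * (omega y (g - g1) (hat z :: coords t (snd IJ)) * dhat z)) s))).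
    intros g1 Hg1; apply in_seq in Hg1.
    apply (laurent_csum _ (fun IJ t z =>
      if (unstable01 g1 (coords t (fst IJ)) || unstable01 (g - g1) (coords t (snd IJ)))%bool then RtoC 0
      else omega y g1 (z :: coords t (fst IJ)) * (omega y (g - g1) (hat z :: coords t (snd IJ)) * dhat z))).
    intros [I I'] HI; specialize (Hlen _ _ HI); simpl fst; simpl snd.
    (* Whether a term is omitted depends on the genus and the number of points, not on the
       coordinates. *)
    assert (Eun : forall g' K t, unstable01 g' (coords t K) = unstable01 g' (coords [] K)).
    { intros g' [|k K] t; reflexivity. }
    apply laurent_ext with (fun t z => if (unstable01 g1 (coords [] I) || unstable01 (g - g1) (coords [] I'))%bool then RtoC 0
      else omega y g1 (z :: coords t I) * (omega y (g - g1) (hat z :: coords t I') * dhat z)).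
    { intros t _; apply near_true; intros z; rewrite !(Eun _ _ t); reflexivity. }
    destruct (unstable01 g1 (coords [] I)) eqn:E1; [apply (laurent_const _ _ (rational_const 0))|].
    destruct (unstable01 (g - g1) (coords [] I')) eqn:E2; [apply (laurent_const _ _ (rational_const 0))|].
    simpl orb; cbv iota.
    apply laurent_mult; [|apply laurent_mult; [|apply laurent_dhat]].
    (* That the complementary factor is not [omega^0_1] makes [2 g + n] drop strictly. *)
    + apply (laurent_omega_one g1 b false I); [|exact E1]; intros Hst; apply HIH; [|exact Hst].
      destruct (g - g1)%nat eqn:Eg; destruct I'; simpl in *; try discriminate; lia.
    + apply (laurent_omega_one (g - g1) b true I'); [|exact E2]; intros Hst; apply HIH; [|exact Hst].
      destruct g1; destruct I; simpl in *; try discriminate; lia.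
Qed.

Lemma omega_eq_sum_Res (g : nat) (z0 : C) (zS : list C) : stable g (S (length zS)) ->
  omega y g (z0 :: zS) = sum_Res (fun z => Kker y z0 z * bracket (omega y) g zS z).
Proof.
  intros [_ Hs]; rewrite omega_rec; destruct g as [|g]; [|reflexivity].
  destruct zS as [|z1 [|z2 zS]]; simpl in Hs; try lia; reflexivity.
Qed.

Lemma coords_seq (z0 : C) (zS : list C) : coords (z0 :: zS) (seq 1 (length zS)) = zS.
Proof.
  unfold coords; rewrite <- seq_shift, map_map; simpl.
  apply nth_ext with (RtoC 0) (RtoC 0); [rewrite length_map, length_seq; reflexivity|].
  rewrite length_map, length_seq; intros n Hn.
  rewrite (nth_indep _ (RtoC 0) (nth 0 zS (RtoC 0))) by (rewrite length_map, length_seq; exact Hn).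
  rewrite (map_nth (fun i => nth i zS (RtoC 0))), seq_nth by exact Hn; reflexivity.
Qed.

(** Strong induction on [2 g + n]. The external argument of the kernel is coordinate [0] of the
    list, the spectators are coordinates [1] to [n]. *)
Lemma omega_rational (g n : nat) : stable g n -> omega_is_rational g n.
Proof.
  remember (2 * g + n)%nat as m eqn:Em; revert g n Em.
  induction m as [m IH] using (well_founded_induction lt_wf); intros g n Em Hst.
  destruct n as [|n]; [unfold stable in Hst; lia|].
  assert (Hbr : forall b, laurent (branch b) (fun t z => Kker y (nth 0 t 0) z * bracket (omega y) g (coords t (seq 1 n)) z)).
  { intros b; apply laurent_mult; [apply laurent_Kker|apply laurent_bracket].
    rewrite length_seq; intros g' n' Hlt Hst'; apply (IH (2 * g' + n')%nat); auto; lia. }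
  destruct (laurent_residue _ _ (Hbr true)) as [r1 [Hr1 H1]].
  destruct (laurent_residue _ _ (Hbr false)) as [r2 [Hr2 H2]].
  exists (fun t => r1 t + r2 t); split; [apply rational_add; assumption|].
  intros [|z0 zS] Hlen Hg; simpl in Hlen; [discriminate|]; injection Hlen as Hlen.
  rewrite omega_eq_sum_Res by (rewrite Hlen; exact Hst).
  specialize (H1 _ Hg); specialize (H2 _ Hg); rewrite <- Hlen, coords_seq in H1, H2.
  unfold sum_Res; f_equal; apply Res_eq; [exact H1|exact H2].
Qed.

Lemma laurent_bracket_1 (g : nat) (b : bool) : laurent (branch b) (fun _ z => bracket (omega y) g [] z).
Proof. apply (laurent_bracket g b []); intros; apply omega_rational; assumption. Qed.

End Recursion.

(** * The invariants with one point *)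

Definition basis (b : bool) (k : nat) (z : C) : C := z ^ k / (z - branch b) ^ (2 * k + 2).

(* [x - x(branch b)], in the coordinate [z] *)
Definition dist_x (b : bool) (z : C) : C := (z - branch b) ^ 2 * / z.

Lemma Cmult_integral (a b : C) : a * b = 0 -> a = 0 \/ b = 0.
Proof.
  intros H; destruct (Ceq_dec a 0) as [E|E]; [left; exact E|right].
  replace b with (/ a * (a * b)) by (field; exact E); rewrite H; ring.
Qed.

Lemma geometric_remainder (u v : C) (M : nat) : u <> 0 -> u - v <> 0 ->
  / (u - v) = Csum (fun k => v ^ k / u ^ S k) M + (v / u) ^ S M * / (u - v).
Proof.
  intros Hu Huv; induction M as [|M IH].
  - rewrite Csum_O; simpl; field; split; assumption.
  - rewrite Csum_S, IH at 1; rewrite <- Cplus_assoc; f_equal.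
    unfold Cdiv; rewrite !Cpow_mult_l, !Cpow_inv by exact Hu. rewrite !(Cpow_S _ (S M)).
    field; repeat split; try apply Cpow_nz; assumption.
Qed.

Lemma Kker_dist_x (y : C -> C) (b : bool) (w : C) : regular w ->
  near (branch b) (fun z => (w - branch b) ^ 2 - w * dist_x b z <> 0 /\
    Kker y w z = (- z * / 2 * / (y z - y (hat z))) * / ((w - branch b) ^ 2 - w * dist_x b z)).
Proof.
  intros Hw; set (d := Cmod (w - branch b)).
  assert (Hd : (0 < d)%R) by (apply Cmod_gt_0, Hw).
  apply near_imp with (1 := near_and _ _ _ (near_and _ _ _ (near_branch_neq_0 b) (near_regular b))
    (near_and _ _ _ (near_seg_int b w Hw) (near_hat_close b d Hd))).
  intros z [[Hz Hr] [Es [H1 H2]]].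
  assert (Hne : forall v, (Cmod (v - branch b) < d)%R -> w - v <> 0).
  { intros v Hv E; replace (v - branch b) with ((w - branch b) - (w - v)) in Hv by ring.
    rewrite E in Hv; replace (w - branch b - 0) with (w - branch b) in Hv by ring; unfold d in Hv; lra. }
  assert (N1 := Hne z H1); assert (N2 := Hne (hat z) H2); unfold hat in N2.
  (* [(w - z) (w - 1/z) = w^2 + 1 - w x(z)] is invariant under [z -> 1/z], hence a function of
     [x(z)]. *)
  assert (E : (w - branch b) ^ 2 - w * dist_x b z = (w - z) * (w - / z)).
  { unfold dist_x; transitivity (w ^ 2 + branch b * branch b - w * (z + branch b * branch b * / z)).
    - field; exact Hz.
    - rewrite branch_sq; field; exact Hz. }
  rewrite E; split.
  - intros E0; apply Cmult_integral in E0; tauto.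
  - unfold Kker, Cdiv; rewrite Es, dx_eq by exact Hz; unfold hat in *.
    pose proof (Hr true) as R1; pose proof (Hr false) as R2; simpl in R1, R2.
    rewrite !Cinv_mult_total; generalize (/ (y z - y (/ z))); intros c.
    assert (E1 : / (w - z) - / (w - / z) = (z - / z) * (/ (w - z) * / (w - / z))).
    { transitivity (((w - / z) - (w - z)) * (/ (w - z) * / (w - / z))).
      - generalize dependent (w - z); generalize dependent (w - / z); intros; field; split; assumption.
      - ring. }
    rewrite E1.
    assert (E2 : 1 - / z ^ 2 = (z - / z) * / z) by (field; exact Hz).
    assert (N3 : z - / z <> 0).
    { intros E3; assert (E4 : (z - 1) * (z - -1) = (z - / z) * z) by (field; exact Hz).
      rewrite E3, Cmult_0_l in E4; apply Cmult_integral in E4; tauto. }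
    rewrite E2, Cinv_mult_total.
    generalize (/ (w - z) * / (w - / z)); revert N3; generalize (z - / z); intros q Hq e.
    field; split; assumption.
Qed.

Lemma expands_inv_z (b : bool) : expands (fun n => monomial (branch b) 0 n + hat_coef (branch b) n) (branch b) (fun z => / z).
Proof.
  apply expands_ext with (2 := expands_plus _ _ _ _ _ (expands_monomial (branch b) (branch b) 0) (expands_hat b)).
  apply near_true; intros z; simpl; unfold hat; ring.
Qed.

Lemma expands_pow (a : nat -> C) (z0 : C) (f : C -> C) (n : nat) :
  expands a z0 f -> expands (conv_pow a n) z0 (fun z => f z ^ n).
Proof.
  intros H; induction n as [|n IH].
  - apply near_true; intros z; apply Cser_first; [simpl; ring|intros; simpl; ring].
  - apply (expands_mult _ _ _ _ _ H IH).
Qed.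

Lemma is_residue_Csum (f : nat -> C -> C) (z0 : C) (c : nat -> C) (n : nat) :
  (forall k, (k <= n)%nat -> is_residue (f k) z0 (c k)) ->
  is_residue (fun z => Csum (fun k => f k z) n) z0 (Csum c n).
Proof.
  induction n as [|n IH]; intros H.
  - rewrite Csum_O; apply is_residue_ext with (2 := H 0%nat (Nat.le_refl _)).
    apply near_true; intros z; rewrite Csum_O; reflexivity.
  - rewrite Csum_S.
    apply is_residue_ext with (fun z => Csum (fun k => f k z) n + f (S n) z).
    + apply near_true; intros z; rewrite Csum_S; reflexivity.
    + apply is_residue_plus; [apply IH; intros; apply H; lia|apply H; lia].
Qed.

Lemma good_nil : good [].
Proof. intros [|i]; apply regular_0. Qed.

(** The kernel is expanded as a finite geometric sum in [w * dist_x b z / (w - branch b)^2] plus a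
    remainder. The bound [p] and the coefficients [c] precede [M] and [w], so that the two branch
    points can share one [M]. *)
Lemma residue_principal_part (y G : C -> C) (b : bool) :
  laurent (branch b) (fun _ z => / (y z - y (hat z))) -> laurent (branch b) (fun _ z => G z) ->
  exists (p : nat) (c : nat -> C), forall M, (p <= M)%nat -> forall w, regular w ->
    is_residue (fun z => Kker y w z * G z) (branch b) (Csum (fun k => c k * basis b k w) M).
Proof.
  intros HD HG.
  (* Everything in the integrand that does not depend on [w]. *)
  set (H := fun z => (- z * / 2 * / (y z - y (hat z))) * G z).
  assert (HH : laurent (branch b) (fun _ z => H z)).
  { unfold H; apply laurent_mult; [|exact HG]. apply laurent_mult; [|exact HD].
    apply laurent_ext with (fun _ z => z * (-1 * / 2)).
    - intros t _; apply near_true; intros z; ring.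
    - apply laurent_mult; [apply laurent_id|apply (laurent_const _ _ (rational_const (-1 * / 2)))]. }
  assert (Hwk : forall k, exists c, is_residue (fun z => dist_x b z ^ k * H z) (branch b) c).
  { intros k; assert (HL : laurent (branch b) (fun _ z => dist_x b z ^ k * H z)).
    { apply laurent_mult; [|exact HH]. eapply (laurent_fixed _ _ (fun z => dist_x b z ^ k)).
      apply expands_pow; unfold dist_x; apply expands_mult; [|apply expands_inv_z].
      apply expands_ext with (2 := expands_monomial 1 (branch b) 2); apply near_true; intros z; ring. }
    destruct (laurent_residue _ _ HL) as [rho [_ Hrho]]; exists (rho []); exact (Hrho [] good_nil). }
  destruct HH as [p [h [_ Hh]]]; specialize (Hh [] good_nil).
  (* The moments of [H] against powers of [dist_x], which depend neither on [M] nor on [w]. *)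
  set (c := fun k => epsilon (inhabits (RtoC 0)) (is_residue (fun z => dist_x b z ^ k * H z) (branch b))).
  exists p, c.
  intros M HM w Hw.
  assert (Hw0 : w - branch b <> 0) by apply Hw.
  set (A := (w - branch b) ^ 2) in *.
  assert (HA : A <> 0) by (apply Cpow_nz; exact Hw0).
  assert (Hmono : expands (monomial 1 2) (branch b) (fun z => (z - branch b) ^ 2)).
  { apply expands_ext with (2 := expands_monomial 1 (branch b) 2); apply near_true; intros z; ring. }
  set (e := fun n => monomial A 0 n + - w * conv (monomial 1 2) (fun n => monomial (branch b) 0 n + hat_coef (branch b) n) n).
  assert (He : expands e (branch b) (fun z => A - w * dist_x b z)).
  { apply expands_ext with (2 := expands_plus _ _ _ _ _ (expands_monomial A (branch b) 0)
      (expands_scal (- w) _ _ _ (expands_mult _ _ _ _ _ Hmono (expands_inv_z b)))).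
    apply near_true; intros z; unfold dist_x; simpl; ring. }
  assert (He0 : / A * e 0%nat = 1).
  { unfold e, conv; rewrite Csum_O; unfold monomial; simpl; field; exact HA. }
  assert (Hinv := expands_inv e (/ A) _ _ He0 He).
  (* [dist_x ^ (M + 1)] vanishes to order [2 M + 2], which exceeds the pole order [p] of [H]; the
     denominator has the nonzero constant term [A]. The remainder has therefore no residue. *)
  assert (Hrest : is_residue (fun z => (w / A) ^ S M * (dist_x b z ^ S M * H z * / (A - w * dist_x b z))) (branch b) ((w / A) ^ S M * 0)).
  { apply is_residue_scal; eapply is_residue_holomorphic.
    apply expands_ext with (fun z => (z - branch b) ^ (2 * S M - p) * ((((z - branch b) ^ p * H z) * (/ z) ^ S M) * / (A - w * dist_x b z))).
    - apply near_imp with (1 := near_branch_neq_0 b); intros z Hz; unfold dist_x.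
      rewrite Cpow_mult_l, <- Cpow_mult_r.
      replace (2 * S M)%nat with ((2 * S M - p) + p)%nat at 2 by lia.
      rewrite Cpow_add_r; ring.
    - apply expands_shift, expands_mult; [apply expands_mult; [exact Hh|]|exact Hinv].
      apply expands_pow, expands_inv_z. }
  assert (Hmain : is_residue (fun z => Csum (fun k => basis b k w * (dist_x b z ^ k * H z)) M) (branch b)
    (Csum (fun k => basis b k w * c k) M)).
  { apply (is_residue_Csum (fun k z => basis b k w * (dist_x b z ^ k * H z))); intros k _.
    apply is_residue_scal, epsilon_spec, Hwk. }
  assert (Htot := is_residue_plus _ _ _ _ _ Hmain Hrest).
  rewrite Cmult_0_r, Cplus_0_r in Htot.
  replace (Csum (fun k => c k * basis b k w) M) with (Csum (fun k => basis b k w * c k) M)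
    by (apply Csum_ext; intros; ring).
  apply is_residue_ext with (2 := Htot).
  apply near_imp with (1 := Kker_dist_x y b w Hw); intros z [Hne EK]; fold A in Hne, EK.
  rewrite EK; transitivity (H z * / (A - w * dist_x b z)); [|unfold H; ring].
  rewrite (geometric_remainder A (w * dist_x b z) M HA Hne) at 2.
  rewrite Cmult_plus_distr_l; f_equal.
  - rewrite <- Csum_scal; apply Csum_ext; intros k _; unfold basis.
    rewrite Cpow_mult_l; unfold A; rewrite <- Cpow_mult_r.
    replace (2 * S k)%nat with (2 * k + 2)%nat by lia; unfold Cdiv; ring.
  - unfold Cdiv; rewrite !Cpow_mult_l; ring.
Qed.

Lemma omega_one_expansion (y : C -> C) (g : nat) :
  (forall b, analytic_at y (branch b)) -> (forall b, C_derive y (branch b) <> 0) -> (1 <= g)%nat ->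
  exists (M : nat) (c : bool -> nat -> C), forall w, regular w ->
    omega y g [w] = Csum (fun k => c true k * basis true k w) M + Csum (fun k => c false k * basis false k w) M.
Proof.
  intros Hy Hdy Hg.
  assert (HP := fun b => residue_principal_part y (bracket (omega y) g []) b
    (laurent_inv_y_diff y b (Hy b) (Hdy b)) (laurent_bracket_1 y Hy Hdy g b)).
  destruct (HP true) as [p1 [c1 H1]]; destruct (HP false) as [p2 [c2 H2]].
  exists (Nat.max p1 p2), (fun b : bool => if b then c1 else c2); intros w Hw.
  rewrite omega_eq_sum_Res by (unfold stable; simpl; lia).
  unfold sum_Res; f_equal; apply Res_eq; [apply H1|apply H2]; try exact Hw; lia.
Qed.

(** * Expansion at the origin *)

Definition CN (n : nat) : C := RtoC (INR n).

Lemma CN_0 : CN 0 = 0.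
Proof. reflexivity. Qed.

Lemma CN_S (n : nat) : CN (S n) = CN n + 1.
Proof. unfold CN; rewrite S_INR, RtoC_plus; reflexivity. Qed.

Lemma CN_plus (n m : nat) : CN (n + m) = CN n + CN m.
Proof. unfold CN; rewrite plus_INR, RtoC_plus; reflexivity. Qed.

Lemma CN_neq_0 (n : nat) : n <> 0%nat -> CN n <> 0.
Proof. intros Hn E; apply RtoC_inj in E; apply (not_0_INR n Hn E). Qed.

Fixpoint falling (x : C) (m : nat) : C :=
  match m with O => 1 | S m' => falling x m' * (x - CN m') end.

Lemma falling_shift (x : C) (m : nat) : falling (x + 1) (S m) = (x + 1) * falling x m.
Proof.
  induction m as [|m IH]; [simpl falling; rewrite CN_0; ring|].
  change (falling (x + 1) (S (S m))) with (falling (x + 1) (S m) * (x + 1 - CN (S m))).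
  rewrite IH, CN_S; simpl; ring.
Qed.

Lemma falling_pascal (x : C) (m : nat) : falling (x + 1) (S m) = falling x (S m) + CN (S m) * falling x m.
Proof. rewrite falling_shift, CN_S; simpl; ring. Qed.

Lemma falling_nat_zero (j m : nat) : (j < m)%nat -> falling (CN j) m = 0.
Proof.
  induction m as [|m IH]; intros H; [lia|]; simpl.
  destruct (Nat.eq_dec j m) as [->|Hne]; [ring|]. rewrite IH by lia; ring.
Qed.

Definition Cfact (n : nat) : C := CN (fact n).

Lemma Cfact_S (n : nat) : Cfact (S n) = CN (S n) * Cfact n.
Proof. unfold Cfact, CN; rewrite fact_simpl, mult_INR, RtoC_mult; reflexivity. Qed.

Lemma Cfact_neq_0 (n : nat) : Cfact n <> 0.
Proof. apply CN_neq_0, fact_neq_0. Qed.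

(** The coefficient of [z^n] in [1 / (1 - al z)^(m+1)]: [al^n] times the binomial coefficient of
    [n + m] over [m]. *)
Definition inv_pow_coef (al : C) (m n : nat) : C := al ^ n * (falling (CN (n + m)) m / Cfact m).

Lemma inv_pow_coef_S (b : bool) (m n : nat) :
  conv (inv_pow_coef (branch b) m) (inv_pow_coef (branch b) 0) n = inv_pow_coef (branch b) (S m) n.
Proof.
  (* Hockey-stick identity for binomial coefficients, by Pascal's rule. *)
  assert (E : Csum (fun k => falling (CN (k + m)) m) n = falling (CN (n + S m)) (S m) / CN (S m)).
  { induction n as [|n IH].
    - rewrite Csum_O; replace (CN (0 + S m)) with (CN m + 1) by (rewrite <- CN_S; reflexivity).
      rewrite falling_shift, CN_S; simpl; field. rewrite <- CN_S; apply CN_neq_0; lia.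
    - rewrite Csum_S, IH.
      replace (CN (S n + S m)) with (CN (n + S m) + 1) by (rewrite <- CN_S; reflexivity).
      replace (S n + m)%nat with (n + S m)%nat by lia.
      rewrite falling_pascal; field; apply CN_neq_0; lia. }
  unfold conv, inv_pow_coef at 3; rewrite Cfact_S.
  transitivity (branch b ^ n / Cfact m * Csum (fun k => falling (CN (k + m)) m) n).
  - rewrite <- Csum_scal; apply Csum_ext; intros k Hk; unfold inv_pow_coef.
    replace (branch b ^ n) with (branch b ^ k * branch b ^ (n - k)) by (rewrite <- Cpow_add_r; f_equal; lia).
    replace (falling (CN (n - k + 0)) 0 / Cfact 0) with (RtoC 1) by (unfold Cfact, CN; simpl; field).
    field; apply Cfact_neq_0.
  - rewrite E; field; split; [apply Cfact_neq_0|apply CN_neq_0; lia].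
Qed.

Lemma absconv_inv_pow_coef (b : bool) (m : nat) (rho : R) : (0 <= rho < 1)%R ->
  absconv (inv_pow_coef (branch b) m) rho.
Proof.
  intros Hr; induction m as [|m IH].
  - apply (absconv_of_bounded _ 1 1 rho); [lra| |exact Hr].
    intros n; unfold inv_pow_coef.
    replace (falling (CN (n + 0)) 0 / Cfact 0) with (RtoC 1) by (unfold Cfact, CN; simpl; field).
    rewrite Cmult_1_r, Cmod_pow, Cmod_branch, !pow1; lra.
  - replace (inv_pow_coef (branch b) (S m)) with (conv (inv_pow_coef (branch b) m) (inv_pow_coef (branch b) 0))
      by (apply functional_extensionality; intros n; apply inv_pow_coef_S).
    apply absconv_conv; [lra|exact IH|].
    apply (absconv_of_bounded _ 1 1 rho); [lra| |exact Hr].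
    intros n; unfold inv_pow_coef.
    replace (falling (CN (n + 0)) 0 / Cfact 0) with (RtoC 1) by (unfold Cfact, CN; simpl; field).
    rewrite Cmult_1_r, Cmod_pow, Cmod_branch, !pow1; lra.
Qed.

Lemma Cser_inv_pow (b : bool) (m : nat) (z : C) : (Cmod z < 1)%R ->
  Cser (fun n => inv_pow_coef (branch b) m n * z ^ n) ((/ (1 - branch b * z)) ^ S m).
Proof.
  intros Hz; pose proof (Cmod_ge_0 z).
  assert (H0 : Cser (fun n => inv_pow_coef (branch b) 0 n * z ^ n) (/ (1 - branch b * z))).
  { assert (Hg := Cser_geom (branch b * z) ltac:(rewrite Cmod_mult, Cmod_branch; lra)).
    revert Hg; apply is_series_ext; intros n; unfold inv_pow_coef.
    replace (falling (CN (n + 0)) 0 / Cfact 0) with (RtoC 1) by (unfold Cfact, CN; simpl; field).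
    change (1 * (branch b * z) ^ n = branch b ^ n * 1 * z ^ n); rewrite Cpow_mult_l; ring. }
  induction m as [|m IH].
  - simpl; rewrite Cmult_1_r; exact H0.
  - replace (inv_pow_coef (branch b) (S m)) with (conv (inv_pow_coef (branch b) m) (inv_pow_coef (branch b) 0))
      by (apply functional_extensionality; intros n; apply inv_pow_coef_S).
    rewrite Cpow_S, Cmult_comm.
    apply conv_series with (Cmod z); try apply absconv_inv_pow_coef; try lra; assumption.
Qed.

(** [qpoly k] has the value [prod_{j=1}^k (m^2 - j^2)] at [m^2]. *)
Fixpoint qpoly (k : nat) : poly :=
  match k with O => [RtoC 1] | S k' => pmul [- (CN (S k') * CN (S k')); RtoC 1] (qpoly k') end.

Lemma peval_padd (p q : poly) (z : C) : peval (padd p q) z = peval p z + peval q z.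
Proof.
  revert q; induction p as [|c p IH]; intros [|d q]; simpl; try ring; rewrite IH; ring.
Qed.

Lemma peval_map_Cmult (c : C) (p : poly) (z : C) : peval (map (Cmult c) p) z = c * peval p z.
Proof. induction p as [|d p IH]; simpl; [ring|]; rewrite IH; ring. Qed.

Lemma peval_pmul (p q : poly) (z : C) : peval (pmul p q) z = peval p z * peval q z.
Proof.
  induction p as [|c p IH]; simpl; [ring|].
  rewrite peval_padd, peval_map_Cmult; simpl; rewrite IH; ring.
Qed.

(** In [(x + k) (x + k - 1) ... (x - k)] the factors [x + j] and [x - j] are paired. *)
Lemma falling_qpoly (x : C) (k : nat) : falling (x + CN k) (2 * k + 1) = x * peval (qpoly k) (x * x).
Proof.
  induction k as [|k IH]; [simpl; rewrite CN_0; ring|].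
  replace (2 * S k + 1)%nat with (S (S (2 * k + 1))) by lia.
  change (falling (x + CN (S k)) (S (S (2 * k + 1)))) with
    (falling (x + CN (S k)) (S (2 * k + 1)) * (x + CN (S k) - CN (S (2 * k + 1)))).
  replace (x + CN (S k)) with (x + CN k + 1) by (rewrite CN_S; ring).
  rewrite falling_shift, IH.
  change (qpoly (S k)) with (pmul [- (CN (S k) * CN (S k)); RtoC 1] (qpoly k)).
  rewrite peval_pmul; simpl peval.
  replace (S (2 * k + 1)) with (S k + S k)%nat by lia.
  rewrite CN_plus, CN_S; ring.
Qed.

(** Extends [branch b ^ m] to all integers [m]. *)
Definition parity (b : bool) (m : Z) : C := if Z.even m then 1 else branch b.

(* [m * basisN b k m] is the coefficient of [z ^ (m - 1)] in [basis b k]. *)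
Definition basisN (b : bool) (k : nat) (m : Z) : C :=
  parity b m * (branch b ^ S k * peval (qpoly k) (RtoC (IZR (m * m))) / Cfact (2 * k + 1)).

Lemma branch_pow_add_even (b : bool) (n k : nat) : branch b ^ (n + 2 * k) = branch b ^ n.
Proof.
  rewrite Cpow_add_r, Cpow_mult_r; simpl (branch b ^ 2); rewrite Cmult_1_r, branch_sq, Cpow_1_l; ring.
Qed.

Lemma parity_of_nat (b : bool) (n : nat) : parity b (Z.of_nat n) = branch b ^ n.
Proof.
  unfold parity; destruct (Nat.Even_or_Odd n) as [[k ->]|[k ->]].
  - replace (Z.even (Z.of_nat (2 * k))) with true.
    + rewrite <- (Nat.add_0_l (2 * k)), branch_pow_add_even; reflexivity.
    + rewrite Nat2Z.inj_mul, Z.even_mul; reflexivity.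
  - replace (Z.even (Z.of_nat (2 * k + 1))) with false.
    + rewrite Nat.add_comm, branch_pow_add_even; simpl; ring.
    + rewrite Nat2Z.inj_add, Nat2Z.inj_mul, Z.even_add, Z.even_mul; reflexivity.
Qed.

Lemma CN_IZR (n : nat) : CN n = RtoC (IZR (Z.of_nat n)).
Proof. unfold CN; rewrite INR_IZR_INZ; reflexivity. Qed.

Lemma basisN_nat (b : bool) (k n : nat) :
  CN n * basisN b k (Z.of_nat n) = branch b ^ (n + S k) * (falling (CN (n + k)) (2 * k + 1) / Cfact (2 * k + 1)).
Proof.
  unfold basisN; rewrite parity_of_nat, CN_plus, falling_qpoly, mult_IZR, RtoC_mult, <- CN_IZR, Cpow_add_r.
  field; apply Cfact_neq_0.
Qed.

(** [(z - branch b)^2 = (1 - branch b z)^2], so the even power in the denominator of [basis] gives a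
    binomial series, shifted by [z^k]. *)
Lemma basis_series (b : bool) (k : nat) (z : C) : (Cmod z < 1)%R ->
  Cser (fun n => (CN (S n) * basisN b k (Z.of_nat (S n))) * z ^ n) (basis b k z).
Proof.
  intros Hz; assert (H := Cser_inv_pow b (2 * k + 1) z Hz).
  apply (is_series_shift (V:=C_NormedModule) _ k) in H.
  apply (Cser_scal (z ^ k)) in H.
  assert (Hne : z - branch b <> 0).
  { intros E; assert (Ez : z = branch b) by (replace z with (z - branch b + branch b) by ring; rewrite E; ring).
    rewrite Ez, Cmod_branch in Hz; lra. }
  replace (basis b k z) with (z ^ k * (/ (1 - branch b * z)) ^ S (2 * k + 1)).
  - revert H; apply is_series_ext; intros n; rewrite basisN_nat.
    (* Below degree [k] the formula also holds: the falling factorial vanishes, as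
       [S n + k < 2 * k + 1]. *)
    destruct (Nat.ltb_spec n k) as [Hn|Hn].
    + rewrite (falling_nat_zero (S n + k)) by lia.
      change (z ^ k * 0 = branch b ^ (S n + S k) * (0 / Cfact (2 * k + 1)) * z ^ n).
      unfold Cdiv; ring.
    + unfold inv_pow_coef.
      change (z ^ k * (branch b ^ (n - k) * (falling (CN (n - k + (2 * k + 1))) (2 * k + 1) / Cfact (2 * k + 1)) * z ^ (n - k))
        = branch b ^ (S n + S k) * (falling (CN (S n + k)) (2 * k + 1) / Cfact (2 * k + 1)) * z ^ n).
      replace (n - k + (2 * k + 1))%nat with (S n + k)%nat by lia.
      replace (S n + S k)%nat with (n - k + 2 * (k + 1))%nat by lia.
      rewrite branch_pow_add_even.
      replace (z ^ n) with (z ^ k * z ^ (n - k)) by (rewrite <- Cpow_add_r; f_equal; lia).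
      ring.
  - unfold basis; replace (S (2 * k + 1)) with (2 * (k + 1))%nat by lia.
    replace (2 * k + 2)%nat with (2 * (k + 1))%nat by lia.
    assert (E : (1 - branch b * z) ^ 2 = (z - branch b) ^ 2).
    { transitivity (1 - 2 * branch b * z + (branch b * branch b) * z ^ 2); [ring|].
      rewrite branch_sq; transitivity (branch b * branch b - 2 * branch b * z + z ^ 2); [rewrite branch_sq|]; ring. }
    assert (Hne2 : 1 - branch b * z <> 0).
    { intros E0; rewrite E0 in E; symmetry in E; revert E; simpl; rewrite Cmult_0_l; apply (Cpow_nz _ 2 Hne). }
    rewrite Cpow_inv by exact Hne2.
    rewrite !(Cpow_mult_r _ 2), E; reflexivity.
Qed.

Definition expansion_N (c : bool -> nat -> C) (M : nat) (m : Z) : C :=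
  Csum (fun k => c true k * basisN true k m) M + Csum (fun k => c false k * basisN false k m) M.

Lemma even_quasi_poly_plus (f g : Z -> C) :
  is_even_quasi_poly f -> is_even_quasi_poly g -> is_even_quasi_poly (fun m => f m + g m).
Proof.
  intros [p0 [p1 Hf]] [q0 [q1 Hg]]; exists (padd p0 q0), (padd p1 q1); intros m.
  rewrite Hf, Hg; destruct (Z.even m); rewrite peval_padd; reflexivity.
Qed.

Lemma even_quasi_poly_basisN (b : bool) (c : C) (k : nat) : is_even_quasi_poly (fun m => c * basisN b k m).
Proof.
  set (d := branch b ^ S k * / Cfact (2 * k + 1)).
  exists (map (Cmult (c * d)) (qpoly k)), (map (Cmult (c * branch b * d)) (qpoly k)); intros m.
  unfold basisN, parity, d; destruct (Z.even m); rewrite peval_map_Cmult; unfold Cdiv; ring.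
Qed.

Lemma even_quasi_poly_Csum (f : nat -> Z -> C) (M : nat) :
  (forall k, is_even_quasi_poly (f k)) -> is_even_quasi_poly (fun m => Csum (fun k => f k m) M).
Proof.
  intros Hf; induction M as [|M IH].
  - destruct (Hf 0%nat) as [p0 [p1 H]]; exists p0, p1; intros m; rewrite Csum_O; apply H.
  - destruct (even_quasi_poly_plus _ _ IH (Hf (S M))) as [p0 [p1 H]]; exists p0, p1; intros m.
    rewrite Csum_S; apply H.
Qed.

Lemma Cser_Csum (a : nat -> nat -> C) (l : nat -> C) (M : nat) :
  (forall k, Cser (a k) (l k)) -> Cser (fun n => Csum (fun k => a k n) M) (Csum l M).
Proof.
  intros H; induction M as [|M IH].
  - rewrite Csum_O; apply is_series_ext with (2 := H 0%nat); intros n; rewrite Csum_O; reflexivity.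
  - rewrite Csum_S; apply is_series_ext with (2 := Cser_plus _ _ _ _ IH (H (S M))).
    intros n; rewrite Csum_S; reflexivity.
Qed.

Lemma is_N1_expansion (y : C -> C) (g M : nat) (c : bool -> nat -> C) :
  (forall w, regular w -> omega y g [w] =
     Csum (fun k => c true k * basis true k w) M + Csum (fun k => c false k * basis false k w) M) ->
  is_N1 y g (expansion_N c M).
Proof.
  intros H; split.
  - apply even_quasi_poly_plus; apply (even_quasi_poly_Csum (fun k m => _ * _)); intros k; apply even_quasi_poly_basisN.
  - exists 1%R; split; [lra|]; intros z Hz; apply is_pseries_Cser; fold CN.
    rewrite H.
    2:{ intros b E; assert (Ez : z = branch b) by (replace z with (z - branch b + branch b) by ring; rewrite E; ring).
        rewrite Ez, Cmod_branch in Hz; lra. }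
    assert (Hb : forall b, Cser (fun n => Csum (fun k => c b k * (CN (S n) * basisN b k (Z.of_nat (S n)) * z ^ n)) M)
        (Csum (fun k => c b k * basis b k z) M)).
    { intros b; apply (Cser_Csum (fun k n => c b k * (CN (S n) * basisN b k (Z.of_nat (S n)) * z ^ n))).
      intros k; apply Cser_scal, basis_series, Hz. }
    apply is_series_ext with (2 := Cser_plus _ _ _ _ (Hb true) (Hb false)); intros n; unfold expansion_N.
    change (Csum (fun k => c true k * (CN (S n) * basisN true k (Z.of_nat (S n)) * z ^ n)) M +
      Csum (fun k => c false k * (CN (S n) * basisN false k (Z.of_nat (S n)) * z ^ n)) M =
      CN (S n) * (Csum (fun k => c true k * basisN true k (Z.of_nat (S n))) M +
        Csum (fun k => c false k * basisN false k (Z.of_nat (S n))) M) * z ^ n).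
    transitivity (CN (S n) * z ^ n * (Csum (fun k => c true k * basisN true k (Z.of_nat (S n))) M +
        Csum (fun k => c false k * basisN false k (Z.of_nat (S n))) M)); [|ring].
    rewrite Cmult_plus_distr_l, <- !Csum_scal; f_equal; apply Csum_ext; intros; ring.
Qed.

(** * Uniqueness of the quasi-polynomial [N] *)

Lemma poly_factor (p : poly) (a : C) :
  exists q, length q = pred (length p) /\ forall z, peval p z = (z - a) * peval q z + peval p a.
Proof.
  induction p as [|c p [q [Hl Hq]]]; [exists []; split; [reflexivity|intros; simpl; ring]|].
  destruct p as [|d p].
  - exists []; split; [reflexivity|]; intros z; simpl; ring.
  - exists (peval (d :: p) a :: q); split; [simpl in *; lia|]; intros z.
    change (peval (c :: d :: p) z) with (c + z * peval (d :: p) z).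
    change (peval (c :: d :: p) a) with (c + a * peval (d :: p) a).
    rewrite Hq; simpl; ring.
Qed.

Lemma poly_infinite_roots (p : poly) (x : nat -> C) :
  (forall i j, x i = x j -> i = j) -> (forall j, peval p (x j) = 0) -> forall z, peval p z = 0.
Proof.
  remember (length p) as n eqn:Hn; revert p x Hn; induction n as [|n IH]; intros p x Hn Hx H z.
  - destruct p; [reflexivity|discriminate].
  - destruct (poly_factor p (x 0%nat)) as [q [Hl Hq]].
    rewrite Hq, H, (IH q (fun j => x (S j))); [ring|lia| |].
    + intros i j E; apply Hx in E; lia.
    + intros j; specialize (Hq (x (S j))); rewrite !H in Hq.
      rewrite Cplus_0_r in Hq; symmetry in Hq; apply Cmult_integral in Hq; destruct Hq as [E|E]; [|exact E].
      assert (E' : x (S j) = x 0%nat) by (replace (x (S j)) with (x (S j) - x 0%nat + x 0%nat) by ring; rewrite E; ring).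
      apply Hx in E'; lia.
Qed.

(** Positive arguments are read off the expansion and negative ones follow by evenness. At [0] the
    two polynomials for the even class are compared. *)
Lemma is_N1_unique (y : C -> C) (g : nat) (f f' : Z -> C) : is_N1 y g f -> is_N1 y g f' -> forall m, f m = f' m.
Proof.
  intros [[p0 [p1 Hp]] Hf] [[q0 [q1 Hq]] Hf'].
  assert (Hpos : forall n, f (Z.of_nat (S n)) = f' (Z.of_nat (S n))).
  { intros n.
    assert (He : forall h, (exists r : R, (0 < r)%R /\ forall z, (Cmod z < r)%R ->
        is_pseries (fun k : nat => RtoC (INR (S k)) * h (Z.of_nat (S k))) z (omega y g [z])) ->
        expands (fun k => CN (S k) * h (Z.of_nat (S k))) 0 (fun z => omega y g [z])).
    { intros h [r [Hr Hh]]; exists r; split; [exact Hr|]; intros z Hz.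
      assert (E0 : z - 0 = z) by ring; rewrite E0 in *; exact (proj1 (is_pseries_Cser _ _ _) (Hh z ltac:(lra))). }
    assert (E := expands_unique _ _ _ _ (He f Hf) (He f' Hf') n); cbv beta in E.
    replace (f (Z.of_nat (S n))) with (/ CN (S n) * (CN (S n) * f (Z.of_nat (S n)))) by (field; apply CN_neq_0; lia).
    rewrite E; field; apply CN_neq_0; lia. }
  (* They agree at the infinitely many squares of positive even integers. *)
  assert (Hp0 : forall z, peval p0 z = peval q0 z).
  { intros z; assert (E : peval (padd p0 (map (Cmult (-1)) q0)) z = 0).
    { apply poly_infinite_roots with (fun j => CN (2 * S j) * CN (2 * S j)).
      - intros i j E; unfold CN in E; rewrite <- !RtoC_mult, <- !mult_INR in E; apply RtoC_inj, INR_eq in E; nia.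
      - intros j; rewrite peval_padd, peval_map_Cmult.
        assert (Ev : Z.even (Z.of_nat (2 * S j)) = true) by (rewrite Nat2Z.inj_mul, Z.even_mul; reflexivity).
        assert (E1 := Hp (Z.of_nat (2 * S j))); assert (E2 := Hq (Z.of_nat (2 * S j))).
        rewrite Ev, mult_IZR, RtoC_mult, <- CN_IZR in E1, E2; rewrite <- E1, <- E2.
        replace (2 * S j)%nat with (S (2 * j + 1)) by lia; rewrite Hpos; ring. }
    rewrite peval_padd, peval_map_Cmult in E.
    replace (peval p0 z) with (peval p0 z + -1 * peval q0 z + peval q0 z) by ring; rewrite E; ring. }
  intros m.
  assert (Habs : forall h r0 r1, (forall m, h m = peval (if Z.even m then r0 else r1) (RtoC (IZR (m * m)))) ->
     h m = h (Z.abs m)).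
  { intros h r0 r1 Hh; rewrite (Hh m), (Hh (Z.abs m)).
    replace (Z.even (Z.abs m)) with (Z.even m) by (destruct m; reflexivity).
    replace (Z.abs m * Z.abs m)%Z with (m * m)%Z by (destruct m; reflexivity); reflexivity. }
  rewrite (Habs f _ _ Hp), (Habs f' _ _ Hq).
  destruct (Z.eq_dec m 0) as [->|Hm].
  - rewrite (Hp (Z.abs 0)), (Hq (Z.abs 0)); simpl Z.even; cbv iota; apply Hp0.
  - replace (Z.abs m) with (Z.of_nat (S (pred (Z.abs_nat m)))) by lia; apply Hpos.
Qed.

Lemma N1_eq (y : C -> C) (g : nat) (f : Z -> C) : is_N1 y g f -> N1 y g = f.
Proof.
  intros H; apply functional_extensionality; apply (is_N1_unique y g); [|exact H].
  unfold N1; apply epsilon_spec; exists f; exact H.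
Qed.

(** * Taylor coefficients of polynomials *)

(** Multiplication by [z = al + (z - al)], on Taylor coefficients at [al]. *)
Definition mulz (al : C) (a : nat -> C) (n : nat) : C :=
  al * a n + match n with O => 0 | S n' => a n' end.

Lemma Cser_mulz (al : C) (a : nat -> C) (u l : C) :
  Cser (fun n => a n * u ^ n) l -> Cser (fun n => mulz al a n * u ^ n) ((al + u) * l).
Proof.
  intros H; rewrite Cmult_plus_distr_r.
  assert (H1 : Cser (fun n => match n with O => RtoC 0 | S n' => a n' * u ^ S n' end) (u * l)).
  { apply (proj2 (Cser_tail _ _)); replace (u * l - 0) with (u * l) by ring.
    apply is_series_ext with (2 := Cser_scal u _ _ H); intros n.
    change (u * (a n * u ^ n) = a n * (u * u ^ n)); ring. }
  apply is_series_ext with (2 := Cser_plus _ _ _ _ (Cser_scal al _ _ H) H1); intros n; unfold mulz.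
  destruct n as [|n].
  - change (al * (a 0%nat * u ^ 0) + 0 = (al * a 0%nat + 0) * u ^ 0); ring.
  - change (al * (a (S n) * u ^ S n) + a n * u ^ S n = (al * a (S n) + a n) * u ^ S n); ring.
Qed.

Lemma expands_mulz (al : C) (a : nat -> C) (f : C -> C) :
  expands a al f -> expands (mulz al a) al (fun z => z * f z).
Proof.
  intros H; apply (near_imp _ _ _ H); intros z Hz.
  replace (z * f z) with ((al + (z - al)) * f z) by ring; apply Cser_mulz, Hz.
Qed.

Lemma mulz_ext (al : C) (a a' : nat -> C) (n : nat) :
  (forall k, (k <= n)%nat -> a k = a' k) -> mulz al a n = mulz al a' n.
Proof. intros H; unfold mulz; destruct n as [|n]; rewrite !H by lia; reflexivity. Qed.

Fixpoint taylor (al : C) (p : poly) (n : nat) : C :=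
  match p with [] => 0 | c :: p' => monomial c 0 n + mulz al (taylor al p') n end.

Lemma Cser_taylor (al : C) (p : poly) (u : C) :
  Cser (fun n => taylor al p n * u ^ n) (peval p (al + u)).
Proof.
  induction p as [|c p IH].
  - apply Cser_first; [simpl; ring|intros; simpl; ring].
  - simpl peval; assert (H := Cser_monomial c u 0); rewrite Cmult_1_r in H.
    apply is_series_ext with (2 := Cser_plus _ _ _ _ H (Cser_mulz al _ _ _ IH)); intros n.
    symmetry; apply Cmult_plus_distr_r.
Qed.

Lemma expands_taylor (al : C) (p : poly) : expands (taylor al p) al (peval p).
Proof.
  apply near_true; intros z; assert (H := Cser_taylor al p (z - al)).
  replace (al + (z - al)) with z in H by ring; exact H.
Qed.

Lemma derive_n_taylor (al : C) (p : poly) (j : nat) :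
  derive_n j (peval p) al = Cfact j * taylor al p j.
Proof.
  apply (derive_n_coef (taylor al p) al 1 (peval p) j Rlt_0_1); intros z _.
  assert (H := Cser_taylor al p (z - al)); replace (al + (z - al)) with z in H by ring; exact H.
Qed.

Lemma taylor_padd (al : C) (p q : poly) (n : nat) : taylor al (padd p q) n = taylor al p n + taylor al q n.
Proof.
  apply (expands_unique _ (fun n => taylor al p n + taylor al q n) al (peval (padd p q)) (expands_taylor _ _)).
  apply expands_ext with (2 := expands_plus _ _ _ _ _ (expands_taylor al p) (expands_taylor al q)).
  apply near_true; intros z; symmetry; apply peval_padd.
Qed.

Lemma taylor_pmul (al : C) (p q : poly) (n : nat) : taylor al (pmul p q) n = conv (taylor al p) (taylor al q) n.
Proof.
  apply (expands_unique _ _ al (peval (pmul p q)) (expands_taylor _ _)).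
  apply expands_ext with (2 := expands_mult _ _ _ _ _ (expands_taylor al p) (expands_taylor al q)).
  apply near_true; intros z; symmetry; apply peval_pmul.
Qed.

Lemma taylor_ppow (al : C) (p : poly) (k n : nat) : taylor al (ppow p k) n = conv_pow (taylor al p) k n.
Proof.
  revert n; induction k as [|k IH]; intros n.
  - simpl; unfold monomial, mulz; destruct n as [|n]; simpl; [ring|].
    destruct n; ring.
  - simpl; rewrite taylor_pmul; apply Csum_ext; intros i _; rewrite IH; reflexivity.
Qed.

Lemma conv_pow_leading (b : nat -> C) (n : nat) : b 0%nat = 0 -> conv_pow b n n = b 1%nat ^ n.
Proof.
  intros Hb; induction n as [|n IH]; [reflexivity|].
  change (conv_pow b (S n) (S n)) with (Csum (fun k => b k * conv_pow b n (S n - k)%nat) (S n)).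
  rewrite Csum_shift, Hb.
  destruct n as [|n].
  - rewrite Csum_O; simpl; ring.
  - rewrite Csum_shift, Csum_zero.
    + replace (S (S n) - 1)%nat with (S n) by lia; rewrite IH; simpl; ring.
    + intros k Hk; rewrite conv_pow_order by (auto; lia); ring.
Qed.

Lemma taylor_one_minus_sq (b : bool) :
  taylor (branch b) one_minus_sq 0 = 0 /\ taylor (branch b) one_minus_sq 1 = - (2) * branch b.
Proof.
  unfold one_minus_sq; simpl; unfold monomial, mulz; simpl; split.
  - transitivity (1 + -1 * (branch b * branch b)); [ring|rewrite branch_sq; ring].
  - ring.
Qed.

Lemma conv_order (a b : nat -> C) (n m : nat) :
  (forall j, (j < m)%nat -> b j = 0) -> (n <= m)%nat -> conv a b n = a 0%nat * b n.
Proof.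
  intros H Hn; unfold conv; destruct n as [|n]; [rewrite Csum_O; reflexivity|].
  rewrite Csum_shift, Csum_zero; [rewrite Nat.sub_0_r; ring|].
  intros k Hk; rewrite H by lia; ring.
Qed.

(** * Hermite interpolation at [1] and [-1] *)

Definition interp_term (a c : nat -> C) (k : nat) : poly := pmul [a k; c k] (ppow one_minus_sq k).

(** [1 - z^2] has simple zeros at both branch points, with derivative [- 2 branch b]. The
    interpolation conditions are thus triangular in [k]. *)
Lemma taylor_interp_term (b : bool) (a c : nat -> C) (k j : nat) : (j <= k)%nat ->
  taylor (branch b) (interp_term a c k) j =
  if (j =? k)%nat then (a k + c k * branch b) * (- (2) * branch b) ^ k else 0.
Proof.
  intros Hj; unfold interp_term; rewrite taylor_pmul.
  destruct (taylor_one_minus_sq b) as [H0 H1].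
  rewrite (conv_order _ _ j k); [|intros i Hi; rewrite taylor_ppow; apply conv_pow_order; assumption|exact Hj].
  rewrite taylor_ppow; destruct (Nat.eqb_spec j k) as [->|Hne].
  - rewrite conv_pow_leading, H1 by exact H0; f_equal; simpl; unfold monomial, mulz; simpl; ring.
  - rewrite conv_pow_order by (auto; lia); ring.
Qed.

Lemma taylor_fold_padd (al : C) (l : list poly) (n : nat) :
  taylor al (fold_right padd [] l) n = csum (map (fun p => taylor al p n) l).
Proof. induction l as [|p l IH]; [reflexivity|]; simpl; rewrite taylor_padd, IH; reflexivity. Qed.

(** A new term leaves all lower orders unchanged, and its two scalars solve the two conditions of
    the new order. *)
Lemma hermite_interpolation (T : bool -> nat -> C) (N : nat) :
  exists a c : nat -> C, forall b j, (j <= N)%nat ->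
    taylor (branch b) (fold_right padd [] (map (interp_term a c) (seq 0 (S N)))) j = T b j.
Proof.
  assert (Hstep : forall (e : bool -> C) k, exists a c : C, forall b, (a + c * branch b) * (- (2) * branch b) ^ k = e b).
  { intros e k; set (d := fun b => e b / (- (2) * branch b) ^ k).
    (* Solves [a + c = d true] and [a - c = d false]. *)
    exists ((d true + d false) / 2), ((d true - d false) / 2); intros b.
    assert (Hb : - (2) * branch b <> 0).
    { intros E; apply Cmult_integral in E; destruct E as [E|E]; [|exact (branch_neq_0 b E)].
      injection E; lra. }
    transitivity (d b * (- (2) * branch b) ^ k).
    - f_equal; destruct b; simpl; field.
    - unfold d; field; apply Cpow_nz, Hb. }
  induction N as [|N [a [c IH]]].
  - destruct (Hstep (fun b => T b 0%nat) 0%nat) as [a0 [c0 H]].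
    exists (fun _ => a0), (fun _ => c0); intros b j Hj; assert (j = 0%nat) by lia; subst j.
    rewrite taylor_fold_padd.
    change (taylor (branch b) (interp_term (fun _ => a0) (fun _ => c0) 0) 0 + 0 = T b 0%nat).
    rewrite taylor_interp_term by lia.
    simpl Nat.eqb; cbv iota; rewrite H; ring.
  - destruct (Hstep (fun b => T b (S N) - csum (map (fun p => taylor (branch b) p (S N)) (map (interp_term a c) (seq 0 (S N))))) (S N)) as [a0 [c0 H]].
    exists (fun k => if (k =? S N)%nat then a0 else a k), (fun k => if (k =? S N)%nat then c0 else c k).
    intros b j Hj; rewrite taylor_fold_padd, seq_S, !map_app, csum_app.
    rewrite (map_ext_in _ (interp_term a c)).
    2:{ intros k Hk; apply in_seq in Hk; unfold interp_term.
        replace (k =? S N)%nat with false by (symmetry; apply Nat.eqb_neq; lia); reflexivity. }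
    set (a' := fun k => if (k =? S N)%nat then a0 else a k).
    set (c' := fun k => if (k =? S N)%nat then c0 else c k).
    change (csum (map (fun p => taylor (branch b) p j) (map (interp_term a' c') [(0 + S N)%nat])))
      with (taylor (branch b) (interp_term a' c' (S N)) j + 0).
    rewrite taylor_interp_term by exact Hj; unfold a', c'.
    rewrite Nat.eqb_refl; destruct (Nat.eqb_spec j (S N)) as [->|Hne].
    + rewrite H; ring.
    + rewrite <- taylor_fold_padd, IH by lia; ring.
Qed.

(** Hermite interpolation provides a polynomial meeting the specification, so the chosen one meets
    it; equal derivatives are then divided by [j!]. *)
Lemma truncation_taylor (y : C -> C) (a : bool -> nat -> C) (N j : nat) (b : bool) :
  (forall b, exists r, (0 < r)%R /\ forall z, (Cmod (z - branch b) < r)%R -> Cser (fun n => a b n * (z - branch b) ^ n) (y z)) ->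
  (j <= N)%nat -> taylor (branch b) (truncation y N) j = a b j.
Proof.
  intros Hy Hj.
  assert (Hd : forall b j, derive_n j y (branch b) = Cfact j * a b j).
  { intros b' j'; destruct (Hy b') as [r [Hr H]]; apply (derive_n_coef (a b') _ r y j' Hr H). }
  assert (Ht : is_truncation y N (truncation y N)).
  { unfold truncation; apply epsilon_spec.
    destruct (hermite_interpolation a N) as [s [c H]].
    exists (fold_right padd [] (map (interp_term s c) (seq 0 (S N)))); split; [exists s, c; reflexivity|].
    intros i Hi; split.
    - change (RtoC 1) with (branch true); rewrite derive_n_taylor, H, Hd by exact Hi; reflexivity.
    - change (RtoC (-1)) with (branch false); rewrite derive_n_taylor, H, Hd by exact Hi; reflexivity. }
  destruct Ht as [_ Ht]; destruct (Ht j Hj) as [H1 H2].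
  assert (H : derive_n j (peval (truncation y N)) (branch b) = derive_n j y (branch b)) by (destruct b; assumption).
  rewrite derive_n_taylor, Hd in H.
  replace (taylor (branch b) (truncation y N) j) with (/ Cfact j * (Cfact j * taylor (branch b) (truncation y N) j))
    by (field; apply Cfact_neq_0).
  rewrite H; field; apply Cfact_neq_0.
Qed.

(** The sum of [phi k (z - al)^k] for [k <= n], in Horner form. *)
Fixpoint jet_poly (al : C) (phi : nat -> C) (n : nat) : poly :=
  match n with
  | O => [phi 0%nat]
  | S n' => padd [phi 0%nat] (pmul [- al; RtoC 1] (jet_poly al (fun k => phi (S k)) n'))
  end.

Lemma taylor_jet_poly (al : C) (phi : nat -> C) (n j : nat) : (j <= n)%nat -> taylor al (jet_poly al phi n) j = phi j.
Proof.
  revert phi j; induction n as [|n IH]; intros phi j Hj.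
  - assert (j = 0%nat) by lia; subst; simpl; unfold monomial, mulz; simpl; ring.
  - change (jet_poly al phi (S n)) with (padd [phi 0%nat] (pmul [- al; RtoC 1] (jet_poly al (fun k => phi (S k)) n))).
    rewrite taylor_padd, taylor_pmul.
    assert (E : forall q i, conv (taylor al [- al; RtoC 1]) q i = match i with O => 0 | S i' => q i' end).
    { intros q i; unfold conv; destruct i as [|i].
      - rewrite Csum_O; simpl; unfold monomial, mulz; simpl; ring.
      - rewrite Csum_shift; destruct i as [|i].
        + rewrite Csum_O; simpl; unfold monomial, mulz; simpl; ring.
        + rewrite Csum_shift, Csum_zero.
          * replace (S (S i) - 1)%nat with (S i) by lia; simpl; unfold monomial, mulz; simpl; ring.
          * intros k Hk; simpl; unfold monomial, mulz; simpl; destruct k; ring. }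
    rewrite E; destruct j as [|j].
    + simpl; unfold monomial, mulz; simpl; ring.
    + rewrite IH by lia; simpl; unfold monomial, mulz; simpl; destruct j; ring.
Qed.

(** * Shift polynomials acting on quasi-polynomials *)

(** The operator [D - al]. *)
Definition twist_diff (al : C) (f : Z -> C) (m : Z) : C := f (m + 1)%Z - al * f m.

Fixpoint twist_diff_n (al : C) (i : nat) (f : Z -> C) : Z -> C :=
  match i with O => f | S i' => twist_diff al (twist_diff_n al i' f) end.

Lemma twist_diff_n_plus (al c d : C) (i : nat) (f g : Z -> C) (m : Z) :
  twist_diff_n al i (fun m => c * f m + d * g m) m = c * twist_diff_n al i f m + d * twist_diff_n al i g m.
Proof. revert m; induction i as [|i IH]; intros m; [reflexivity|]; simpl; unfold twist_diff; rewrite !IH; ring. Qed.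

Lemma twist_diff_n_succ (al : C) (i : nat) (f : Z -> C) (m : Z) :
  twist_diff_n al i (fun m => f (m + 1)%Z) m = twist_diff_n al i f (m + 1)%Z.
Proof. revert m; induction i as [|i IH]; intros m; [reflexivity|]; simpl; unfold twist_diff; rewrite !IH; ring. Qed.

Lemma twist_diff_n_zero (al : C) (i j : nat) (f : Z -> C) :
  (i <= j)%nat -> (forall m, twist_diff_n al i f m = 0) -> forall m, twist_diff_n al j f m = 0.
Proof.
  intros Hij H; induction Hij as [|j Hij IH]; [exact H|]; intros m; simpl; unfold twist_diff; rewrite !IH; ring.
Qed.

Lemma taylor_length (al : C) (p : poly) (n : nat) : (length p <= n)%nat -> taylor al p n = 0.
Proof.
  revert n; induction p as [|c p IH]; intros n Hn; [reflexivity|].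
  simpl in *; unfold monomial, mulz; destruct n as [|n]; [lia|]; simpl; rewrite !IH by lia; ring.
Qed.

(** Taylor's formula for [p(D)] around [D = al]. *)
Lemma pD_taylor (al : C) (p : poly) (f : Z -> C) (m : Z) (L : nat) : (length p <= L)%nat ->
  pD p f m = Csum (fun i => taylor al p i * twist_diff_n al i f m) L.
Proof.
  revert f m; induction p as [|c p IH]; intros f m HL.
  - rewrite Csum_zero; [reflexivity|]; intros; simpl; ring.
  - simpl in HL |- *.
    transitivity (c * f m + pD p (fun m => f (m + 1)%Z) m).
    { f_equal; clear; revert m; induction p as [|d p IH]; intros m; [reflexivity|]; simpl; rewrite IH; reflexivity. }
    rewrite IH by lia.
    transitivity (c * f m + (Csum (fun i => al * taylor al p i * twist_diff_n al i f m) L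
                   + Csum (fun i => taylor al p i * twist_diff_n al (S i) f m) L)).
    { f_equal; rewrite <- Csum_plus; apply Csum_ext; intros i _; rewrite twist_diff_n_succ; simpl; unfold twist_diff; ring. }
    destruct L as [|L]; [lia|].
    rewrite (Csum_S (fun i => taylor al p i * twist_diff_n al (S i) f m) L), (taylor_length al p (S L)) by lia.
    rewrite !(Csum_shift _ L).
    transitivity (c * f m + al * taylor al p 0%nat * f m +
      (Csum (fun k => al * taylor al p (S k) * twist_diff_n al (S k) f m) L
       + Csum (fun i => taylor al p i * twist_diff_n al (S i) f m) L)); [simpl; ring|].
    f_equal; [unfold monomial, mulz; simpl; ring|].
    rewrite <- Csum_plus; apply Csum_ext; intros i _; unfold monomial, mulz; simpl; ring.
Qed.

(** Around [D = al], [p(D)] only contains powers [(D - al)^i] with [i >= K]. *)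
Lemma pD_zero (al : C) (p : poly) (f : Z -> C) (m : Z) (K : nat) :
  (forall i, (i < K)%nat -> taylor al p i = 0) -> (forall m, twist_diff_n al K f m = 0) -> pD p f m = 0.
Proof.
  intros Hp Hf; rewrite (pD_taylor al p f m (length p) (Nat.le_refl _)); apply Csum_zero; intros i _.
  destruct (Nat.lt_ge_cases i K) as [Hi|Hi]; [rewrite Hp by exact Hi; ring|].
  rewrite (twist_diff_n_zero al K i f Hi Hf); ring.
Qed.

(** Leibniz rule: the commutator of [D - al] with multiplication by [m] is [D]. *)
Lemma twist_diff_n_mul_id (al : C) (i : nat) (f : Z -> C) (m : Z) :
  twist_diff_n al (S i) (fun m => RtoC (IZR m) * f m) m =
  RtoC (IZR m) * twist_diff_n al (S i) f m + CN (S i) * twist_diff_n al i f (m + 1)%Z.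
Proof.
  revert m; induction i as [|i IH]; intros m.
  - simpl; unfold twist_diff; rewrite plus_IZR, RtoC_plus; unfold CN; simpl; ring.
  - change (twist_diff al (twist_diff_n al (S i) (fun m => RtoC (IZR m) * f m)) m =
      RtoC (IZR m) * twist_diff al (twist_diff_n al (S i) f) m + CN (S (S i)) * twist_diff al (twist_diff_n al i f) (m + 1)%Z).
    unfold twist_diff at 1; rewrite !IH, plus_IZR, RtoC_plus, (CN_S (S i)).
    simpl twist_diff_n; unfold twist_diff; ring.
Qed.

(** [D - branch b] annihilates [branch b ^ m], and each multiplication by [m] costs one more power;
    [qpoly k] has degree [2 k] in [m]. *)
Lemma twist_diff_basisN (b : bool) (k : nat) (m : Z) : twist_diff_n (branch b) (2 * k + 1) (basisN b k) m = 0.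
Proof.
  set (f := fun k m => parity b m * peval (qpoly k) (RtoC (IZR (m * m)))).
  assert (Hf : forall k m, twist_diff_n (branch b) (2 * k + 1) (f k) m = 0).
  { clear k m; intros k; induction k as [|k IH]; intros m.
    - unfold f; simpl; unfold twist_diff, parity; rewrite Z.even_add; destruct (Z.even m); simpl; [ring|].
      transitivity (1 - branch b * branch b); [ring|rewrite branch_sq; ring].
    - replace (2 * S k + 1)%nat with (S (S (2 * k + 1))) by lia.
      replace (f (S k)) with (fun m => 1 * (RtoC (IZR m) * (RtoC (IZR m) * f k m)) + - (CN (S k) * CN (S k)) * f k m).
      2:{ apply functional_extensionality; intros n; unfold f.
          change (qpoly (S k)) with (pmul [- (CN (S k) * CN (S k)); RtoC 1] (qpoly k)).
          rewrite peval_pmul, mult_IZR, RtoC_mult; simpl peval; ring. }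
      rewrite twist_diff_n_plus, (twist_diff_n_mul_id _ (S (2 * k + 1)) (fun m => RtoC (IZR m) * f k m)).
      assert (H2 : forall n, twist_diff_n (branch b) (S (2 * k + 1)) (fun m => RtoC (IZR m) * f k m) n = 0).
      { intros n; rewrite twist_diff_n_mul_id, IH, (twist_diff_n_zero _ (2 * k + 1) (S (2 * k + 1)) (f k)) by (auto; lia); ring. }
      rewrite H2, (twist_diff_n_zero _ (S (2 * k + 1)) (S (S (2 * k + 1))) (fun m => RtoC (IZR m) * f k m)) by (auto; lia).
      rewrite (twist_diff_n_zero _ (2 * k + 1) (S (S (2 * k + 1))) (f k)) by (auto; lia); ring. }
  replace (basisN b k) with (fun m => (branch b ^ S k / Cfact (2 * k + 1)) * f k m + 0 * f k m).
  - rewrite twist_diff_n_plus, Hf; ring.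
  - apply functional_extensionality; intros n; unfold basisN, f; unfold Cdiv; ring.
Qed.

(** * Residues against a primitive of [y dx] *)

Fixpoint pow_coef (al : C) (n : nat) : nat -> C :=
  match n with O => monomial 1 0 | S n' => mulz al (pow_coef al n') end.

Lemma expands_z_pow (al : C) (n : nat) : expands (pow_coef al n) al (fun z => z ^ n).
Proof.
  induction n as [|n IH].
  - apply expands_ext with (2 := expands_monomial 1 al 0); apply near_true; intros z; simpl; ring.
  - apply (expands_mulz al _ _ IH).
Qed.

(** Binomial theorem. As [branch b ^ 2 = 1], the exponent [n + m] stands for [n - m], which avoids
    truncated subtraction. *)
Lemma pow_coef_eq (b : bool) (n m : nat) :
  pow_coef (branch b) n m = branch b ^ (n + m) * (falling (CN n) m / Cfact m).
Proof.
  revert m; induction n as [|n IH]; intros m.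
  - destruct m as [|m]; simpl pow_coef; unfold monomial; simpl Nat.eqb; cbv iota.
    + unfold Cfact, CN; simpl; field.
    + rewrite falling_nat_zero by lia; unfold Cdiv; ring.
  - simpl pow_coef; unfold mulz; rewrite IH; destruct m as [|m].
    + simpl; rewrite !Nat.add_0_r; unfold Cdiv; ring.
    + rewrite IH, (CN_S n), falling_pascal, Cfact_S.
      replace (S n + S m)%nat with (n + m + 2 * 1)%nat by lia; rewrite branch_pow_add_even.
      replace (n + S m)%nat with (S (n + m)) by lia; rewrite Cpow_S.
      transitivity (branch b * branch b * branch b ^ (n + m) * (falling (CN n) (S m) / (CN (S m) * Cfact m))
        + branch b ^ (n + m) * (falling (CN n) m / Cfact m)); [ring|].
      rewrite branch_sq; field; split; [apply Cfact_neq_0|apply CN_neq_0; lia].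
Qed.

Lemma is_residue_basis (Phi : C -> C) (phi : nat -> C) (b : bool) (k : nat) :
  expands phi (branch b) Phi ->
  is_residue (fun z => Phi z * basis b k z) (branch b) (conv phi (pow_coef (branch b) k) (2 * k + 1)).
Proof.
  intros H; assert (H1 := expands_mult _ _ _ _ _ H (expands_z_pow (branch b) k)).
  apply (expands_pole_residue (S (2 * k + 1))).
  apply expands_ext with (2 := H1); apply near_imp with (1 := near_self (branch b)); intros z Hz.
  unfold basis; replace (2 * k + 2)%nat with (S (2 * k + 1)) by lia.
  field; apply Cpow_nz, Hz.
Qed.

Lemma is_residue_basis_other (Phi : C -> C) (phi : nat -> C) (b b' : bool) (k : nat) :
  b <> b' -> expands phi (branch b) Phi -> is_residue (fun z => Phi z * basis b' k z) (branch b) 0.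
Proof.
  intros Hb H.
  assert (Hs : expands (fun n => monomial (branch b + branch b) 0 n + monomial 1 1 n) (branch b) (fun z => z - branch b')).
  { apply expands_ext with (2 := expands_plus _ _ _ _ _ (expands_monomial (branch b + branch b) (branch b) 0)
      (expands_monomial 1 (branch b) 1)).
    apply near_true; intros z; assert (E : branch b' = - branch b) by (destruct b, b'; try congruence; simpl; ring).
    rewrite E; simpl; ring. }
  assert (Hi := expands_inv (fun n => monomial (branch b + branch b) 0 n + monomial 1 1 n) (branch b * / 2) _ _
    ltac:(unfold monomial; simpl; transitivity (branch b * branch b); [field|apply branch_sq]) Hs).
  eapply is_residue_holomorphic.
  apply expands_ext with (2 := expands_mult _ _ _ _ _ H
    (expands_mult _ _ _ _ _ (expands_z_pow (branch b) k) (expands_pow _ _ _ (2 * k + 2) Hi))).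
  apply near_imp with (1 := near_regular b); intros z Hz; unfold basis, Cdiv.
  rewrite Cpow_inv by apply Hz; reflexivity.
Qed.

Definition weighted (f : Z -> C) (m : Z) : C := RtoC (IZR m) * f m.

(** The left side is the residue of [h(z) z^j] against [basis b k]. For a monomial it is [m N(m)],
    by [pow_coef_eq] and [basisN_nat]; the offset [j] carries the induction on [h]. *)
Lemma conv_taylor_pow (b : bool) (k : nat) (h : poly) (j : nat) :
  conv (taylor (branch b) h) (pow_coef (branch b) (k + j)) (2 * k + 1) = pD h (weighted (basisN b k)) (Z.of_nat j).
Proof.
  revert j; induction h as [|c h IH]; intros j.
  - apply Csum_zero; intros; simpl; ring.
  - simpl pD; replace (Z.of_nat j + 1)%Z with (Z.of_nat (S j)) by lia; rewrite <- IH.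
    replace (k + S j)%nat with (S (k + j)) by lia.
    transitivity (c * pow_coef (branch b) (k + j) (2 * k + 1) + conv (taylor (branch b) h) (pow_coef (branch b) (S (k + j))) (2 * k + 1)).
    + apply (expands_unique _ (fun i => c * pow_coef (branch b) (k + j) i + conv (taylor (branch b) h) (pow_coef (branch b) (S (k + j))) i)
        (branch b) (fun z => peval (c :: h) z * z ^ (k + j))).
      * apply expands_mult; [apply expands_taylor|apply expands_z_pow].
      * apply expands_ext with (2 := expands_plus _ _ _ _ _ (expands_scal c _ _ _ (expands_z_pow (branch b) (k + j)))
          (expands_mult _ _ _ _ _ (expands_taylor (branch b) h) (expands_z_pow (branch b) (S (k + j))))).
        apply near_true; intros z; simpl; ring.
    + f_equal; f_equal; unfold weighted.
      rewrite <- CN_IZR, basisN_nat, pow_coef_eq, (Nat.add_comm k j).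
      replace (j + k + (2 * k + 1))%nat with (j + S k + 2 * k)%nat by lia.
      rewrite branch_pow_add_even; reflexivity.
Qed.

(* For [j = 0] this is [z h'(z)]. *)
Fixpoint index_mul (j : Z) (h : poly) : poly :=
  match h with [] => [] | c :: h' => (RtoC (IZR j) * c) :: index_mul (j + 1) h' end.

Lemma pD_index_mul (f : Z -> C) (h : poly) (j : Z) : pD (index_mul j h) f j = pD h (weighted f) j.
Proof. revert j; induction h as [|c h IH]; intros j; [reflexivity|]; simpl; rewrite IH; unfold weighted; ring. Qed.

Lemma mulz_der (al : C) (a : nat -> C) (i : nat) :
  mulz al (der_coef a) i = al * (CN (S i) * a (S i)) + CN i * a i.
Proof. unfold mulz, der_coef; destruct i; [rewrite CN_0; unfold CN; ring|reflexivity]. Qed.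

(** [index_mul j h] represents [j h + z h']. *)
Lemma taylor_index_mul (al : C) (h : poly) (j : Z) (i : nat) :
  taylor al (index_mul j h) i = RtoC (IZR j) * taylor al h i + mulz al (der_coef (taylor al h)) i.
Proof.
  revert j i; induction h as [|c h IH]; intros j i.
  - rewrite mulz_der; simpl; ring.
  - rewrite mulz_der; simpl taylor; unfold mulz; rewrite !IH, !mulz_der, !plus_IZR, !RtoC_plus.
    destruct i as [|i]; unfold monomial; simpl Nat.eqb; cbv iota.
    + rewrite !CN_S, CN_0; ring.
    + rewrite IH, mulz_der, !plus_IZR, !RtoC_plus, !CN_S; ring.
Qed.

(** [Phi] is only given as differentiable. Integrating the series of [y dx] term by term yields a
    primitive [Psi], and [Phi - Psi] is constant. The relation is [z^2 Phi' + (1 - z^2) y = 0] on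
    coefficients. *)
Lemma primitive_expands (y Phi : C -> C) (a : nat -> C) (b : bool) :
  expands a (branch b) y -> local_primitive y Phi (branch b) ->
  exists phi, expands phi (branch b) Phi /\ forall i,
    mulz (branch b) (mulz (branch b) (der_coef phi)) i + conv (taylor (branch b) one_minus_sq) a i = 0.
Proof.
  intros Ha [r [Hr HPhi]]; set (al := branch b) in *.
  set (ih := fun n => monomial al 0 n + hat_coef al n).
  set (d := fun n => monomial 1 0 n + -1 * conv ih ih n).
  assert (Hd : expands d al dx).
  { apply expands_ext with (2 := expands_plus _ _ _ _ _ (expands_monomial 1 al 0)
      (expands_scal (-1) _ _ _ (expands_mult _ _ _ _ _ (expands_inv_z b) (expands_inv_z b)))).
    apply near_imp with (1 := near_branch_neq_0 b); intros z Hz; rewrite dx_eq by exact Hz; simpl; field; exact Hz. }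
  set (ga := conv a d).
  assert (Hga : expands ga al (fun z => y z * dx z)) by (apply expands_mult; assumption).
  assert (Hga0 : ga 0%nat = 0).
  { unfold ga, d, ih, conv; rewrite !Csum_O; unfold monomial; simpl.
    transitivity (a 0%nat * (1 - al * al)); [ring|unfold al; rewrite branch_sq; ring]. }
  destruct (expands_radius _ _ _ Hga) as [r' [Hr' [Ab Hga']]].
  set (phi0 := fun n => match n with O => RtoC 0 | S n' => ga n' / CN n end).
  assert (Hder : forall n, der_coef phi0 n = ga n).
  { intros n; unfold der_coef, phi0; fold (CN (S n)); field; apply CN_neq_0; lia. }
  assert (Ab0 : absconv phi0 r').
  { apply ex_series_incr_1.
    destruct Ab as [s Hs].
    refine (ex_series_le (K:=R_AbsRing) (V:=R_CompleteNormedModule) _ _ _ (ex_intro _ _ (is_series_scal r' _ _ Hs))).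
    intros n; unfold norm; simpl; unfold abs; simpl.
    rewrite Rabs_pos_eq by (apply Rmult_le_pos; [apply Cmod_ge_0|apply Rmult_le_pos; [lra|apply pow_le; lra]]).
    unfold scal; simpl; unfold mult; simpl.
    assert (Hle : (Cmod (ga n / CN (S n)) <= Cmod (ga n))%R).
    { unfold Cdiv; rewrite Cmod_mult, Cmod_inv by (apply CN_neq_0; lia); unfold CN.
      rewrite Cmod_R, Rabs_pos_eq by apply pos_INR.
      rewrite <- (Rmult_1_r (Cmod (ga n))) at 2; apply Rmult_le_compat_l; [apply Cmod_ge_0|].
      rewrite <- Rinv_1; apply Rinv_le_contravar; [lra|]; rewrite S_INR; pose proof (pos_INR n); lra. }
    assert (0 <= r' * r' ^ n)%R by (apply Rmult_le_pos; [lra|apply pow_le; lra]).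
    nra. }
  set (Psi := fun z => epsilon (inhabits (RtoC 0)) (Cser (fun n => phi0 n * (z - al) ^ n))).
  assert (HPsi : forall z, (Cmod (z - al) < r')%R -> Cser (fun n => phi0 n * (z - al) ^ n) (Psi z)).
  { intros z Hz; unfold Psi; apply epsilon_spec.
    apply Cser_abs, absconv_term with r'; [exact Ab0|lra]. }
  assert (Hsub : forall z, (Cmod (z - al) < Rmin r r')%R -> Cderive (fun w => Phi w + -1 * Psi w) z (RtoC 0)).
  { intros z Hz; pose proof (Rmin_l r r'); pose proof (Rmin_r r r').
    destruct (Cser_derive _ _ _ _ HPsi z ltac:(lra)) as [l [H1 H2]].
    (* [expands] gives nothing at the centre; there both sides vanish, by [ga 0 = 0] and
       [dx al = 0]. *)
    assert (El : l = y z * dx z).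
    { destruct (Ceq_dec (z - al) 0) as [E|E].
      - assert (Ez : z = al) by (replace z with (z - al + al) by ring; rewrite E; ring).
        rewrite E in H1; transitivity (RtoC 0).
        + apply (Cser_unique _ _ _ H1); apply Cser_first; [change (der_coef phi0 0 * 0 ^ 0 = 0); rewrite Hder, Hga0; ring|
            intros n; change (der_coef phi0 (S n) * (0 * 0 ^ n) = 0); ring].
        + rewrite Ez, dx_eq by apply branch_neq_0.
          replace (/ al ^ 2) with (RtoC 1); [ring|].
          replace (al ^ 2) with (RtoC 1) by (simpl; rewrite Cmult_1_r; symmetry; apply branch_sq); field.
      - apply (Cser_unique _ _ _ H1).
        assert (Hp : (0 < Cmod (z - al))%R) by (apply Cmod_gt_0; exact E).
        apply is_series_ext with (2 := Hga' z ltac:(lra)); intros n; rewrite Hder; reflexivity. }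
    assert (H3 := Cderive_plus _ _ _ _ _ (HPhi z ltac:(lra)) (Cderive_scal_r _ _ _ (-1) H2)).
    assert (E0 : y z * dx z + l * -1 = 0) by (rewrite El; ring).
    rewrite E0 in H3; apply is_derive_ext with (2 := H3); intros w; apply f_equal, Cmult_comm. }
  assert (Hc := Cderive_zero_const _ _ _ Hsub).
  set (c0 := Phi al + -1 * Psi al) in *.
  set (phi := fun n => monomial c0 0 n + phi0 n).
  assert (Hphi : expands phi al Phi).
  { apply expands_ext with (fun z => c0 * (z - al) ^ 0 + Psi z).
    - exists (Rmin r r'); split; [apply Rmin_glb_lt; assumption|]; intros z Hz; rewrite <- (Hc z) by lra; simpl; ring.
    - apply expands_plus; [apply expands_monomial|]; exists r'; split; [exact Hr'|]; intros z Hz; apply HPsi; lra. }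
  exists phi; split; [exact Hphi|].
  assert (Hderp : der_coef phi = ga).
  { apply functional_extensionality; intros n; rewrite <- Hder; unfold der_coef, phi, monomial; simpl; ring. }
  rewrite Hderp.
  apply (expands_zero_coef (fun i => mulz al (mulz al ga) i + conv (taylor al one_minus_sq) a i) al).
  apply expands_ext with (2 := expands_plus _ _ _ _ _ (expands_mulz _ _ _ (expands_mulz _ _ _ Hga))
    (expands_mult _ _ _ _ _ (expands_taylor al one_minus_sq) Ha)).
  apply near_imp with (1 := near_branch_neq_0 b); intros z Hz; rewrite dx_eq by exact Hz.
  unfold one_minus_sq; simpl; field; exact Hz.
Qed.

(* The polynomial [h] has the jet of [Phi], so that [z^2 h'] and [(z^2 - 1) p]
   agree to high order at [branch b]; hence their difference, taken at
   [z = D], annihilates [basisN b k]. *)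
Lemma residue_basis_pD (a phi : nat -> C) (p : poly) (b : bool) (k : nat) :
  (forall i, mulz (branch b) (mulz (branch b) (der_coef phi)) i + conv (taylor (branch b) one_minus_sq) a i = 0) ->
  (forall i, (i <= 2 * k)%nat -> taylor (branch b) p i = a i) ->
  conv phi (pow_coef (branch b) k) (2 * k + 1) = - pD (pmul one_minus_sq p) (basisN b k) (-1).
Proof.
  intros Hphi Hp; set (al := branch b) in *.
  (* The residue and the orders up to [2 * k] of [z^2 h'] only involve orders up to [2 * k + 1] of
     [Phi], which this jet covers. *)
  set (h := jet_poly al phi (2 * k + 2)).
  assert (Hh : forall j, (j <= 2 * k + 2)%nat -> taylor al h j = phi j) by (apply taylor_jet_poly).
  assert (E1 : conv phi (pow_coef al k) (2 * k + 1) = pD h (weighted (basisN b k)) 0).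
  { change 0%Z with (Z.of_nat 0); rewrite <- conv_taylor_pow, Nat.add_0_r.
    apply Csum_ext; intros i Hi; fold al; rewrite Hh by lia; reflexivity. }
  (* The polynomial is [z^2 h' + (1 - z^2) p]. The leading [0] is one factor [z]; it moves the
     starting index of [index_mul 0 h] from [-1] to [0]. *)
  assert (E2 : pD (padd (RtoC 0 :: index_mul 0 h) (pmul one_minus_sq p)) (basisN b k) (-1) = 0).
  { apply (pD_zero al _ _ _ (2 * k + 1)); [|apply twist_diff_basisN].
    intros i Hi; rewrite taylor_padd, taylor_pmul.
    apply eq_trans with (2 := Hphi i); f_equal.
    - assert (E0 : monomial 0 0 i = 0) by (unfold monomial; destruct (i =? 0)%nat; reflexivity).
      change (monomial 0 0 i + mulz al (taylor al (index_mul 0 h)) i = mulz al (mulz al (der_coef phi)) i).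
      rewrite E0, Cplus_0_l.
      apply mulz_ext; intros j Hj; rewrite taylor_index_mul, !mulz_der, !Hh by lia; ring.
    - apply Csum_ext; intros j Hj; rewrite Hp by lia; reflexivity. }
  assert (E3 : forall (q q' : poly) f m, pD (padd q q') f m = pD q f m + pD q' f m).
  { clear; intros q; induction q as [|c q IH]; intros [|c' q'] f m; simpl; try ring; rewrite IH; ring. }
  rewrite E3 in E2; simpl pD at 1 in E2; rewrite pD_index_mul, <- E1 in E2.
  replace (conv phi (pow_coef al k) (2 * k + 1)) with
    (0 * basisN b k (-1) + conv phi (pow_coef al k) (2 * k + 1) + pD (pmul one_minus_sq p) (basisN b k) (-1)
      - pD (pmul one_minus_sq p) (basisN b k) (-1)) by ring.
  rewrite E2; ring.
Qed.

(** * Linearity in [N] and the final summation *)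

Lemma pD_Csum (p : poly) (f : nat -> Z -> C) (c : nat -> C) (M : nat) (m : Z) :
  pD p (fun m => Csum (fun k => c k * f k m) M) m = Csum (fun k => c k * pD p (f k) m) M.
Proof.
  revert m; induction p as [|d p IH]; intros m; simpl.
  - symmetry; apply Csum_zero; intros; ring.
  - rewrite IH, <- Csum_scal, <- Csum_plus; apply Csum_ext; intros; ring.
Qed.

Lemma pD_plus (p : poly) (f f' : Z -> C) (m : Z) : pD p (fun m => f m + f' m) m = pD p f m + pD p f' m.
Proof. revert m; induction p as [|d p IH]; intros m; simpl; [ring|]; rewrite IH; ring. Qed.

Theorem corollary2 (U : C -> Prop) (y Phi : C -> C) (g : nat)
    (HU : is_domain U) (HU1 : U 1%C) (HUm1 : U (-1)%C)
    (Hy : forall z : C, U z -> analytic_at y z)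
    (Hdy1 : C_derive y 1%C <> 0%C) (Hdym1 : C_derive y (-1)%C <> 0%C)
    (Hg : (2 <= g)%nat)
    (HPhi1 : local_primitive y Phi 1%C)
    (HPhim1 : local_primitive y Phi (-1)%C) :
  eventually (fun N : nat =>
    symplectic_invariant y Phi g =
    (/ RtoC (2 - 2 * INR g)
       * pD (pmul one_minus_sq (truncation y N)) (N1 y g) (-1)%Z)%C).
Proof.
  assert (Hya : forall b, analytic_at y (branch b)) by (intros []; apply Hy; assumption).
  assert (Hdy : forall b, C_derive y (branch b) <> 0) by (intros []; assumption).
  assert (HPhi : forall b, local_primitive y Phi (branch b)) by (intros []; assumption).
  destruct (omega_one_expansion y g Hya Hdy ltac:(lia)) as [M [c Hom]].
  rewrite (N1_eq y g _ (is_N1_expansion y g M c Hom)).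
  (* The differential of index [k <= M] needs the Taylor coefficients of [y] up to order [2 * k]. *)
  exists (2 * M)%nat; intros N HN.
  set (p := truncation y N).
  assert (Hser : exists a : bool -> nat -> C, forall b, exists r, (0 < r)%R /\
      forall z, (Cmod (z - branch b) < r)%R -> Cser (fun n => a b n * (z - branch b) ^ n) (y z)).
  { destruct (analytic_at_series y _ (Hya true)) as [a1 H1]; destruct (analytic_at_series y _ (Hya false)) as [a2 H2].
    exists (fun b : bool => if b then a1 else a2); intros []; assumption. }
  destruct Hser as [a Ha].
  assert (Hres : forall b, is_residue (fun z => Phi z * omega y g [z]) (branch b)
     (Csum (fun k => c b k * - pD (pmul one_minus_sq p) (basisN b k) (-1)) M)).
  { intros b.
    assert (Hae : expands (a b) (branch b) y).
    { destruct (Ha b) as [r [Hr H]]; exists r; split; [exact Hr|]; intros z Hz; apply H; lra. }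
    destruct (primitive_expands y Phi (a b) b Hae (HPhi b)) as [phi [Hphi Hrel]].
    assert (H1 : is_residue (fun z => Csum (fun k => c b k * (Phi z * basis b k z)) M) (branch b)
       (Csum (fun k => c b k * - pD (pmul one_minus_sq p) (basisN b k) (-1)) M)).
    { apply (is_residue_Csum (fun k z => c b k * (Phi z * basis b k z))); intros k Hk; apply is_residue_scal.
      rewrite <- (residue_basis_pD (a b) phi p b k Hrel); [apply is_residue_basis, Hphi|].
      intros i Hi; apply truncation_taylor; [exact Ha|lia]. }
    (* The differentials attached to the other branch point are holomorphic here. *)
    assert (H2 : is_residue (fun z => Csum (fun k => c (negb b) k * (Phi z * basis (negb b) k z)) M) (branch b)
       (Csum (fun k => c (negb b) k * 0) M)).
    { apply (is_residue_Csum (fun k z => c (negb b) k * (Phi z * basis (negb b) k z))); intros k Hk; apply is_residue_scal.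
      apply (is_residue_basis_other Phi phi); [destruct b; discriminate|exact Hphi]. }
    assert (H3 := is_residue_plus _ _ _ _ _ H1 H2).
    rewrite (Csum_zero (fun k => c (negb b) k * 0)), Cplus_0_r in H3 by (intros; ring).
    apply is_residue_ext with (2 := H3); apply near_imp with (1 := near_regular b); intros z Hz.
    rewrite (Hom z Hz), Cmult_plus_distr_l, <- !Csum_scal.
    assert (Hx : forall b', Csum (fun k => c b' k * (Phi z * basis b' k z)) M = Csum (fun k => Phi z * (c b' k * basis b' k z)) M)
      by (intros b'; apply Csum_ext; intros; ring).
    rewrite !Hx; destruct b; simpl negb; [reflexivity|apply Cplus_comm]. }
  unfold symplectic_invariant, sum_Res.
  change (RtoC 1) with (branch true); change (RtoC (-1)) with (branch false).
  rewrite (Res_eq _ _ _ (Hres true)), (Res_eq _ _ _ (Hres false)).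
  unfold expansion_N; rewrite pD_plus, !pD_Csum.
  (* The sign common to all residues is what changes [2 g - 2] into [2 - 2 g]. *)
  assert (Hneg : forall b, Csum (fun k => c b k * - pD (pmul one_minus_sq p) (basisN b k) (-1)) M =
     -1 * Csum (fun k => c b k * pD (pmul one_minus_sq p) (basisN b k) (-1)) M).
  { intros b; rewrite <- Csum_scal; apply Csum_ext; intros; ring. }
  rewrite !Hneg.
  assert (Hg2 : (2 <= INR g)%R) by (change 2%R with (INR 2); apply le_INR; exact Hg).
  replace (2 - 2 * INR g)%R with (- (2 * INR g - 2))%R by ring.
  rewrite RtoC_opp.
  assert (Hne : RtoC (2 * INR g - 2) <> 0) by (intros E; apply RtoC_inj in E; lra).
  revert Hne; generalize (RtoC (2 * INR g - 2)); intros e He.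
  field; exact He.
Qed.
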